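(* Let $k,d\ge1$ be integers, $0<t_0<T$, $\beta\in\,]0,2\wedge k[$, and let $u=\{u(t,x),\ (t,x)\in[0,T]\times\mathbb{R}^k\}$ be the $\mathbb{R}^d$-valued solution of the linear stochastic wave system driven by spatially homogeneous Gaussian noise with spectral measure $\mu(d\xi)=\|\xi\|^{-k+\beta}d\xi$ (defined in the context). Let $I$, $J$ be compact subsets of $[t_0,T]$ and $\mathbb{R}^k$, respectively, each with positive Lebesgue measure. Fix $N>0$. Then: (1) there exists a positive constant $c=c(I,J,N,\beta,k,d)$ such that for any Borel set $A\subset[-N,N]^d$, $$P\{u(I\times J)\cap A\ne\varnothing\}\ge c\,\operatorname{Cap}_{d-\frac{2(k+1)}{2-\beta}}(A);$$ (2) for any $t\in I$, there exists a positive constant $c=c(J,N,\beta,k,d,t)$ such that for any Borel set $A\subset[-N,N]^d$, $$P\{u(\{t\}\times J)\cap A\ne\varnothing\}\ge c\,\operatorname{Cap}_{d-\frac{2k}{2-\beta}}(A);$$ (3) for any $x\in J$, there exists a positive constant $c=c(I,N,\beta,k,d,x)$ such that for any Borel set $A\subset[-N,N]^d$, $$P\{u(I\times\{x\})\cap A\ne\varnothing\}\ge c\,\operatorname{Cap}_{d-\frac{2}{2-\beta}}(A).$$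
   Context: The process $u$. Let $\sigma=(\sigma_{i,j})$ be a fixed deterministic invertible $d\times d$ matrix (constants may depend on it). $u=(u_1,\dots,u_d)$ is the solution of $$\frac{\partial^2u_i}{\partial t^2}(t,x)-\Delta u_i(t,x)=\sum_{j=1}^d\sigma_{i,j}\dot F^j(t,x),\qquad u_i(0,x)=\frac{\partial u_i}{\partial t}(0,x)=0,$$ where $\dot F=(\dot F^1,\dots,\dot F^d)$ has i.i.d. centered Gaussian components, white in time and spatially homogeneous, with $E(F^i(\varphi)F^i(\psi))=\int_{\mathbb{R}_+}dr\int_{\mathbb{R}^k}\mu(d\xi)\,\mathcal{F}\varphi(r,\cdot)(\xi)\,\overline{\mathcal{F}\psi(r,\cdot)(\xi)}$ for test functions $\varphi,\psi\in C_0^\infty(\mathbb{R}^{k+1})$, $\mathcal{F}$ denoting the Fourier transform in space. Here $\mu(d\xi)=\|\xi\|^{-k+\beta}d\xi$ (equivalently, spatial covariance a constant multiple of $\|x\|^{-\beta}$). The solution is the stochastic convolution $u_i(t,x)=\int_0^t\int_{\mathbb{R}^k}G(t-r,x-y)\sum_j\sigma_{i,j}M^j(dr,dy)$, where $G$ is the fundamental solution of the wave equation, with $\mathcal{F}G(t)(\xi)=\sin(t\|\xi\|)/\|\xi\|$, and $M=(M^1,\dots,M^d)$ is the martingale measure derived from $\dot F$. Equivalently, $u$ is the centered Gaussian random field with $$E(u_i(t,x)u_j(s,y))=(\sigma\sigma^{\mathsf T})_{i,j}\int_0^{t\wedge s}dr\int_{\mathbb{R}^k}\mu(d\xi)\,e^{\mathrm{i}\xi\cdot(x-y)}\,\frac{\sin((t-r)\|\xi\|)\sin((s-r)\|\xi\|)}{\|\xi\|^2},$$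 taken in its version with continuous sample paths. For a set $S\subset[0,T]\times\mathbb{R}^k$, $u(S)$ is its random image. Capacity. For $\gamma\in\mathbb{R}$, $r\ge0$: $K_\gamma(r)=r^{-\gamma}$ if $\gamma>0$; $K_0(r)=\log(c_*/r)$; $K_\gamma(r)=1$ if $\gamma<0$ (value $+\infty$ at $r=0$ when $\gamma\ge0$), where $c_*$ is a fixed constant chosen sufficiently large. With $\mathcal{P}(A)$ the set of probability measures on the Borel set $A\subset\mathbb{R}^d$ and $\mathcal{E}_\gamma(\mu)=\int_A\int_AK_\gamma(\|x-y\|)\mu(dx)\mu(dy)$, $\operatorname{Cap}_\gamma(A)=[\inf_{\mu\in\mathcal{P}(A)}\mathcal{E}_\gamma(\mu)]^{-1}$, with $1/\infty=0$. *)

(* Defs.v *)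
From HB Require Import structures.
From mathcomp Require Import all_boot all_order all_algebra.
From mathcomp Require Import all_classical all_reals all_analysis.
Set Implicit Arguments.
Unset Strict Implicit.
Unset Printing Implicit Defensive.
Import Order.TTheory GRing.Theory Num.Theory.
Import numFieldTopology.Exports numFieldNormedType.Exports.

Local Open Scope classical_set_scope.
Local Open Scope ring_scope.

Definition rV_display : measure_display. Proof. exact: default_measure_display. Qed.

Section borel_rV.
Context (R : realType) (n : nat).

Definition borel_rV : set (set 'rV[R]_n) := <<s open >>.

Let borel0 : borel_rV set0. Proof. exact: sigma_algebra0. Qed.

Let borelC A : borel_rV A -> borel_rV (~` A).
Proof. exact: sigma_algebraC. Qed.

Let borel_bigcup (F : (set 'rV[R]_n)^nat) :
  (forall i, borel_rV (F i)) -> borel_rV (\bigcup_i F i).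
Proof. exact: sigma_algebra_bigcup. Qed.

HB.instance Definition _ := @isMeasurable.Build rV_display 'rV[R]_n
  borel_rV borel0 borelC borel_bigcup.

Lemma open_measurable_rV (U : set 'rV[R]_n) : open U -> measurable U.
Proof. by move=> oU; exact: sub_sigma_algebra. Qed.

Lemma measurable_coord (i : 'I_n) :
  measurable_fun setT (fun v : 'rV[R]_n => v 0 i).
Proof.
apply: (measurability _ (measurable_realfun.RGenOpens.measurableE R)) => _ [_ [a [b ->] <-]].
rewrite setTI; apply: open_measurable_rV; apply: open_comp => //.
by move=> v _; exact: coord_continuous.
Qed.

Lemma measurable_rVP d (T : measurableType d) (f : T -> 'rV[R]_n) :
  (forall i, measurable_fun setT (fun x => f x 0 i)) -> measurable_fun setT f.
Proof.
move=> mf; apply: (@measurability _ _ _ _ _ _ (@open 'rV[R]_n)) => //.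
move=> _ [U oU <-]; rewrite setTI.
pose box (q : 'rV[rat]_n * 'rV[rat]_n) : set 'rV[R]_n :=
  [set v | forall i, v 0 i \in `]ratr (q.1 0 i), ratr (q.2 0 i)[].
have -> : U = \bigcup_q (if `[< box q `<=` U >] then box q else set0).
  apply/seteqP; split=> [v Uv|v [q _]]; last first.
    by case: ifPn => // /asboolP; exact.
  have /nbhs_ballP[e /= e0 eU] := open_nbhs_nbhs (conj oU Uv).
  have qa i : {q : rat | ratr q \in `](v 0 i - e), (v 0 i)[}.
    by apply/cid/rat_in_itvoo; rewrite ltrBlDr ltrDl.
  have qb i : {q : rat | ratr q \in `](v 0 i), (v 0 i + e)[}.
    by apply/cid/rat_in_itvoo; rewrite ltrDl.
  exists (\row_i projT1 (qa i), \row_i projT1 (qb i)) => //.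
  set q := (X in box X).
  have boxv : box q v.
    move=> i; rewrite in_itv/= !mxE.
    have := projT2 (qa i); have := projT2 (qb i).
    by rewrite !in_itv/= => /andP[-> _] /andP[_ ->].
  case: ifPn => // /asboolP []; apply: subset_trans eU => w boxw.
  split => // i j; rewrite (ord1 i); have := boxw j.
  rewrite in_itv/= !mxE.
  have := projT2 (qa j); have := projT2 (qb j).
  rewrite !in_itv/= => /andP[_ b1] /andP[a1 _] /andP[wa wb].
  rewrite /ball/= distrC ltr_distl.
  by rewrite (lt_trans a1 wa) (lt_trans wb b1).
rewrite preimage_bigcup; apply: countable_bigcupT_measurable => // q.
case: ifPn => _; last by rewrite preimage_set0.
have -> : f @^-1` box q = \bigcap_(i in [set: 'I_n])
    ((fun x => f x 0 i) @^-1` `]ratr (q.1 0 i), ratr (q.2 0 i)[).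
  by apply/seteqP; split=> [x h i _|x h i]; [exact: h|exact: (h i)].
apply: fin_bigcap_measurable => // i _.
by rewrite -[X in measurable X]setTI; exact: mf.
Qed.

End borel_rV.

Section lebesgue_step.
Context (R : realType) (n : nat).
Variable m : {sigma_finite_measure set 'rV[R]_n -> \bar R}.

Definition cons_rV (p : R * 'rV[R]_n) : 'rV[R]_(1 + n) := row_mx p.1%:M p.2.

Lemma cons_rV0 p : cons_rV p 0 (ord0 : 'I_n.+1) = p.1.
Proof.
rewrite (_ : (ord0 : 'I_n.+1) = lshift n (ord0 : 'I_1)); last exact/val_inj.
by rewrite row_mxEl mxE eqxx.
Qed.

Lemma cons_rVS p i : cons_rV p 0 (lift ord0 i : 'I_n.+1) = p.2 0 i.
Proof.
rewrite (_ : (lift ord0 i : 'I_n.+1) = rshift 1 i); last exact/val_inj.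
by rewrite row_mxEr.
Qed.

Lemma measurable_cons_rV : measurable_fun setT cons_rV.
Proof.
apply: measurable_rVP => i; case: (split_ordP i) => j ->.
  rewrite (_ : (fun x => _) = fst); first exact: measurable_fst.
  by apply/funext => x; rewrite row_mxEl (ord1 j) !mxE.
rewrite (_ : (fun x => _) = (fun v : 'rV[R]_n => v 0 j) \o snd).
  by apply: measurableT_comp => //; exact: measurable_coord.
by apply/funext => x; rewrite row_mxEr.
Qed.

Definition lebesgue_step : set 'rV[R]_(1 + n) -> \bar R :=
  pushforward (lebesgue_measure \x m)%E cons_rV.

Let step0 : lebesgue_step set0 = 0%E.
Proof. by rewrite /lebesgue_step /pushforward preimage_set0 measure0. Qed.

Let step_ge0 A : (0 <= lebesgue_step A)%E.
Proof. by rewrite /lebesgue_step /pushforward measure_ge0. Qed.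

Let step_sigma_additive : semi_sigma_additive lebesgue_step.
Proof.
move=> F mF tF mUF; rewrite /lebesgue_step /pushforward preimage_bigcup.
apply: measure_semi_sigma_additive.
- by move=> i; rewrite -[X in measurable X]setTI; exact: measurable_cons_rV.
- apply/trivIsetP => /= i j _ _ ij; rewrite -preimage_setI.
  by move/trivIsetP : tF => /(_ _ _ _ _ ij) ->//; rewrite preimage_set0.
- rewrite -preimage_bigcup -[X in measurable X]setTI.
  exact: measurable_cons_rV.
Qed.

HB.instance Definition _ := isMeasure.Build _ _ _ lebesgue_step
  step0 step_ge0 step_sigma_additive.

Let step_sigma_finite : sigma_finite setT lebesgue_step.
Proof.
pose l : {sigma_finite_measure set (measurableTypeR R) -> \bar R} :=
  lebesgue_measure.
have /sigma_finiteP[F [TF ndF Foo]] := sigma_finiteT l.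
have /sigma_finiteP[G [TG ndG Goo]] := sigma_finiteT m.
pose g (v : 'rV[R]_(1 + n)) : R * 'rV[R]_n := (lsubmx v 0 0, rsubmx v).
have gK : g \o cons_rV = id.
  by apply/funext => -[x v]; rewrite /g /cons_rV/= row_mxKl row_mxKr mxE eqxx.
have mg : measurable_fun setT g.
  apply: measurable_fun_pair.
    by under eq_fun do rewrite mxE; exact: measurable_coord.
  by apply: measurable_rVP => i; under eq_fun do rewrite mxE;
    exact: measurable_coord.
exists (fun i => g @^-1` (F i `*` G i)).
  rewrite -preimage_bigcup (_ : \bigcup_i _ = setT) ?preimage_setT//.
  apply/seteqP; split => // -[x y] _.
  have [i _ Fx] : (\bigcup_i F i) x by rewrite -TF.
  have [j _ Gy] : (\bigcup_i G i) y by rewrite -TG.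
  exists (maxn i j) => //; split => /=.
    by move: x Fx; exact/subsetPset/ndF/leq_maxl.
  by move: y Gy; exact/subsetPset/ndG/leq_maxr.
move=> i; have [mF Fi] := Foo i; have [mG Gi] := Goo i; split.
  by rewrite -[X in measurable X]setTI; apply: mg => //; exact: measurableX.
rewrite /lebesgue_step /pushforward -comp_preimage gK preimage_id.
by rewrite product_measure1E// lte_mul_pinfty// ge0_fin_numE.
Qed.

HB.instance Definition _ := Measure_isSigmaFinite.Build _ _ _ lebesgue_step
  step_sigma_finite.

End lebesgue_step.

(* Lebesgue measure on R^n, as an iterated product; [lebesgue_rV_box] gives its
   value on boxes. *)
Fixpoint lebesgue_rV (R : realType) (n : nat) :
    {sigma_finite_measure set 'rV[R]_n -> \bar R} :=
  match n with
  | 0 => \d_(0 : 'rV[R]_0)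
  | n'.+1 => lebesgue_step (lebesgue_rV R n')
  end.

Lemma lebesgue_rV_box (R : realType) (n : nat) (B : 'I_n -> set R) :
  (forall i, measurable (B i)) ->
  lebesgue_rV R n [set v : 'rV[R]_n | forall i, B i (v 0 i)] =
  (\prod_(i < n) lebesgue_measure (B i))%E.
Proof.
elim: n B => [|n IHn] B mB.
  by rewrite big_ord0 /= diracE mem_set// => -[].
have mbox : measurable [set v : 'rV[R]_n | forall i, B (lift ord0 i) (v 0 i)].
  rewrite (_ : [set _ | _] = \bigcap_(i in [set: 'I_n])
      ((fun v : 'rV[R]_n => v 0 i) @^-1` B (lift ord0 i))).
    apply: fin_bigcap_measurable => // i _.
    by rewrite -[X in measurable X]setTI; exact: measurable_coord.
  by apply/seteqP; split=> [v h i _|v h i]; [exact: h|exact: (h i)].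
rewrite big_ord_recl -IHn//= /lebesgue_step /pushforward -product_measure1E//=.
congr ((lebesgue_measure \x lebesgue_rV R n)%E _).
apply/seteqP; split => [[x v] /= Bv|[x v] /= [Bx Bv] i].
  split=> [|i]; first by have := Bv ord0; rewrite cons_rV0.
  by have := Bv (lift ord0 i); rewrite cons_rVS.
by case: (unliftP ord0 i) => [j ->|->]; rewrite ?cons_rVS ?cons_rV0.
exact: mB.
Qed.

Section euclidean.
Context (R : realType) (n : nat).
Implicit Types v w : 'rV[R]_n.

(* The library norm [`|v|] on row vectors is the sup norm. *)
Definition enorm v : R := Num.sqrt (\sum_i v 0 i ^+ 2).

Definition edot v w : R := \sum_i v 0 i * w 0 i.

End euclidean.

Section capacity.
Context (R : realType) (d : nat).
Local Open Scope ereal_scope.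

(* [c] is the constant c_* of the logarithmic kernel. The case r = 0 is separate
   because [0 `^ a = 0] for a != 0 and [ln] is 0 on nonpositive numbers. *)
Definition riesz_kernel (c gamma r : R) : \bar R :=
  if (gamma < 0)%R then 1
  else if r == 0%R then +oo
  else if gamma == 0%R then (ln (c / r))%:E
  else (r `^ (- gamma))%:E.

Definition energy (c gamma : R) (A : set 'rV[R]_d)
    (m : probability 'rV[R]_d R) : \bar R :=
  \int[m]_(x in A) \int[m]_(y in A) riesz_kernel c gamma (enorm (x - y)).

(* The inverse on [\bar R] sends +oo to 0; in particular the capacity of the
   empty set is 0. *)
Definition capacity (c gamma : R) (A : set 'rV[R]_d) : \bar R :=
  (ereal_inf [set energy c gamma A m |
    m in [set m : probability 'rV[R]_d R | m A = 1]])^-1.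

End capacity.

Section inner_probability.
Context (d : measure_display) (W : measurableType d) (R : realType)
  (P : probability W R).
Local Open Scope ereal_scope.

(* For a Borel set A which is not sigma-compact, the event that a continuous
   process hits A is analytic, hence measurable for the completion of P but not
   necessarily measurable. Inner probability is the probability of E under the
   completion of P whenever E is measurable for that completion, and it is P E
   when E is measurable. *)
Definition inner_prob (E : set W) : \bar R :=
  ereal_sup [set P B | B in [set B | measurable B /\ B `<=` E]].

Lemma inner_probE (E : set W) : measurable E -> inner_prob E = P E.
Proof.
move=> mE; apply/eqP; rewrite eq_le; apply/andP; split.
  by apply: ge_ereal_sup => _ [B [mB BE] <-]; apply: le_measure; rewrite ?inE.
by apply: (@ereal_sup_ubound _ _ (P E)); exists E => //; split.
Qed.

End inner_probability.

Section gaussian_field.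
Context (disp : measure_display) (W : measurableType disp) (R : realType)
  (P : probability W R).

(* [normal_prob 0 s] has standard deviation s, but it is the uniform law on
   [0, 1] when s = 0, whence the Dirac mass for degenerate Gaussian variables. *)
Definition centered_normal (X : W -> R) : Prop :=
  measurable_fun setT X /\
  exists2 s : R, 0 <= s & forall B : set R, measurable B ->
    P (X @^-1` B) = if s == 0 then \d_(0 : R) B else normal_prob 0 s B.

Definition centered_gaussian_field (I : Type) (D : set I) (d : nat)
    (u : I -> W -> 'rV[R]_d) : Prop :=
  forall (n : nat) (p : 'I_n -> I) (a : 'I_n -> 'rV[R]_d),
    (forall l, D (p l)) ->
    centered_normal (fun w => \sum_l edot (a l) (u (p l) w)).

End gaussian_field.

Section wave.
Context (R : realType) (k d : nat) (beta : R).

(* density of the spectral measure mu(d xi) *)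
Definition spectral_density (xi : 'rV[R]_k) : R := enorm xi `^ (beta - k%:R).

(* exp(i xi.(x - y)) is replaced by its real part: the rest of the integrand is
   real and even in xi, so that the imaginary part integrates to 0. *)
Definition wave_cov (p q : R * 'rV[R]_k) : R :=
  \int[lebesgue_measure]_(r in `[0, Num.min p.1 q.1])
    \int[lebesgue_rV R k]_xi
      (cos (edot xi (p.2 - q.2))
       * (sin ((p.1 - r) * enorm xi) * sin ((q.1 - r) * enorm xi)
          / enorm xi ^+ 2)
       * spectral_density xi).

(* [u (t, x) w] is the value of the solution at time t and position x; only
   times in [0, T] matter. *)
Definition wave_solution (T : R) (sigma : 'M[R]_d)
    (disp : measure_display) (W : measurableType disp) (P : probability W R)
    (u : R * 'rV[R]_k -> W -> 'rV[R]_d) : Prop :=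
  let D : set (R * 'rV[R]_k) := `[0, T] `*` setT in
  [/\ centered_gaussian_field P D u,
      forall p q (i j : 'I_d), D p -> D q ->
        ('E_P[fun w => (u p w 0 i * u q w 0 j)%R] =
          ((sigma *m sigma^T) i j * wave_cov p q)%:E)%E
    & forall w, {within D, continuous (fun p => u p w)}].

Definition hitting_event (W : Type) (u : R * 'rV[R]_k -> W -> 'rV[R]_d)
    (S : set (R * 'rV[R]_k)) (A : set 'rV[R]_d) : set W :=
  [set w | ((fun p => u p w) @` S) `&` A !=set0].

Definition time_space_setting (t0 T : R) (I : set R) (J : set 'rV[R]_k) :=
  [/\ 0 < t0 < T,
      compact I /\ I `<=` `[t0, T],
      compact J,
      (0 < lebesgue_measure I)%E
    & (0 < lebesgue_rV R k J)%E].

End wave.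

(* Main.v *)
Require Import Defs.
From HB Require Import structures.
From mathcomp Require Import all_boot all_order all_algebra.
From mathcomp Require Import all_classical all_reals all_analysis.
From mathcomp Require Import measurable_realfun.
From mathcomp Require Import ring lra.
Set Implicit Arguments.
Unset Strict Implicit.
Unset Printing Implicit Defensive.
Import Order.TTheory GRing.Theory Num.Theory.
Import numFieldTopology.Exports numFieldNormedType.Exports.
Local Open Scope classical_set_scope.
Local Open Scope ring_scope.

(** The proof is the second moment method. Multiplication by the inverse of
    [sigma] turns the solution [u] into [d] independent copies of a centered
    Gaussian process [V] with covariance [wave_cov], and distorts the target [A]
    by a bounded factor only ([decorrelated_cos]). Let [eta = (2 - beta) / 2], let
    [delta] be the sup distance between the parameters, and let [nu] be the Lebesgue
    measure on the parameter set [S], of dimension [m = k + 1], [k] or [1] in the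
    three cases.

    Two properties of the covariance carry the estimates. The variance of [V p]
    and its covariance with [V q] differ by [O(delta^eta)] ([wave_cov_diff_le]).
    The variance of [a V p - l V q] is at least of order
    [(a^2 + l^2) delta^(2 eta)] ([wave_cov_nondeterminism]): the frequencies of
    order [1 / delta] see the two parameters out of phase. In particular the
    conditional variance of [V q] given [V p] is at least of order
    [delta^(2 eta)], and the joint density of the two values of the [d]-dimensional
    process at points [z] and [z'] is at most of the order of the minimum of
    [delta^(- eta d)] and [|z - z'|^(- d)] ([two_point_bound]). As
    [nu {delta <= r} = O(r^m)], the integral of this minimum over the second
    parameter is at most a constant times the Riesz kernel of index [d - m / eta]
    at [|z - z'|] ([kernel_integral_le]).

    Let [mu] be a probability carried by [A], of energy at most [b], and let [K]
    be a compact subset of [A] whose mass is nearly [1]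
    ([probability_inner_closed]). Let [Z e] be the time that the process spends in [S]
    within distance about [e] of a point of [K], averaged over this point under
    [mu] and normalized by the volume of a ball of radius [e]. Its mean is bounded
    from below uniformly in [e], because the one-point densities are, and its second
    moment is at most of order [b] by the previous paragraph ([sqr_smeared_le]).
    By the inequality of Paley and Zygmund ([paley_zygmund]), [Z e] exceeds a fixed
    level with probability at least of order [1 / b], hence so does it for
    infinitely many [e = 1 / j]. On this event the process hits [K]: a continuous
    path that misses a compact set over a compact set of parameters stays at a
    positive distance from it, and then [Z e] tends to [0] ([hitting_prob_ge]).
    The event is measurable, whence a lower bound of the inner probability, and the
    infimum over [mu] brings in the capacity ([capacity_le]). The constants depend on
    the parameter set only through its measure, its extent and its growth exponent
    ([hitting_capacity_ge]), which are then supplied in the three cases.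

    The process is known through the laws of its linear combinations, that is,
    through integrals of cosines, rather than through densities. A Gauss function
    is itself an average of cosines, so that the expectation of a product of Gauss
    functions of the process, which is a mollified density, is determined by these
    integrals and may be computed on any Gaussian model with the same covariance
    ([gauss_expectation_unique], [gauss_blocks]). *)

(** * Gaussian integrals *)

Section normal_integral.
Context {R : realType}.
Notation mu := (@lebesgue_measure R).

Let density_ae (m s : R) E : measurable E ->
  ae_eq mu E (Radon_Nikodym_SigmaFinite.f (normal_prob m s) mu)
    (EFin \o normal_pdf m s).
Proof.
move=> mE; apply: integral_ae_eq => //.
- by apply: (integrableS measurableT) => //;
    apply: Radon_Nikodym_SigmaFinite.f_integrable; exact: normal_prob_dominates.
- by apply/measurable_EFinP/measurable_funTS; exact: measurable_normal_pdf.
- move=> A AE mA; rewrite -Radon_Nikodym_SigmaFinite.f_integral//.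
  exact: normal_prob_dominates.
Qed.

Lemma ge0_integral_normal_prob (m s : R) (f : R -> \bar R) :
  (forall x, 0 <= f x)%E -> measurable_fun setT f ->
  (\int[normal_prob m s]_x f x = \int[mu]_x (f x * (normal_pdf m s x)%:E))%E.
Proof.
move=> f0 mf.
rewrite -(Radon_Nikodym_SigmaFinite.change_of_variables
  (normal_prob_dominates m s))//.
have mn := @normal_prob_dominates R m s.
apply: ae_eq_integral => //.
- apply: emeasurable_funM => //; apply: (measurable_int mu).
  exact: (Radon_Nikodym_SigmaFinite.f_integrable mn).
- apply: emeasurable_funM => //; apply/measurable_EFinP.
  exact: measurable_normal_pdf.
- exact/ae_eqe_mul2l/density_ae.
Qed.

Lemma integral_normal_prob (m s : R) (f : R -> \bar R) :
  (normal_prob m s).-integrable setT f ->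
  (\int[normal_prob m s]_x f x = \int[mu]_x (f x * (normal_pdf m s x)%:E))%E.
Proof.
move=> fi; have mn := @normal_prob_dominates R m s.
have mf := measurable_int _ fi.
rewrite -(Radon_Nikodym_change_of_variables mn)//.
apply: ae_eq_integral => //.
- exact: emeasurable_funM.
- apply: emeasurable_funM => //; apply/measurable_EFinP.
  exact: measurable_normal_pdf.
- apply: ae_eqe_mul2l; apply: ae_eq_trans; last exact: density_ae.
  exact/ae_eq_sym/ae_eq_Radon_Nikodym_SigmaFinite.
Qed.

End normal_integral.

Section standard_normal.
Context {R : realType}.
Notation mu := (@lebesgue_measure R).

Let phi (x : R) := expR (- x ^+ 2 / 2).

Let normal_pdf01 (x : R) : normal_pdf 0 1 x = normal_peak 1 * phi x.
Proof.
rewrite normal_pdfE ?oner_neq0// /normal_fun subr0 expr1n.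
by rewrite /phi.
Qed.

(** Half of the exponent absorbs the factor [1 + x^2], and the other half is
    a Gaussian density of variance [2]. *)
Lemma integrable_sqr_gauss : mu.-integrable [set: R]
  (fun x => ((1 + x ^+ 2) * expR (- x ^+ 2 / 2))%:E).
Proof.
have s2 : Num.sqrt 2 != 0 :> R by rewrite gt_eqF// sqrtr_gt0.
have := integrable_normal_pdf (0 : R) (Num.sqrt 2).
move=> /(integrableZl measurableT (4 / normal_peak (Num.sqrt 2))).
apply: le_integrable => //.
  apply/measurable_EFinP; apply: measurable_funM.
    by apply: measurable_funD => //; exact: measurable_funX.
  apply: measurableT_comp => //; apply: measurable_funM => //.
  by apply: measurableT_comp => //; exact: measurable_funX.
move=> x _; rewrite -EFinM !abse_EFin lee_fin.
have -> : 4 / normal_peak (Num.sqrt 2) * normal_pdf 0 (Num.sqrt 2) x =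
   4 * expR (- x ^+ 2 / 4).
  rewrite normal_pdfE// mulrA divfK ?gt_eqF ?normal_peak_gt0//.
  by rewrite /normal_fun subr0 sqr_sqrtr// -mulr_natr; congr (_ * expR (_ / _)); lra.
have x2 : 0 <= x ^+ 2 by exact: sqr_ge0.
have -> : expR (- x ^+ 2 / 2) = expR (- x ^+ 2 / 4) * expR (- x ^+ 2 / 4).
  by rewrite -expRD; congr expR; lra.
rewrite !ger0_norm ?mulr_ge0 ?expR_ge0 ?addr_ge0// mulrA ler_wpM2r ?expR_ge0//.
have : 1 + x ^+ 2 / 4 <= expR (x ^+ 2 / 4) by exact: expR_ge1Dx.
move=> h; have -> : expR (- x ^+ 2 / 4) = (expR (x ^+ 2 / 4))^-1.
  by rewrite -expRN; congr expR; lra.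
by rewrite ler_pdivrMr ?expR_gt0//; lra.
Qed.

(** By the fundamental theorem of calculus on [[- n, n]], the integral is the limit of
    boundary terms. *)
Lemma integral_derivative_eq0 (F f : R -> R) :
  continuous f -> (forall x : R, is_derive x 1 F (f x)) ->
  mu.-integrable setT (EFin \o f) ->
  F n%:R @[n --> \oo] --> 0 -> F (- n%:R) @[n --> \oo] --> 0 ->
  (\int[mu]_x (f x)%:E = 0)%E.
Proof.
move=> cf dF fi F1 F2.
pose D (n : nat) : set R := `[(- n.+1%:R), n.+1%:R]%classic.
have fD n : (\int[mu]_(x in D n) (f x)%:E)%E = (F n.+1%:R - F (- n.+1%:R))%:E.
  rewrite EFinB; apply: (continuous_FTC2 (F := F)).
  - by rewrite (lt_trans (y := 0))// ?oppr_lt0 ltr0n.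
  - exact: continuous_subspaceT.
  - have cF : continuous F.
      by move=> x; apply: differentiable_continuous; apply/derivable1_diffP; case: (dF x).
    split => [x _||].
    + by case: (dF x).
    + exact: cvg_at_right_filter (cF _).
    + exact: cvg_at_left_filter (cF _).
  - by move=> x _; rewrite derive1E; case: (dF x).
have h1 : (\int[mu]_(x in D n) (f x)%:E)%E @[n --> \oo] --> (\int[mu]_x (f x)%:E)%E.
  under eq_fun do rewrite integral_mkcond.
  have mf : measurable_fun setT (EFin \o f) by exact: measurable_int fi.
  have [] := @dominated_convergence _ _ _ mu setT measurableT
    (fun n => (EFin \o f) \_ (D n)) (EFin \o f) (abse \o (EFin \o f)) => //.
  - move=> n; apply/(measurable_restrictT _ _).1; first exact: measurable_itv.
    exact: measurable_funTS.
  - apply: aeW => x _.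
    apply: cvg_near_cst; exists (Num.truncn `|x|) => // n /= xn.
    rewrite patchE mem_set// /D/= in_itv/= -ler_norml.
    apply: (le_trans (ltW (truncnS_gt _))); rewrite ler_nat ltnS; exact: xn.
  - exact: integrable_abse.
  - apply: aeW => x n _; rewrite patchE; case: ifP => _ /=; first exact: lexx.
    by rewrite normr0 lee_fin.
have h2 : (\int[mu]_(x in D n) (f x)%:E)%E @[n --> \oo] --> (0%R%:E : \bar R).
  under eq_fun do rewrite fD.
  apply: cvg_EFin; first exact: nearW.
  rewrite -[0](subr0 0).
  by apply: cvgB; [rewrite (cvg_shiftS (fun n => F n%:R))|
    rewrite (cvg_shiftS (fun n => F (- n%:R)))].
exact: cvg_unique h1 h2.
Qed.

Let mphi : measurable_fun setT phi.
Proof.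
apply: measurableT_comp => //; apply: measurable_funM => //.
by apply: measurableT_comp => //; exact: measurable_funX.
Qed.

Let cphi : continuous phi.
Proof.
move=> x; apply: continuous_comp; last exact: continuous_expR.
apply: cvgM; last exact: cvg_cst.
by apply: cvgN; exact: exprn_continuous.
Qed.

Let dphi (x : R) : is_derive x 1 phi (- x * phi x).
Proof.
rewrite /phi; apply: is_derive_eq; rewrite /GRing.scale/=.
by field.
Qed.

(** As [phi x <= 1 / (1 + x^2 / 2)], the function [F] is [O(1 / |x|)]. *)
Let gauss_decay (F : R -> R) : (forall x, `|F x| <= (1 + `|x|) * phi x) ->
  F n%:R @[n --> \oo] --> 0 /\ F (- n%:R) @[n --> \oo] --> 0.
Proof.
move=> hF.
suff h (x : R) : `|F x| <= 4 / (1 + `|x|).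
  have c0 : (4 * (n.+1%:R)^-1 : R) @[n --> \oo] --> 0.
    rewrite -[0](mulr0 4); apply: cvgM; first exact: cvg_cst.
    exact: cvg_harmonic.
  have sq (G : nat -> R) : (forall n, `|G n| <= 4 * (n.+1%:R)^-1) ->
      G n @[n --> \oo] --> 0.
    move=> hG; apply: norm_cvg0.
    apply: (@squeeze_cvgr _ _ _ _ (cst 0) _ _ _ _ _ c0) => //.
    - by apply: nearW => n; rewrite /= normr_ge0/=.
    - exact: cvg_cst.
  by split; apply: sq => n; apply: (le_trans (h _)); rewrite ?normrN ger0_norm//
    -[n.+1%:R]natr1 (addrC 1).
apply: (le_trans (hF x)).
have e : phi x <= (1 + x ^+ 2 / 2)^-1.
  rewrite /phi mulNr expRN lef_pV2 ?posrE ?expR_gt0 ?expR_ge1Dx//.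
  by rewrite ltr_pwDl// divr_ge0// sqr_ge0.
apply: (le_trans (ler_wpM2l _ e)); first by rewrite addr_ge0.
have x0 : 0 <= `|x| by [].
rewrite -(real_normK (num_real x)); move: (`|x|) x0 => y y0.
have y2 : 0 <= y ^+ 2 by exact: sqr_ge0.
rewrite ler_pdivrMr; last by lra.
rewrite mulrAC ler_pdivlMr; last by lra.
by have := sqr_ge0 (y - 1); rewrite !expr2; nra.
Qed.

Let integrable_gauss (f : R -> R) : measurable_fun setT f ->
  (forall x, `|f x| <= 1 + x ^+ 2) ->
  mu.-integrable setT (fun x => (f x * phi x)%:E).
Proof.
move=> mf hf; apply: le_integrable integrable_sqr_gauss => //.
  by apply/measurable_EFinP; apply: measurable_funM.
move=> x _; rewrite !abse_EFin lee_fin !normrM ler_wpM2r// (le_trans (hf x))//.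
exact: ler_norm.
Qed.

Let gauss_prob (f : R -> R) : measurable_fun setT f ->
  (forall x, `|f x| <= 1 + x ^+ 2) ->
  ((normal_prob 0 1).-integrable setT (EFin \o f)) /\
  (\int[normal_prob 0 1]_x (f x)%:E =
   (normal_peak 1)%:E * \int[mu]_x (f x * phi x)%:E)%E.
Proof.
move=> mf hf; have fi := integrable_gauss mf hf.
have E (g : R -> R) x :
    ((g x)%:E * (normal_pdf 0 1 x)%:E = (normal_peak 1)%:E * (g x * phi x)%:E)%E.
  by rewrite -!EFinM normal_pdf01; congr EFin; ring.
have gi : (normal_prob 0 1).-integrable setT (EFin \o f).
  apply/integrableP; split; first exact/measurable_EFinP.
  rewrite ge0_integral_normal_prob//; last first.
    by apply/measurable_EFinP; exact: measurableT_comp.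
  under eq_integral do rewrite /= (E (fun x => `|f x|)).
  have {}fi : mu.-integrable setT (fun x => (`|f x| * phi x)%:E).
    apply: integrable_gauss; first exact: measurableT_comp.
    by move=> x; rewrite normr_id.
  rewrite integralZl//.
  have /(integrable_fin_num measurableT) := fi.
  by move=> /fin_numPlt /andP[_ h]; rewrite lte_mul_pinfty// lee_fin normal_peak_ge0.
split=> //; rewrite integral_normal_prob//.
under eq_integral do rewrite /= (E f).
by rewrite integralZl.
Qed.

(** By parts: [(x^2 - 1) phi] is the derivative of [- x phi]. *)
Lemma integral_normal_sqr : (\int[normal_prob 0 1]_x (x ^+ 2 : R)%:E = 1)%E.
Proof.
have mX : measurable_fun setT (fun x : R => x ^+ 2) by exact: measurable_funX.
have b1 x : `|x ^+ 2 : R| <= 1 + x ^+ 2.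
  by rewrite ger0_norm ?sqr_ge0// lerDr.
have b2 (x : R) : `|cst 1 x| <= 1 + x ^+ 2.
  by rewrite normr1 lerDl sqr_ge0.
rewrite (gauss_prob mX b1).2.
have := @integral_normal_pdf R 0 1.
have -> : (\int[mu]_x (normal_pdf 0 1 x)%:E =
    (normal_peak 1)%:E * \int[mu]_x (cst 1 x * phi x)%:E)%E.
  rewrite -integralZl//; last exact: integrable_gauss.
  by apply: eq_integral => x _; rewrite normal_pdf01 mul1r EFinM.
move=> <-; congr (_ * _)%E.
have i1 : mu.-integrable setT (fun x : R => ((x ^+ 2 - 1) * phi x)%:E).
  apply: integrable_gauss; first exact: measurable_funB.
  by move=> x; rewrite ler_norml; have := sqr_ge0 x; lra.
suff i0 : (\int[mu]_x ((x ^+ 2 - 1) * phi x)%:E = 0)%E.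
  rewrite -[RHS]adde0 -i0 -integralD//; last exact: integrable_gauss.
  by apply: eq_integral => x _; rewrite -EFinD; congr EFin; rewrite /cst; ring.
pose F (x : R) := - (x * phi x).
have [F1 F2] : F n%:R @[n --> \oo] --> 0 /\ F (- n%:R) @[n --> \oo] --> 0.
  apply: gauss_decay => x; rewrite /F normrN normrM (ger0_norm (expR_ge0 _)).
  by rewrite ler_wpM2r ?expR_ge0// lerDr.
apply: (integral_derivative_eq0 (F := F)) => //.
- move=> x; apply: cvgM; last exact: cphi.
  by apply: cvgB; [exact: exprn_continuous|exact: cvg_cst].
- move=> x; rewrite /F; apply: is_derive_eq; rewrite /GRing.scale/= /phi; by field.
Qed.

Variable c : R.

(** The phase [c] makes one real integral stand for both parts of the
    characteristic function. *)
Let char (a : R) := \int[mu]_x (cos (a * x + c) * phi x).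

Let caff (a : R) : continuous (fun x : R => a * x + c).
Proof. by move=> x; apply: cvgD; [exact: mulrl_continuous|exact: cvg_cst]. Qed.

Let mcos (a : R) : measurable_fun setT (fun x => cos (a * x + c)).
Proof.
by apply: continuous_measurable_fun => x; apply: continuous_comp;
  [exact: caff|exact: continuous_cos].
Qed.

Let msin (a : R) : measurable_fun setT (fun x => sin (a * x + c)).
Proof.
by apply: continuous_measurable_fun => x; apply: continuous_comp;
  [exact: caff|exact: continuous_sin].
Qed.

Let cos_le (y x : R) : `|cos y| <= 1 + x ^+ 2.
Proof.
have [h1 h2] := (cos_geN1 y, cos_le1 y); have := sqr_ge0 x.
by rewrite ler_norml; lra.
Qed.

Let xsin_le (y x : R) : `|x * sin y| <= 1 + x ^+ 2.
Proof.
have s1 : `|sin y| <= 1 by rewrite ler_norml sin_geN1 sin_le1.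
rewrite normrM (le_trans (ler_wpM2l _ s1))// mulr1.
rewrite -(real_normK (num_real x)); have := sqr_ge0 (`|x| - 1).
by have : 0 <= `|x| by []; rewrite !expr2; nra.
Qed.

Let mxsin (a : R) : measurable_fun setT (fun x : R => x * sin (a * x + c)).
Proof. by apply: measurable_funM => //; exact: msin. Qed.

Let char_derive (a : R) :
  is_derive a 1 char (\int[mu]_x (- (x * sin (a * x + c)) * phi x)).
Proof.
pose f (b x : R) := cos (b * x + c) * phi x.
have df (b x : R) : is_derive b 1 (f ^~ x) (- (x * sin (b * x + c)) * phi x).
  rewrite /f; apply: is_derive_eq; rewrite /GRing.scale/= /phi; by field.
have p1 (b x : R) : partial1of2 f b x = - (x * sin (b * x + c)) * phi x.
  by rewrite /partial1of2 derive1E; case: (df b x).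
have aI : `](a - 1), (a + 1)[%classic a by rewrite /= in_itv/=; lra.
have intf b : `](a - 1), (a + 1)[%classic b -> mu.-integrable setT (EFin \o f b).
  by move=> _; apply: integrable_gauss.
have derf b x : `](a - 1), (a + 1)[%classic b -> [set: R] x ->
    derivable (f ^~ x) b 1.
  by move=> _ _; case: (df b x).
pose G (x : R) := (1 + x ^+ 2) * phi x.
have G0 x : 0 <= G x by rewrite mulr_ge0 ?expR_ge0// addr_ge0// sqr_ge0.
have Gub b x : `](a - 1), (a + 1)[%classic b -> [set: R] x ->
    `|partial1of2 f b x| <= G x.
  move=> _ _; rewrite p1 normrM normrN (ger0_norm (expR_ge0 _)).
  by rewrite ler_wpM2r ?expR_ge0.
have d := derivable_under_integral measurableT aI intf derf G0
  integrable_sqr_gauss Gub.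
have e := differentiation_under_integral measurableT aI intf derf G0
  integrable_sqr_gauss Gub.
split=> //; rewrite -derive1E; rewrite [LHS]e.
by apply: eq_Rintegral => x _; rewrite p1.
Qed.

(** By parts again, from the derivative of [sin (a x + c) phi]. *)
Let char_deriveE (a : R) :
  \int[mu]_x (- (x * sin (a * x + c)) * phi x) = - (a * char a).
Proof.
have i1 : mu.-integrable setT (fun x => (- (x * sin (a * x + c)) * phi x)%:E).
  apply: integrable_gauss; first exact: measurableT_comp.
  by move=> x; rewrite normrN.
have i2 : mu.-integrable setT (fun x => (cos (a * x + c) * phi x)%:E).
  exact: integrable_gauss.
have i3 : mu.-integrable setT (fun x => (a * (cos (a * x + c) * phi x))%:E).
  by under eq_fun do rewrite EFinM; exact: integrableZl.
have dec x : `|sin (a * x + c) * phi x| <= (1 + `|x|) * phi x.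
  rewrite normrM (ger0_norm (expR_ge0 _)) ler_wpM2r ?expR_ge0//.
  rewrite (@le_trans _ _ 1) ?lerDl//.
  by rewrite ler_norml sin_geN1 sin_le1.
apply/eqP; rewrite -subr_eq0 opprK /char -RintegralZl// -RintegralD//.
rewrite /Rintegral.
rewrite (_ : integral _ _ _ = 0)%E//.
apply: (@integral_derivative_eq0 (fun x => sin (a * x + c) * phi x)).
- move=> x; apply: cvgD.
    apply: cvgM; last exact: cphi.
    apply: cvgN; apply: cvgM; first exact: cvg_id.
    apply: continuous_comp; [exact: caff|exact: continuous_sin].
  apply: cvgM; first exact: cvg_cst.
  apply: cvgM; last exact: cphi.
  apply: continuous_comp; [exact: caff|exact: continuous_cos].
- move=> x; apply: is_derive_eq; rewrite /GRing.scale/= /phi; by field.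
- by have := integrableD measurableT i1 i3; apply: eq_integrable.
- by have [] := gauss_decay dec.
- by have [] := gauss_decay dec.
Qed.

(** The function [f a = E cos (a G + c)] of a standard normal [G] solves
    [f' = - a f], so that [f a * exp (a^2 / 2)] is constant. *)
Lemma integral_normal_cos (a : R) :
  (\int[normal_prob 0 1]_x (cos (a * x + c))%:E =
    (cos c * expR (- a ^+ 2 / 2))%:E)%E.
Proof.
rewrite (gauss_prob _ (fun x => cos_le (a * x + c) x)).2//.
have ic b : mu.-integrable setT (fun x => (cos (b * x + c) * phi x)%:E).
  exact: integrable_gauss.
have E b : (\int[mu]_x (cos (b * x + c) * phi x)%:E = (char b)%:E)%E.
  by rewrite /char /Rintegral fineK//; exact: integrable_fin_num.
pose h (b : R) := char b * expR (b ^+ 2 / 2).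
have hc : h a = h 0.
  apply: is_derive_0_is_cst => b; rewrite /h.
  have hd := char_derive b; rewrite char_deriveE in hd.
  apply: is_derive_eq; rewrite /GRing.scale/=; by field.
have c0 : normal_peak 1 * char 0 = cos c.
  apply: EFin_inj; rewrite -[RHS]mule1 -(integral_normal_pdf 0 1) EFinM -E.
  transitivity (\int[mu]_x ((normal_peak 1)%:E * (cos (0 * x + c) * phi x)%:E))%E.
    by rewrite integralZl.
  transitivity (\int[mu]_x ((cos c)%:E * (normal_pdf 0 1 x)%:E))%E; last first.
    by apply: integralZl => //; exact: integrable_normal_pdf.
  apply: eq_integral => x _; rewrite -!EFinM normal_pdf01 mul0r add0r.
  by congr EFin; ring.
have ca : char a = char 0 * expR (- a ^+ 2 / 2).
  have -> : char 0 = h 0 by rewrite /h expr0n mul0r expR0 mulr1.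
  rewrite -hc /h -mulrA -expRD.
  by rewrite (_ : _ + _ = 0) ?expR0 ?mulr1//; lra.
by rewrite E -EFinM ca mulrA c0.
Qed.

End standard_normal.
Section normal_gauss.
Context {R : realType}.
Notation mu := (@lebesgue_measure R).

Let complete_square (a c x y : R) : a != 0 -> a + c ^+ 2 != 0 ->
  - (y + c * x) ^+ 2 / (a *+ 2) + - x ^+ 2 / (1 *+ 2) =
  - y ^+ 2 / ((a + c ^+ 2) *+ 2) +
  - (x - - (c * y) / (a + c ^+ 2)) ^+ 2 / ((a / (a + c ^+ 2)) *+ 2).
Proof.
move=> a0 V0; rewrite -[a *+ 2]mulr_natr -[(a + _) *+ 2]mulr_natr.
by rewrite -[(a / _) *+ 2]mulr_natr; field; rewrite a0 V0.
Qed.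

(** Completing the square: the density of a sum of two independent Gaussians. *)
Lemma integral_normal_gauss (e c y : R) : 0 < e ->
  (\int[normal_prob 0 1]_x (expR (- (y + c * x) ^+ 2 / (e ^+ 2 *+ 2)))%:E =
   (e / Num.sqrt (e ^+ 2 + c ^+ 2) *
    expR (- y ^+ 2 / ((e ^+ 2 + c ^+ 2) *+ 2)))%:E)%E.
Proof.
move=> e0.
have e2 : 0 < e ^+ 2 by exact: exprn_gt0.
have c2 : 0 <= c ^+ 2 by exact: sqr_ge0.
have v0 : 0 < e ^+ 2 + c ^+ 2 by lra.
set v := Num.sqrt _; have vE : v ^+ 2 = e ^+ 2 + c ^+ 2 by rewrite sqr_sqrtr// ltW.
have {}v0 : 0 < v by rewrite sqrtr_gt0.
(* The standard deviation [s] and the mean [m] of the Gaussian in [x] that is left. *)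
pose s := e / v; have s0 : 0 < s by exact: divr_gt0.
pose m := - (c * y) / v ^+ 2.
have sE : s ^+ 2 = e ^+ 2 / v ^+ 2 by rewrite /s expr_div_n.
have peakE : normal_peak s * s = normal_peak 1.
  rewrite /normal_peak expr1n mul1r -mulr_natr -mulrA sqrtrM ?sqr_ge0//.
  by rewrite sqrtr_sqr gtr0_norm// invfM mulrAC mulVf ?gt_eqF// mul1r mulr_natr.
rewrite ge0_integral_normal_prob//; last first.
  apply/measurable_EFinP; apply: measurableT_comp => //.
  apply: measurable_funM => //; apply: measurableT_comp => //.
  by apply: measurable_funX; apply: measurable_funD => //; exact: measurable_funM.
rewrite -vE; set K := (X in _ = X%:E).
have -> : (K%:E = K%:E * \int[mu]_x (normal_pdf m s x)%:E)%E.
  by rewrite integral_normal_pdf mule1.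
transitivity (\int[mu]_x (K%:E * (normal_pdf m s x)%:E))%E; last first.
  by apply: integralZl => //; exact: integrable_normal_pdf.
apply: eq_integral => x _; rewrite -!EFinM; congr EFin.
rewrite (@normal_pdfE _ 0 1) ?oner_neq0// (@normal_pdfE _ m s) ?gt_eqF//=.
rewrite -peakE /normal_fun subr0 expr1n /K.
have : expR (- (y + c * x) ^+ 2 / (e ^+ 2 *+ 2)) * expR (- x ^+ 2 / (1 *+ 2)) =
    expR (- y ^+ 2 / (v ^+ 2 *+ 2)) * expR (- (x - m) ^+ 2 / (s ^+ 2 *+ 2)).
  rewrite -!expRD; congr expR; rewrite sE /m.
  rewrite vE; apply: complete_square.
    by rewrite gt_eqF.
  by rewrite -vE gt_eqF// exprn_gt0.
move: (expR _) (expR _) (expR _) (expR _) => A B C D AB.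
rewrite mulrCA AB -/s; move: (normal_peak s) => p.
by move: (s : R) => q; ring.
Qed.

End normal_gauss.

(** * Gaussian expectations from characteristic functions *)

Section bounded_integrals.
Context {R : realType}.

Lemma measurable_cos : measurable_fun setT (@cos R).
Proof. by apply: continuous_measurable_fun; exact: continuous_cos. Qed.

Lemma measurable_sin : measurable_fun setT (@sin R).
Proof. by apply: continuous_measurable_fun; exact: continuous_sin. Qed.

Lemma bounded_integrable d (T : measurableType d) (P : probability T R)
    (f : T -> R) (M : R) :
  measurable_fun setT f -> (forall x, `|f x| <= M) ->
  P.-integrable setT (EFin \o f).
Proof.
move=> mf fM; apply: measurable_bounded_integrable => //.
  by rewrite (le_lt_trans (probability_le1 _ _))// ltry.
exists M; split; first exact: num_real.
by move=> y My x _; rewrite /= (le_trans (fM x))// ltW.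
Qed.

Section Fubini.
Context d1 d2 (T1 : measurableType d1) (T2 : measurableType d2).
Variables (P : probability T1 R) (Q : probability T2 R).
Variables (f : T1 * T2 -> R) (M : R).
Hypotheses (mf : measurable_fun setT f) (fM : forall x, `|f x| <= M).

Lemma bounded_integral_prod :
  (\int[P \x Q]_z (f z)%:E = \int[P]_x \int[Q]_y (f (x, y))%:E)%E.
Proof.
rewrite -(@integral12_prod_meas1 _ _ _ _ _ P Q (EFin \o f))//.
exact: bounded_integrable mf fM.
Qed.

Lemma bounded_Fubini :
  (\int[P]_x \int[Q]_y (f (x, y))%:E = \int[Q]_y \int[P]_x (f (x, y))%:E)%E.
Proof.
apply: (@Fubini _ _ _ _ _ P Q (EFin \o f)).
exact: bounded_integrable mf fM.
Qed.

End Fubini.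

End bounded_integrals.

(** The Gauss function is its own Fourier transform, so that its product with a
    cosine is an average of cosines. *)
Lemma gauss_mul_cos (R : realType) (x y : R) :
  ((expR (- x ^+ 2 / 2) * cos y)%:E =
   \int[normal_prob 0 1]_b (cos (x * b + y))%:E)%E.
Proof. by rewrite integral_normal_cos mulrC. Qed.

Section gauss_functional.
Context {R : realType} {I : finType} d (W : measurableType d).
Variables (P : probability W R) (X : I -> W -> R) (z : I -> R).
Hypothesis mX : forall i, measurable_fun setT (X i).

Let G (s : seq I) (w : W) : R := \prod_(i <- s) expR (- (X i w - z i) ^+ 2 / 2).
Let L (a : I -> R) (c : R) (w : W) : R := \sum_i a i * X i w + c.

Let mG s : measurable_fun setT (G s).
Proof.
apply: measurable_prod => i _; apply: measurableT_comp => //.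
apply: measurable_funM => //; apply: measurableT_comp => //.
by apply: measurable_funX; exact: measurable_funB.
Qed.

Let G_le1 s w : `|G s w| <= 1.
Proof.
rewrite /G normr_prod; apply: prodr_ile1 => i _; rewrite normr_ge0/=.
rewrite ger0_norm ?expR_ge0// -[leRHS]expR0 ler_expR mulNr oppr_le0.
by rewrite divr_ge0// sqr_ge0.
Qed.

Let mL a c : measurable_fun setT (L a c).
Proof.
apply: measurable_funD => //; apply: measurable_sum => i.
exact: measurable_funM.
Qed.

(** The Gauss factor of index [i] is traded for an average, over [b], of a shift of
    the [i]-th coefficient inside the cosine. *)
Lemma gauss_functional_cons (i : I) (s : seq I) (a : I -> R) (c : R) :
  (\int[P]_w (G (i :: s) w * cos (L a c w))%:E =
   \int[normal_prob 0 1]_b \int[P]_w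
     (G s w * cos (L (fun j => a j + b * (j == i)%:R) (c - b * z i) w))%:E)%E.
Proof.
pose f (wb : W * measurableTypeR R) : R := G s wb.1 * cos ((X i wb.1 - z i) * wb.2 + L a c wb.1).
have mf : measurable_fun setT f.
  apply: measurable_funM; first exact: measurableT_comp.
  apply: (measurableT_comp (measurable_cos)).
  apply: measurable_funD; last exact: measurableT_comp.
  apply: measurable_funM => //.
  by apply: measurable_funB => //; exact: measurableT_comp.
have f1 wb : `|f wb| <= 1.
  rewrite /f normrM mulr_ile1//.
  by rewrite ler_norml cos_geN1 cos_le1.
transitivity (\int[P]_w \int[normal_prob 0 1]_b (f (w, b))%:E)%E.
  apply: eq_integral => w _.
  rewrite /G big_cons -/(G s w) mulrAC EFinM gauss_mul_cos muleC -integralZl//.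
  apply: (@bounded_integrable _ _ _ _ _ 1) => [|b].
    apply: (measurableT_comp measurable_cos).
    by apply: measurable_funD => //; exact: measurable_funM.
  by rewrite ler_norml cos_geN1 cos_le1.
rewrite (@bounded_Fubini _ _ _ _ _ P (normal_prob 0 1) f 1 mf f1).
apply: eq_integral => b _; apply: eq_integral => w _.
congr EFin; rewrite /f /=; congr (_ * cos _).
rewrite /L.
under [in RHS]eq_bigr do rewrite mulrDl.
rewrite big_split/=.
have -> : \sum_j b * (j == i)%:R * X j w = b * X i w.
  rewrite (bigD1 i)//= eqxx mulr1 big1 ?addr0// => j /negbTE ->.
  by rewrite mulr0 mul0r.
by ring.
Qed.

End gauss_functional.

(** Two families of random variables whose linear combinations have the same
    characteristic functions have the same Gaussian expectations: each Gauss
    factor is an average of cosines, which can be absorbed in the linear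
    combination. *)
Lemma gauss_expectation_unique (R : realType) (I : finType) d d'
    (W : measurableType d) (W' : measurableType d')
    (P : probability W R) (P' : probability W' R)
    (X : I -> W -> R) (X' : I -> W' -> R) (z : I -> R) :
  (forall i, measurable_fun setT (X i)) ->
  (forall i, measurable_fun setT (X' i)) ->
  (forall (a : I -> R) (c : R),
    \int[P]_w (cos (\sum_i a i * X i w + c))%:E =
    \int[P']_w (cos (\sum_i a i * X' i w + c))%:E)%E ->
  (\int[P]_w (\prod_i expR (- (X i w - z i) ^+ 2 / 2))%:E =
   \int[P']_w (\prod_i expR (- (X' i w - z i) ^+ 2 / 2))%:E)%E.
Proof.
move=> mX mX' XX'.
suff : forall (s : seq I) a c,
  (\int[P]_w ((\prod_(i <- s) expR (- (X i w - z i) ^+ 2 / 2)) *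
      cos (\sum_i a i * X i w + c))%:E =
   \int[P']_w ((\prod_(i <- s) expR (- (X' i w - z i) ^+ 2 / 2)) *
      cos (\sum_i a i * X' i w + c))%:E)%E.
  move=> /(_ (index_enum I) (fun=> 0) 0).
  have E (Y : I -> R) : \sum_i 0 * Y i + 0 = 0.
    by rewrite addr0 big1// => i _; rewrite mul0r.
  under eq_integral do rewrite E cos0 mulr1.
  by under [in X in _ = X -> _]eq_integral do rewrite E cos0 mulr1.
elim=> [a c|i s IH a c].
  under eq_integral do rewrite big_nil mul1r.
  by under [in RHS]eq_integral do rewrite big_nil mul1r.
rewrite !gauss_functional_cons//.
by apply: eq_integral => b _; exact: IH.
Qed.

Definition gauss (R : realType) (x : R) : R := expR (- x ^+ 2 / 2).

Section gauss_theory.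
Context {R : realType}.

Lemma gauss_ge0 (x : R) : 0 <= gauss x. Proof. exact: expR_ge0. Qed.

Lemma gauss_le1 (x : R) : gauss x <= 1.
Proof.
by rewrite -[leRHS]expR0 ler_expR mulNr oppr_le0 divr_ge0// sqr_ge0.
Qed.

Lemma measurable_gauss : measurable_fun setT (@gauss R).
Proof.
apply: measurableT_comp => //; apply: measurable_funM => //.
by apply: measurableT_comp => //; exact: measurable_funX.
Qed.

Lemma prod_gauss_le1 (I : finType) (x : I -> R) : `|\prod_i gauss (x i)| <= 1.
Proof.
rewrite normr_prod; apply: prodr_ile1 => i _; rewrite normr_ge0/=.
by rewrite ger0_norm ?gauss_ge0// gauss_le1.
Qed.

Lemma measurable_prod_gauss (I : finType) d (W : measurableType d)
    (X : I -> W -> R) (z : I -> R) : (forall i, measurable_fun setT (X i)) ->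
  measurable_fun setT (fun w => \prod_i gauss (X i w - z i)).
Proof.
move=> mX; apply: measurable_prod => i _.
by apply: measurableT_comp measurable_gauss _; exact: measurable_funB.
Qed.

Lemma measurable_lincomb (I : finType) d (W : measurableType d)
    (X : I -> W -> R) (a : I -> R) : (forall i, measurable_fun setT (X i)) ->
  measurable_fun setT (fun w => \sum_i a i * X i w).
Proof. by move=> mX; apply: measurable_sum => i; exact: measurable_funM. Qed.

End gauss_theory.

(** Independence of the blocks [X i], read off the characteristic function, makes
    the Gaussian expectation a product. The first block is moved to an
    independent copy of the model [Y], which does not change the characteristic
    function, and the other blocks are treated by induction. *)
Lemma gauss_blocks (R : realType) (J : finType) d' (S : measurableType d')
    (Q : probability S R) (Y : J -> S -> R) (phi : (J -> R) -> R)
    (mY : forall j, measurable_fun setT (Y j))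
    (Yphi : forall b c, (\int[Q]_s (cos (\sum_j b j * Y j s + c))%:E =
      (cos c * phi b)%:E)%E)
    (n : nat) d (W : measurableType d) (P : probability W R)
    (X : 'I_n -> J -> W -> R) (z : 'I_n -> J -> R) :
  (forall i j, measurable_fun setT (X i j)) ->
  (forall (a : 'I_n -> J -> R) c,
    (\int[P]_w (cos (\sum_i \sum_j a i j * X i j w + c))%:E =
    (cos c * \prod_i phi (a i))%:E)%E) ->
  (\int[P]_w (\prod_i \prod_j gauss (X i j w - z i j))%:E =
   (\prod_i \int[Q]_s (\prod_j gauss (Y j s - z i j)))%:E)%E.
Proof.
elim: n X z => [|n IH] X z mX Xphi.
  under eq_integral do rewrite big_ord0.
  by rewrite big_ord0 integral_cst// mul1e; exact: probability_setT.
pose X' (ij : 'I_n.+1 * J) (ws : W * S) : R :=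
  if unlift ord0 ij.1 is Some k then X (lift ord0 k) ij.2 ws.1
  else Y ij.2 ws.2.
have mX' ij : measurable_fun setT (X' ij).
  rewrite /X'; case: (unlift _ _) => [k|]; first exact: measurableT_comp.
  exact: measurableT_comp.
have X0 j ws : X' (ord0, j) ws = Y j ws.2 by rewrite /X'/= unlift_none.
have XS i j ws : X' (lift ord0 i, j) ws = X (lift ord0 i) j ws.1.
  by rewrite /X'/= liftK.
have c1 (x : R) : `|cos x| <= 1 by rewrite ler_norml cos_geN1 cos_le1.
have phi0 : phi (fun=> 0) = 1.
  have := Yphi (fun=> 0) 0; rewrite cos0 mul1r => /esym h; apply: EFin_inj.
  rewrite {}h; under eq_integral.
    by move=> s _; rewrite addr0 big1 ?cos0 => [|j _]; [over|rewrite mul0r].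
  by rewrite integral_cst// mul1e; exact: probability_setT.
have XSphi (a : 'I_n -> J -> R) c :
    (\int[P]_w (cos (\sum_i \sum_j a i j * X (lift ord0 i) j w + c))%:E =
    (cos c * \prod_i phi (a i))%:E)%E.
  pose a' (i : 'I_n.+1) : J -> R :=
    if unlift ord0 i is Some k then a k else fun=> 0.
  have a'0 : a' ord0 = fun=> 0 by rewrite /a' unlift_none.
  have a'S i : a' (lift ord0 i) = a i by rewrite /a' liftK.
  have := Xphi a' c; rewrite big_ord_recl a'0 phi0 mul1r.
  rewrite (eq_bigr (fun i => phi (a i))) => [<-|i _]; last by rewrite a'S.
  apply: eq_integral => w _; congr (cos (_ + c))%:E.
  rewrite big_ord_recl a'0 [X in _ = X + _]big1 ?add0r; last first.
    by move=> j _; rewrite mul0r.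
  by apply: eq_bigr => i _; rewrite a'S.
have sE (F : 'I_n.+1 * J -> R) : \sum_ij F ij =
    \sum_j F (ord0, j) + \sum_(i < n) \sum_j F (lift ord0 i, j).
  transitivity (\sum_i \sum_j F (i, j)); last by rewrite big_ord_recl.
  by rewrite pair_bigA; apply: eq_bigr => -[].
have pE (F : 'I_n.+1 * J -> R) : \prod_ij F ij =
    \prod_j F (ord0, j) * \prod_(i < n) \prod_j F (lift ord0 i, j).
  transitivity (\prod_i \prod_j F (i, j)); last by rewrite big_ord_recl.
  by rewrite pair_bigA; apply: eq_bigr => -[].
have XX' (a : 'I_n.+1 * J -> R) c :
    (\int[P]_w (cos (\sum_ij a ij * X ij.1 ij.2 w + c))%:E =
     \int[P \x Q]_ws (cos (\sum_ij a ij * X' ij ws + c))%:E)%E.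
  rewrite (@bounded_integral_prod _ _ _ _ _ P Q
    (fun ws => cos (\sum_ij a ij * X' ij ws + c)) 1); last 2 first.
  - apply: measurableT_comp measurable_cos _; apply: measurable_funD => //.
    exact: measurable_lincomb.
  - by move=> ?; exact: c1.
  transitivity (\int[P]_w ((phi (fun j => a (ord0, j)))%:E *
    (cos (\sum_(i < n) \sum_j a (lift ord0 i, j) * X (lift ord0 i) j w + c))%:E))%E.
    rewrite integralZl//; last first.
      apply: (@bounded_integrable _ _ _ _ _ 1) => [|w]; last exact: c1.
      apply: measurableT_comp measurable_cos _; apply: measurable_funD => //.
      apply: measurable_sum => i.
      exact: measurable_lincomb.
    rewrite (XSphi (fun i j => a (lift ord0 i, j))) -EFinM mulrCA.
    have := Xphi (fun i j => a (i, j)) c; rewrite big_ord_recl => <-.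
    apply: eq_integral => w _; congr (cos (_ + c))%:E.
    by rewrite pair_bigA; apply: eq_bigr => -[].
  apply: eq_integral => w _; rewrite muleC -EFinM -Yphi.
  apply: eq_integral => s _; congr (cos _)%:E; rewrite sE -addrA; congr (_ + (_ + c)).
    by apply: eq_bigr => j _; rewrite X0.
  by apply: eq_bigr => i _; apply: eq_bigr => j _; rewrite XS.
transitivity (\int[P]_w (\prod_ij gauss (X ij.1 ij.2 w - z ij.1 ij.2))%:E)%E.
  apply: eq_integral => w _; congr EFin.
  by rewrite pair_bigA; apply: eq_bigr => -[].
rewrite (gauss_expectation_unique (fun ij => z ij.1 ij.2) _ mX' XX')//.
rewrite (@bounded_integral_prod _ _ _ _ _ P Q
  (fun ws => \prod_ij gauss (X' ij ws - z ij.1 ij.2)) 1); last 2 first.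
- exact: measurable_prod_gauss.
- by move=> ?; exact: prod_gauss_le1.
rewrite big_ord_recl EFinM -(IH (fun i => X (lift ord0 i)) (fun i => z (lift ord0 i)))//.
set q := Rintegral _ _ _.
have qE : (\int[Q]_s (\prod_j gauss (Y j s - z ord0 j))%:E = q%:E)%E.
  rewrite /q /Rintegral fineK//; apply: integrable_fin_num => //.
  apply: (@bounded_integrable _ _ _ _ _ 1); first exact: measurable_prod_gauss.
  by move=> ?; exact: prod_gauss_le1.
rewrite -integralZl//; last first.
  apply: (@bounded_integrable _ _ _ _ _ 1) => [|w].
    by apply: measurable_prod => i _; exact: measurable_prod_gauss.
  rewrite normr_prod; apply: prodr_ile1 => i _; rewrite normr_ge0/=.
  exact: prod_gauss_le1.
apply: eq_integral => w _; rewrite -qE muleC -integralZl//; last first.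
  apply: (@bounded_integrable _ _ _ _ _ 1); first exact: measurable_prod_gauss.
  by move=> ?; exact: prod_gauss_le1.
apply: eq_integral => s _; rewrite -EFinM pE mulrC; congr (_ * _)%:E.
  by apply: eq_bigr => i _; apply: eq_bigr => j _; rewrite XS.
by apply: eq_bigr => j _; rewrite X0.
Qed.

(** * Mollified densities of Gaussian vectors *)

Section gaussian_density.
Context {R : realType}.
Notation gamma := (normal_prob (0 : R) 1).

(** A centered Gaussian pair, in the triangular form [(p G, q G + r G')] with [G]
    and [G'] independent standard normals. *)
Let pair_model (p q r : R) (j : bool) (s : measurableTypeR R * measurableTypeR R) : R :=
  if j then q * s.1 + r * s.2 else p * s.1.

Let measurable_pair_model p q r j : measurable_fun setT (pair_model p q r j).
Proof.
rewrite /pair_model; case: j; last exact: measurable_funM.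
by apply: measurable_funD; exact: measurable_funM.
Qed.

Let pair_modelE p q r (b : bool -> R) c :
  (\int[gamma \x gamma]_s (cos (\sum_j b j * pair_model p q r j s + c))%:E =
   (cos c * expR (- ((b false * p + b true * q) ^+ 2 + (b true * r) ^+ 2) / 2))%:E)%E.
Proof.
have c1 (x : R) : `|cos x| <= 1 by rewrite ler_norml cos_geN1 cos_le1.
rewrite (@bounded_integral_prod _ _ _ _ _ gamma gamma
  (fun s => cos (\sum_j b j * pair_model p q r j s + c)) 1)//; last first.
  apply: measurableT_comp measurable_cos _; apply: measurable_funD => //.
  by apply: measurable_lincomb => j; exact: measurable_pair_model.
transitivity (\int[gamma]_x ((expR (- (b true * r) ^+ 2 / 2))%:E *
    (cos ((b false * p + b true * q) * x + c))%:E))%E.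
  apply: eq_integral => x _; rewrite muleC -EFinM -integral_normal_cos.
  apply: eq_integral => y _; congr (cos _)%:E.
  by rewrite big_bool/=; ring.
rewrite integralZl//; last first.
  apply: (@bounded_integrable _ _ _ _ _ 1) => //.
  apply: measurableT_comp measurable_cos _; apply: measurable_funD => //.
rewrite integral_normal_cos -EFinM mulrCA -expRD; congr (_ * expR _)%:E.
by rewrite -mulrDl -opprD addrC.
Qed.

(** The minimum over [x] of the right-hand side is [y^2 / (1 + 2 l^2)]. *)
Let shifted_square (l L x y : R) : `|l| <= L ->
  y ^+ 2 / (1 + 2 * L ^+ 2) <= (l * x + y) ^+ 2 + x ^+ 2 / 2.
Proof.
move=> lL; have L0 : 0 <= L ^+ 2 by exact: sqr_ge0.
have l0 : 0 <= l ^+ 2 by exact: sqr_ge0.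
have lL2 : l ^+ 2 <= L ^+ 2.
  by rewrite -(real_normK (num_real l)) lerXn2r ?nnegrE// (le_trans _ lL).
apply: (@le_trans _ _ (y ^+ 2 / (1 + 2 * l ^+ 2))).
  by rewrite ler_wpM2l ?sqr_ge0// lef_pV2 ?posrE; lra.
rewrite ler_pdivrMr; last by lra.
have -> : ((l * x + y) ^+ 2 + x ^+ 2 / 2) * (1 + 2 * l ^+ 2) =
  y ^+ 2 + 2 * (l * y + (l ^+ 2 + 2^-1) * x) ^+ 2 by field.
by rewrite lerDl mulr_ge0// sqr_ge0.
Qed.

Let normal_gauss (p z : R) :
  (\int[gamma]_x (gauss (p * x - z))%:E =
   ((Num.sqrt (1 + p ^+ 2))^-1 * expR (- z ^+ 2 / (2 * (1 + p ^+ 2))))%:E)%E.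
Proof.
have := @integral_normal_gauss R 1 p (- z) ltr01.
rewrite !expr1n sqrrN mul1r (mulr_natl _ 2) => <-.
by apply: eq_integral => x _; rewrite /gauss addrC.
Qed.

Let normal_wide_gauss (p z : R) : 0 < p ->
  (\int[gamma]_x (expR (- (p * x - z) ^+ 2 / 4))%:E <= (Num.sqrt 2 / p)%:E)%E.
Proof.
move=> p0; have s0 : 0 < Num.sqrt 2 :> R by rewrite sqrtr_gt0.
have := @integral_normal_gauss R (Num.sqrt 2) p (- z) s0.
rewrite sqr_sqrtr// => h.
have -> : (\int[gamma]_x (expR (- (p * x - z) ^+ 2 / 4))%:E =
    \int[gamma]_x (expR (- (- z + p * x) ^+ 2 / (2 *+ 2)))%:E)%E.
  apply: eq_integral => x _; rewrite addrC; congr (expR (_ / _))%:E.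
  by rewrite -mulr_natr; ring.
have p2 : 0 < p ^+ 2 by exact: exprn_gt0.
rewrite {}h lee_fin -[leRHS]mulr1; apply: ler_pM.
- by rewrite divr_ge0// sqrtr_ge0.
- exact: expR_ge0.
- rewrite ler_pM2l// lef_pV2 ?posrE ?sqrtr_gt0//; last by lra.
  by rewrite -[leLHS]gtr0_norm// -sqrtr_sqr ler_wsqrtr// lerDr.
- rewrite -[leRHS]expR0 ler_expR mulNr oppr_le0 divr_ge0 ?sqr_ge0//.
  by rewrite mulrn_wge0// addr_ge0// ltW.
Qed.

(** The integral in the second normal is a Gauss function of [z1 - l p x]. One half of
    the exponent of [gauss (p x - z0)] is spent, through [shifted_square], on
    replacing [p x] by [z0] in it; the other half is integrated in [x]. *)
Let pair_model_gauss (p l r z0 z1 L : R) : 0 < p -> `|l| <= L ->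
  (\int[gamma \x gamma]_s (\prod_j gauss (pair_model p (l * p) r j s -
     (if j then z1 else z0)))%:E <=
  (Num.sqrt 2 / p * ((Num.sqrt (1 + r ^+ 2))^-1 *
  expR (- (l * z0 - z1) ^+ 2 / (1 + 2 * L ^+ 2) / (2 * (1 + r ^+ 2)))))%:E)%E.
Proof.
move=> p0 lL.
have r0 : 0 <= r ^+ 2 by exact: sqr_ge0.
have S0 : 0 < 1 + r ^+ 2 by lra.
rewrite (@bounded_integral_prod _ _ _ _ _ gamma gamma
  (fun s => \prod_j gauss (pair_model p (l * p) r j s -
     (if j then z1 else z0))) 1); last 2 first.
- by apply: measurable_prod_gauss => j; exact: measurable_pair_model.
- by move=> ?; exact: prod_gauss_le1.
set S := Num.sqrt (1 + r ^+ 2); set K := expR _.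
have mg (q z : R) : measurable_fun setT (fun x : R => gauss (q * x - z)).
  by apply: measurableT_comp measurable_gauss _; apply: measurable_funB.
apply: (@le_trans _ _ (\int[gamma]_x
    ((S^-1 * K)%:E * (expR (- (p * x - z0) ^+ 2 / 4))%:E))%E); last first.
  rewrite ge0_integralZl_EFin//; last 2 first.
  - apply/measurable_EFinP; apply: measurableT_comp => //.
    apply: measurable_funM => //; apply: measurableT_comp => //.
    by apply: measurable_funX; apply: measurable_funB => //; exact: measurable_funM.
  - by rewrite mulr_ge0 ?expR_ge0// invr_ge0 sqrtr_ge0.
  rewrite [leRHS]EFinM muleC; apply: lee_wpmul2r; last exact: normal_wide_gauss.
  by rewrite lee_fin mulr_ge0 ?expR_ge0// invr_ge0 sqrtr_ge0.
have inner x : (\int[gamma]_y (\prod_j gauss (pair_model p (l * p) r j (x, y) -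
     (if j then z1 else z0)))%:E = (gauss (p * x - z0))%:E *
     (S^-1 * expR (- (z1 - l * p * x) ^+ 2 / (2 * (1 + r ^+ 2))))%:E)%E.
  rewrite -normal_gauss -ge0_integralZl_EFin; [|by []|..]; last 3 first.
  - by move=> y _; rewrite lee_fin gauss_ge0.
  - by apply/measurable_EFinP; exact: mg.
  - exact: gauss_ge0.
  apply: eq_integral => y _; rewrite -EFinM big_bool/= mulrC; congr (_ * gauss _)%:E.
  by ring.
apply: ge0_le_integral; first by [].
- by move=> x _; rewrite inner -EFinM lee_fin !mulr_ge0 ?expR_ge0// invr_ge0 sqrtr_ge0.
- under eq_fun do rewrite inner -EFinM.
  apply/measurable_EFinP; apply: measurable_funM; first exact: mg.
  apply: measurable_funM => //.
  apply: measurableT_comp => //; apply: measurable_funM => //.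
  apply: measurableT_comp => //; apply: measurable_funX.
  exact: measurable_funB.
- under eq_fun do rewrite -EFinM.
  apply/measurable_EFinP; apply: measurable_funM => //.
  apply: measurableT_comp => //; apply: measurable_funM => //.
  apply: measurableT_comp => //; apply: measurable_funX.
  exact: measurable_funB.
move=> x _; rewrite inner -!EFinM lee_fin mulrCA -[leRHS]mulrA.
apply: ler_wpM2l; first by rewrite invr_ge0 sqrtr_ge0.
rewrite /gauss /K -!expRD ler_expR.
set u := p * x - z0; set v := l * z0 - z1.
have -> : (z1 - l * p * x) ^+ 2 = (l * u + v) ^+ 2 by rewrite /u /v; ring.
have /= uv := @shifted_square l L u v lL.
have u2 : 0 <= u ^+ 2 by exact: sqr_ge0.
have T0 : 0 < (2 * (1 + r ^+ 2))^-1 by rewrite invr_gt0; lra.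
have T1 : (2 * (1 + r ^+ 2))^-1 <= 2^-1 by rewrite lef_pV2 ?posrE; lra.
move: (_^-1) T0 T1 => T T0 T1.
rewrite !mulNr -opprD -[X in _ <= X]opprD lerN2.
have := ler_wpM2r (ltW T0) uv.
by nra.
Qed.

(** The density at [(z, z')] of [n] independent copies of a centered Gaussian pair
    with covariance [(A, B; B, D)], mollified at scale [e]. The mollification is
    the addition of an independent Gaussian vector of variance [e^2], so that
    the bound involves the conditional variance [D - B^2/A + e^2]. *)
Lemma pair_gauss_le (n : nat) d (W : measurableType d) (P : probability W R)
    (V V' : 'I_n -> W -> R) (A B D L e : R) (z z' : 'I_n -> R) :
  (forall i, measurable_fun setT (V i)) ->
  (forall i, measurable_fun setT (V' i)) ->
  (forall (a b : 'I_n -> R) c,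
    (\int[P]_w (cos (\sum_i (a i * V i w + b i * V' i w) + c))%:E =
    (cos c * \prod_i expR (- (a i ^+ 2 * A + 2 * a i * b i * B +
      b i ^+ 2 * D) / 2))%:E)%E) ->
  0 < A -> 0 <= D - B ^+ 2 / A -> `|B / A| <= L -> 0 < e ->
  (\int[P]_w (\prod_i (gauss ((V i w - z i) / e) * gauss ((V' i w - z' i) / e)))%:E
   <= (\prod_(i < n) (Num.sqrt 2 / Num.sqrt A * e ^+ 2 *
       ((Num.sqrt (e ^+ 2 + (D - B ^+ 2 / A)))^-1 *
         expR (- (B / A * z i - z' i) ^+ 2 / (1 + 2 * L ^+ 2) /
           (2 * (e ^+ 2 + (D - B ^+ 2 / A)))))))%:E)%E.
Proof.
move=> mV mV' VV' A0 C0 BL e0.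
set C := D - B ^+ 2 / A; set l := B / A.
pose p := Num.sqrt A / e; pose r := Num.sqrt C / e.
have sA : 0 < Num.sqrt A by rewrite sqrtr_gt0.
have p0 : 0 < p by rewrite divr_gt0.
pose X (i : 'I_n) (j : bool) w := (if j then V' i w else V i w) / e.
pose zz (i : 'I_n) (j : bool) := (if j then z' i else z i) / e.
have mX i j : measurable_fun setT (X i j).
  by rewrite /X; case: j; apply: measurable_funM.
have Xphi (a : 'I_n -> bool -> R) c :
    (\int[P]_w (cos (\sum_i \sum_j a i j * X i j w + c))%:E =
     (cos c * \prod_i expR (- ((a i false * p + a i true * (l * p)) ^+ 2 +
       (a i true * r) ^+ 2) / 2))%:E)%E.
  have := VV' (fun i => a i false / e) (fun i => a i true / e) c.
  have -> : \prod_i expR (- ((a i false / e) ^+ 2 * A +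
      2 * (a i false / e) * (a i true / e) * B + (a i true / e) ^+ 2 * D) / 2) =
    \prod_i expR (- ((a i false * p + a i true * (l * p)) ^+ 2 +
       (a i true * r) ^+ 2) / 2).
    apply: eq_bigr => i _; congr (expR (- _ / 2)).
    have -> : (a i true * r) ^+ 2 = (a i true / e) ^+ 2 * C.
      by rewrite /r !exprMn sqr_sqrtr//; ring.
    have -> : (a i false * p + a i true * (l * p)) ^+ 2 =
        (a i false / e + a i true / e * l) ^+ 2 * A.
      rewrite -[in RHS](sqr_sqrtr (ltW A0)) -exprMn /p; congr (_ ^+ 2).
      by ring.
    rewrite /C /l; field.
    by rewrite !gt_eqF.
  move=> <-; apply: eq_integral => w _; congr (cos (_ + c))%:E.
  apply: eq_bigr => i _; rewrite big_bool/= /X; ring.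
pose Q : probability (measurableTypeR R * measurableTypeR R)%type R :=
  (gamma \x gamma)%E.
have := @gauss_blocks R bool _ _ Q (pair_model p (l * p) r) _
  (measurable_pair_model p (l * p) r) (pair_modelE p (l * p) r)
  n _ W P X zz mX Xphi.
have -> : (\int[P]_w (\prod_i \prod_j gauss (X i j w - zz i j))%:E =
   \int[P]_w (\prod_i (gauss ((V i w - z i) / e) *
     gauss ((V' i w - z' i) / e)))%:E)%E.
  apply: eq_integral => w _; congr EFin; apply: eq_bigr => i _.
  by rewrite big_bool/= /X /zz !mulrBl mulrC.
move=> ->; rewrite lee_fin; apply: ler_prod => i _; apply/andP; split.
  by apply: Rintegral_ge0 => s _; apply: prodr_ge0 => j _; exact: gauss_ge0.
rewrite -lee_fin.
apply: (@le_trans _ _ (\int[Q]_s (\prod_j gauss (pair_model p (l * p) r j s -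
     (if j then z' i / e else z i / e)))%:E)%E).
  rewrite /Rintegral fineK; last first.
    apply: integrable_fin_num => //; apply: (@bounded_integrable _ _ _ _ _ 1).
      by apply: measurable_prod_gauss => j; exact: measurable_pair_model.
    by move=> ?; exact: prod_gauss_le1.
  rewrite le_eqVlt; apply/orP; left; apply/eqP; apply: eq_integral => s _.
  by rewrite !big_bool/=.
apply: (le_trans (pair_model_gauss _ _ _ p0 BL)).
have e2 : 0 < e ^+ 2 by exact: exprn_gt0.
have r2 : 1 + r ^+ 2 = (e ^+ 2 + C) / e ^+ 2.
  by rewrite /r expr_div_n sqr_sqrtr// [RHS]mulrDl divff ?gt_eqF.
have -> : Num.sqrt (1 + r ^+ 2) = Num.sqrt (e ^+ 2 + C) / e.
  rewrite r2 sqrtrM; last by rewrite addr_ge0// ltW.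
  by rewrite sqrtrV ?ltW// sqrtr_sqr gtr0_norm.
rewrite lee_fin r2 le_eqVlt; apply/orP; left; apply/eqP.
rewrite -/l.
have -> : - (l * (z i / e) - z' i / e) ^+ 2 / (1 + 2 * L ^+ 2) /
    (2 * ((e ^+ 2 + C) / e ^+ 2)) =
  - (l * z i - z' i) ^+ 2 / (1 + 2 * L ^+ 2) / (2 * (e ^+ 2 + C)).
  have -> : l * (z i / e) - z' i / e = (l * z i - z' i) / e by ring.
  rewrite expr_div_n; field.
  have L2 : 0 < 1 + 2 * L ^+ 2 by have := sqr_ge0 L; lra.
  by rewrite (gt_eqF (ltr_pwDl e2 C0)) (gt_eqF L2) (gt_eqF e0).
by rewrite /p !(invfM _ e^-1) !invrK; ring.
Qed.

(** An equality, because the one-point density is to be bounded from below. *)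
Lemma single_gaussE (n : nat) d (W : measurableType d) (P : probability W R)
    (V : 'I_n -> W -> R) (A e : R) (z : 'I_n -> R) :
  (forall i, measurable_fun setT (V i)) ->
  (forall (a : 'I_n -> R) c,
    (\int[P]_w (cos (\sum_i a i * V i w + c))%:E =
    (cos c * \prod_i expR (- (a i ^+ 2 * A) / 2))%:E)%E) ->
  0 <= A -> 0 < e ->
  (\int[P]_w (\prod_i gauss ((V i w - z i) / e))%:E =
   (\prod_(i < n) (e / Num.sqrt (e ^+ 2 + A) *
       expR (- z i ^+ 2 / (2 * (e ^+ 2 + A)))))%:E)%E.
Proof.
move=> mV VA A0 e0; pose p := Num.sqrt A / e.
pose X (i : 'I_n) (j : 'I_1) w := V i w / e.
pose zz (i : 'I_n) (j : 'I_1) := z i / e.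
have mX i j : measurable_fun setT (X i j) by exact: measurable_funM.
pose Y (j : 'I_1) (x : measurableTypeR R) : R := p * x.
have mY j : measurable_fun setT (Y j) by exact: measurable_funM.
have Xphi (a : 'I_n -> 'I_1 -> R) c :
    (\int[P]_w (cos (\sum_i \sum_j a i j * X i j w + c))%:E =
     (cos c * \prod_i expR (- (a i ord0 * p) ^+ 2 / 2))%:E)%E.
  have := VA (fun i => a i ord0 / e) c.
  have -> : \prod_i expR (- ((a i ord0 / e) ^+ 2 * A) / 2) =
      \prod_i expR (- (a i ord0 * p) ^+ 2 / 2).
    apply: eq_bigr => i _; congr (expR (- _ / 2)).
    by rewrite /p !exprMn sqr_sqrtr//; ring.
  move=> <-; apply: eq_integral => w _; congr (cos (_ + c))%:E.
  by apply: eq_bigr => i _; rewrite big_ord1 /X; ring.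
have Yphi (b : 'I_1 -> R) c : (\int[gamma]_s (cos (\sum_j b j * Y j s + c))%:E =
    (cos c * expR (- (b ord0 * p) ^+ 2 / 2))%:E)%E.
  rewrite -integral_normal_cos; apply: eq_integral => x _.
  by rewrite big_ord1 /Y mulrA.
have := @gauss_blocks R 'I_1 _ _ gamma Y _ mY Yphi n _ W P X zz mX Xphi.
have -> : (\int[P]_w (\prod_i \prod_j gauss (X i j w - zz i j))%:E =
   \int[P]_w (\prod_i gauss ((V i w - z i) / e))%:E)%E.
  apply: eq_integral => w _; congr EFin; apply: eq_bigr => i _.
  by rewrite big_ord1/= /X /zz !mulrBl.
move=> ->; congr EFin; apply: eq_bigr => i _.
have e2 : 0 < e ^+ 2 by exact: exprn_gt0.
have p2 : 1 + p ^+ 2 = (e ^+ 2 + A) / e ^+ 2.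
  by rewrite /p expr_div_n sqr_sqrtr// mulrDl divff ?gt_eqF.
transitivity (\int[gamma]_x gauss (p * x - z i / e)).
  by apply: eq_Rintegral => x _; rewrite big_ord1.
rewrite /Rintegral normal_gauss/= p2 sqrtrM; last by rewrite addr_ge0// ltW.
rewrite sqrtrV ?ltW// sqrtr_sqr gtr0_norm// invfM invrK.
rewrite [_^-1 * e]mulrC; congr (_ * expR _).
rewrite expr_div_n; field.
by rewrite !gt_eqF//; exact: ltr_pwDl.
Qed.

End gaussian_density.

(** * Integrals of powers of a distance *)

Lemma measurable_sublevel (R : realType) d (T : measurableType d) (N : T -> R) r :
  measurable_fun setT N -> measurable [set x | N x <= r].
Proof.
move=> mN; rewrite -[X in measurable X]setTI.
rewrite (_ : [set x | _] = N @^-1` `]-oo, r]%classic).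
  by apply: mN => //; exact: measurable_itv.
by apply/seteqP; split => x /=; rewrite in_itv.
Qed.

Section shells.
Context {R : realType} d (T : measurableType d).
Variable mu : {measure set T -> \bar R}.

(** On [D], the function [f] is at most the sum of the steps [c n] on [A n]. *)
Lemma integral_le_cover (f : T -> \bar R) (D : set T) (A : (set T)^nat)
    (c : R^nat) :
  measurable D -> (forall n, measurable (A n)) -> (forall n, 0 <= c n) ->
  measurable_fun D f -> (forall x, 0 <= f x)%E ->
  (forall x, D x -> exists2 n, A n x & (f x <= (c n)%:E)%E) ->
  (\int[mu]_(x in D) f x <= \sum_(n <oo) ((c n)%:E * mu (A n)))%E.
Proof.
move=> mD mA c0 mf f0 fc.
pose g n x : \bar R := ((c n)%:E * (\1_(A n) x)%:E)%E.
have g0 n x : (0 <= g n x)%E by rewrite mule_ge0// lee_fin.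
have mg n : measurable_fun setT (g n).
  by apply: measurable_funeM; apply/measurable_EFinP; exact: measurable_indic.
apply: (@le_trans _ _ (\int[mu]_(x in D) (\sum_(n <oo) g n x))%E).
  apply: ge0_le_integral => //.
  - apply: measurable_funTS; apply: ge0_emeasurable_sum => //.
  - move=> x /fc[n Anx fcn]; apply: (le_trans fcn).
    apply: (@le_trans _ _ (g n x)).
      by rewrite /g indicE mem_set// mule1.
    apply: (le_trans _ (@nneseries_lim_ge _ (g ^~ x) xpredT 0 n.+1 _)) => //.
    by rewrite big_nat_recr//= leeDr// sume_ge0.
rewrite integral_nneseries//; last by move=> n; exact: measurable_funTS.
apply: lee_nneseries => [n _ _|n _]; first exact: integral_ge0.
apply: (@le_trans _ _ (\int[mu]_x g n x)%E).
  by apply: ge0_subset_integral => //.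
rewrite /g ge0_integralZl//; last 2 first.
- by apply/measurable_EFinP; exact: measurable_indic.
- by rewrite lee_fin.
by rewrite integral_indic// setIT.
Qed.

Lemma nneseries_geometric_le (a q : R) : 0 <= a -> 0 <= q -> q < 1 ->
  (\sum_(n <oo) (a * q ^+ n)%:E <= (a / (1 - q))%:E)%E.
Proof.
move=> a0 q0 q1; apply: lime_le.
  by apply: is_cvg_nneseries => n _ _; rewrite lee_fin mulr_ge0// exprn_ge0.
apply: nearW => n; rewrite sumEFin lee_fin.
have := geometric_seriesE a (negbT (lt_eqF q1)); move=> /(congr1 (fun f => f n))/=.
rewrite /series/= => ->; rewrite ler_pM2r ?invr_gt0 ?subr_gt0// ler_piMr//.
by rewrite lerBlDr lerDl exprn_ge0.
Qed.

Let powR2_lt1 (x : R) : x < 0 -> 2 `^ x < 1.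
Proof.
move=> x0; rewrite -[x]opprK powRN invf_lt1 ?powR_gt0//.
have := @gt0_ltr_powR _ (- x) _ 1 2; rewrite powR1; apply => //.
- by rewrite oppr_gt0.
- by rewrite nnegrE.
- by rewrite nnegrE.
- by rewrite ltr1n.
Qed.

Lemma ler_powRN (x y kappa : R) : 0 < x -> x <= y -> 0 <= kappa ->
  y `^ (- kappa) <= x `^ (- kappa).
Proof.
move=> x0 xy k0; rewrite !powRN lef_pV2 ?posrE ?powR_gt0// ?(lt_le_trans x0)//.
by rewrite ge0_ler_powR// ?nnegrE ltW// (lt_le_trans x0).
Qed.

Variables (N : T -> R) (n : nat) (C : R).
Hypotheses (mN : measurable_fun setT N) (N0 : forall x, 0 <= N x) (C0 : 0 <= C).
Hypothesis muN : forall r, 0 < r -> (mu [set x | (N x <= r)%R] <= (C * r ^+ n)%:E)%E.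

Let measurable_le r : measurable [set x | N x <= r].
Proof. exact: measurable_sublevel. Qed.

Let mNp kappa D : measurable_fun D (fun x => (N x `^ kappa)%:E).
Proof.
apply: measurable_funTS; apply/measurable_EFinP.
exact: (measurableT_comp (measurable_powR _)).
Qed.

(** The bound on a dyadic shell is the supremum of the integrand, at the inner
    radius, times the measure of the ball of the outer one. *)
Let shell_term (rho kappa t : R) : 0 < rho -> 0 < t -> 0 <= kappa ->
  (((t * rho) `^ (- kappa))%:E * mu [set x | (N x <= 2 * (t * rho))%R] <=
   (C * 2 ^+ n * rho `^ (n%:R - kappa) * t `^ (n%:R - kappa))%:E)%E.
Proof.
move=> rho0 t0 k0; have tr0 : 0 < t * rho by rewrite mulr_gt0.
apply: (le_trans (lee_wpmul2l _ (muN _))); rewrite ?lee_fin ?powR_ge0//.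
  by rewrite mulr_gt0.
have E x : 0 < x -> x `^ (n%:R - kappa) = x ^+ n * x `^ (- kappa).
  by move=> x0; rewrite powRD ?powR_mulrn ?ltW// (gt_eqF x0) implybT.
rewrite (E _ rho0) (E _ t0) (powRM _ (ltW t0) (ltW rho0)) !exprMn.
by rewrite le_eqVlt; apply/orP; left; apply/eqP; ring.
Qed.

Let exp2_powR (x : R) (j : nat) : (2 ^+ j) `^ x = (2 `^ x) ^+ j.
Proof. by rewrite -powR_mulrn// -powRrM mulrC powRrM powR_mulrn// powR_ge0. Qed.

Let exp2V_powR (x : R) (j : nat) : (2 ^- j.+1) `^ x = (2 `^ (- x)) ^+ j.+1.
Proof.
rewrite -powR_invn// -powRrM -[RHS]powR_mulrn ?powR_ge0// -powRrM.
by rewrite !mulNr mulrC.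
Qed.

(** The dyadic shells contribute a geometric series of ratio [2^(n - kappa)]. *)
Lemma integral_powR_far (rho kappa : R) (D : set T) : 0 < rho ->
  measurable D -> (forall x, D x -> rho < N x) -> n%:R < kappa ->
  (\int[mu]_(x in D) (N x `^ (- kappa))%:E <=
   (C * 2 ^+ n * rho `^ (n%:R - kappa) / (1 - 2 `^ (n%:R - kappa)))%:E)%E.
Proof.
move=> rho0 mD rhoD nk; have k0 : 0 <= kappa by rewrite (le_trans _ (ltW nk)).
apply: (@le_trans _ _ (\sum_(j <oo) (((2 ^+ j * rho) `^ (- kappa))%:E *
   mu [set x | (N x <= 2 * (2 ^+ j * rho))%R]))%E).
  apply: (@integral_le_cover _ D (fun j => [set x | N x <= 2 * (2 ^+ j * rho)])
    (fun j => (2 ^+ j * rho) `^ (- kappa))) => //.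
  - by move=> j; exact: powR_ge0.
  - by move=> x; rewrite lee_fin powR_ge0.
  move=> x /rhoD rx.
  have ex : exists j, N x <= 2 ^+ j * rho.
    exists (Num.truncn (N x / rho)).+1; rewrite -ler_pdivrMr//.
    apply: (le_trans (ltW (truncnS_gt _))).
    by rewrite -natrX ler_nat ltnW// ltn_expl.
  case: (ex_minnP ex) => -[|j] hj minj.
    by move: hj; rewrite expr0 mul1r leNgt rx.
  exists j; first by rewrite /= mulrA -exprS.
  rewrite lee_fin ler_powRN ?mulr_gt0 ?exprn_gt0// leNgt.
  by apply/negP => /ltW /minj; rewrite ltnn.
have p2 : 2 `^ (n%:R - kappa) < 1 :> R by rewrite powR2_lt1// subr_lt0.
apply: (le_trans _ (nneseries_geometric_le _ _ p2)); last 2 first.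
- by rewrite !mulr_ge0 ?powR_ge0// exprn_ge0.
- exact: powR_ge0.
apply: lee_nneseries => [j _ _|j _].
  by rewrite mule_ge0// lee_fin powR_ge0.
apply: (le_trans (shell_term rho0 _ k0)); first exact: exprn_gt0.
by rewrite exp2_powR.
Qed.

(** Here the shells shrink to [0], and the ratio is [2^(kappa - n)]. *)
Lemma integral_powR_near (rho kappa : R) : 0 < rho -> 0 < kappa -> kappa < n%:R ->
  (\int[mu]_(x in [set x | (N x <= rho)%R]) (N x `^ (- kappa))%:E <=
   (C * 2 ^+ n * rho `^ (n%:R - kappa) * 2 `^ (kappa - n%:R) /
     (1 - 2 `^ (kappa - n%:R)))%:E)%E.
Proof.
move=> rho0 k0 kn.
apply: (@le_trans _ _ (\sum_(j <oo) (((2 ^- j.+1 * rho) `^ (- kappa))%:E *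
   mu [set x | (N x <= 2 * (2 ^- j.+1 * rho))%R]))%E).
  apply: (@integral_le_cover _ _ (fun j => [set x | N x <= 2 * (2 ^- j.+1 * rho)])
    (fun j => (2 ^- j.+1 * rho) `^ (- kappa))) => //.
  - by move=> j; exact: powR_ge0.
  - by move=> x; rewrite lee_fin powR_ge0.
  move=> x /= rx.
  have [Nx0|Nx0] := eqVneq (N x) 0.
    (* At [N x = 0] the negative power is [0], by convention. *)
    exists 0%N; first by rewrite /= Nx0 !mulr_ge0 ?invr_ge0// ltW.
    by rewrite Nx0 powR0 ?oppr_eq0 ?gt_eqF// lee_fin powR_ge0.
  have {}Nx0 : 0 < N x by rewrite lt_neqAle eq_sym Nx0 N0.
  have ex : exists j, 2 ^- j * rho < N x.
    exists (Num.truncn (rho / N x)).+1; rewrite mulrC ltr_pdivrMr ?exprn_gt0//.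
    rewrite mulrC -ltr_pdivrMr//; apply: (lt_le_trans (truncnS_gt _)).
    by rewrite -natrX ler_nat ltnW// ltn_expl.
  case: (ex_minnP ex) => -[|j] hj minj.
    by move: hj; rewrite expr0 invr1 mul1r ltNge rx.
  exists j.
    rewrite /= exprS invfM !mulrA divff// mul1r leNgt.
    by apply/negP => /minj; rewrite ltnn.
  by rewrite lee_fin ler_powRN// ?mulr_gt0 ?invr_gt0 ?exprn_gt0// ltW.
have p2 : 2 `^ (kappa - n%:R) < 1 :> R by rewrite powR2_lt1// subr_lt0.
apply: (le_trans _ (nneseries_geometric_le _ _ p2)); last 2 first.
- by rewrite !mulr_ge0 ?powR_ge0// exprn_ge0.
- exact: powR_ge0.
apply: lee_nneseries => [j _ _|j _].
  by rewrite mule_ge0// lee_fin powR_ge0.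
apply: (le_trans (shell_term rho0 _ (ltW k0))).
  by rewrite invr_gt0 exprn_gt0.
by rewrite exp2V_powR opprB exprS mulrA.
Qed.

(** At the critical exponent, each dyadic shell contributes at most a constant. *)
Lemma integral_powR_log (rho : R) (J : nat) (D : set T) : 0 < rho ->
  measurable D -> (forall x, D x -> rho < N x <= 2 ^+ J * rho) ->
  (\int[mu]_(x in D) (N x `^ (- n%:R))%:E <= (C * 2 ^+ n * J%:R)%:E)%E.
Proof.
move=> rho0 mD rhoD.
pose c j := if (j < J)%N then (2 ^+ j * rho) `^ (- n%:R) else 0.
apply: (@le_trans _ _ (\sum_(j <oo) ((c j)%:E *
   mu [set x | (N x <= 2 * (2 ^+ j * rho))%R]))%E).
  apply: (@integral_le_cover _ D (fun j => [set x | N x <= 2 * (2 ^+ j * rho)])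
    c) => //.
  - by move=> j; rewrite /c; case: ifP => // _; exact: powR_ge0.
  - by move=> x; rewrite lee_fin powR_ge0.
  move=> x /rhoD/andP[rx xJ].
  have ex : exists j, N x <= 2 ^+ j * rho by exists J.
  case: (ex_minnP ex) => -[|j] hj minj.
    by move: hj; rewrite expr0 mul1r leNgt rx.
  exists j; first by rewrite /= mulrA -exprS.
  rewrite /c (minj _ xJ) lee_fin ler_powRN ?mulr_gt0 ?exprn_gt0// leNgt.
  by apply/negP => /ltW /minj; rewrite ltnn.
rewrite (nneseries_split _ J); last first.
  by move=> j _; rewrite mule_ge0// lee_fin /c; case: ifP => // _; exact: powR_ge0.
rewrite add0n [X in (_ + X)%E]eseries0 ?adde0; last first.
  by move=> j Jj _; rewrite /c ltnNge Jj mul0e.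
apply: (@le_trans _ _ (\sum_(0 <= j < J) (C * 2 ^+ n)%:E)%E).
  rewrite !big_nat; apply: lee_sum => j /andP[_ jJ].
  rewrite /c jJ; apply: (le_trans (shell_term rho0 _ _)) => //.
  by rewrite subrr !powRr0 !mulr1.
by rewrite sumEFin lee_fin big_const_nat iter_addr_0 subn0 mulr_natr.
Qed.

End shells.

(** * The spectral integral *)

Section euclidean_norm.
Context {R : realType} (k : nat).
Implicit Types v w : 'rV[R]_k.

Lemma rV_coord_le v i : `|v 0 i| <= `|v|.
Proof.
rewrite -[`|v|]/(mx_norm v) mx_normrE.
exact: (le_bigmax _ (fun ij : 'I_1 * 'I_k => `|v ij.1 ij.2|) (0, i)).
Qed.

Lemma enorm_ge0 v : 0 <= enorm v. Proof. exact: sqrtr_ge0. Qed.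

Lemma coord_le_enorm v i : `|v 0 i| <= enorm v.
Proof.
rewrite -sqrtr_sqr ler_wsqrtr// (bigD1 i)//= lerDl sumr_ge0// => j _.
exact: sqr_ge0.
Qed.

Lemma enorm_le_sum v : enorm v <= \sum_i `|v 0 i|.
Proof.
have s0 : 0 <= \sum_i `|v 0 i| by exact: sumr_ge0.
rewrite -[leRHS]ger0_norm// -sqrtr_sqr ler_wsqrtr//.
rewrite [leRHS]expr2 mulr_suml; apply: ler_sum => i _.
rewrite -real_normK ?num_real// expr2 ler_wpM2l// (bigD1 i)//= lerDl.
exact: sumr_ge0.
Qed.

Lemma measurable_enorm : measurable_fun setT (@enorm R k).
Proof.
apply: measurableT_comp.
  by apply: continuous_measurable_fun; exact: sqrt_continuous.
apply: measurable_sum => i; apply: measurable_funX; exact: measurable_coord.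
Qed.

Lemma measurable_edot w : measurable_fun setT (fun v => edot v w).
Proof.
by apply: measurable_sum => i; apply: measurable_funM => //;
  exact: measurable_coord.
Qed.

Lemma normr_edot_le v w : `|edot v w| <= enorm v * (k%:R * `|w|).
Proof.
rewrite (le_trans (ler_norm_sum _ _ _))//.
apply: (@le_trans _ _ (\sum_(i < k) enorm v * `|w|)).
  apply: ler_sum => i _; rewrite normrM ler_pM ?coord_le_enorm//.
  exact: rV_coord_le.
by rewrite sumr_const card_ord -mulrnAr -mulr_natl.
Qed.

Lemma measurable_rV_box (B : 'I_k -> set R) : (forall i, measurable (B i)) ->
  measurable [set v : 'rV[R]_k | forall i, B i (v 0 i)].
Proof.
move=> mB; rewrite (_ : [set _ | _] = \bigcap_(i in [set: 'I_k])
    ((fun v : 'rV[R]_k => v 0 i) @^-1` B i)).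
  apply: fin_bigcap_measurable => // i _.
  by rewrite -[X in measurable X]setTI; exact: measurable_coord.
by apply/seteqP; split=> [v h i _|v h i]; [exact: h|exact: (h i)].
Qed.

Lemma lebesgue_rV_enorm_le (r : R) : 0 < r ->
  (lebesgue_rV R k [set v | (enorm v <= r)%R] <= (2 ^+ k * r ^+ k)%:E)%E.
Proof.
move=> r0.
have -> : (2 ^+ k * r ^+ k)%:E = lebesgue_rV R k
    [set v : 'rV[R]_k | forall i, `[(- r), r]%classic (v 0 i)].
  rewrite (@lebesgue_rV_box R k (fun=> `[(- r), r]%classic)); last first.
    by move=> i; exact: measurable_itv.
  under eq_bigr.
    move=> i _; rewrite lebesgue_measure_itv/= lte_fin gtrN// -EFinB opprK.
    over.
  by rewrite prodEFin prodr_const card_ord -exprMn (mulr_natl _ 2).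
apply: le_measure; rewrite ?inE.
- exact: (measurable_sublevel _ measurable_enorm).
- by apply: (measurable_rV_box (B := fun=> `[(- r), r]%classic)) => i; exact: measurable_itv.
- move=> v /= vr i; rewrite in_itv/= -ler_norml.
  exact: le_trans (coord_le_enorm _ _) vr.
Qed.

End euclidean_norm.

Section dominating_weight.
Context {R : realType} (k : nat) (eta : R).
Hypotheses (k1 : (1 <= k)%N) (eta0 : 0 < eta) (eta1 : eta < 1).

(** The two exponents lie on the two sides of the critical exponent [- k], so that the
    weight is integrable both at [0] and at infinity. With [eta = (2 - beta) / 2], it
    is the spectral weight [|v|^(beta - k - 2)] times [|v|^(1 + eta)] for small [v]
    and times [|v|^eta] for large [v]. *)
Definition dom_weight (v : 'rV[R]_k) : R :=
  if enorm v <= 1 then enorm v `^ (- (k%:R - (1 - eta)))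
  else enorm v `^ (- (k%:R + eta)).

Lemma dom_weight_ge0 v : 0 <= dom_weight v.
Proof. by rewrite /dom_weight; case: ifP => _; exact: powR_ge0. Qed.

Lemma measurable_dom_weight : measurable_fun setT dom_weight.
Proof.
have mp x : measurable_fun setT (fun v : 'rV[R]_k => enorm v `^ x).
  apply: (@measurableT_comp _ _ _ _ _ _ (fun y : R => y `^ x)).
    exact: measurable_powR.
  exact: measurable_enorm.
apply: measurable_fun_ifT => //.
by apply: measurable_fun_ler => //; exact: measurable_enorm.
Qed.

Lemma integral_dom_weight_lty :
  (\int[lebesgue_rV R k]_v (dom_weight v)%:E < +oo)%E.
Proof.
pose D := [set v : 'rV[R]_k | enorm v <= 1].
have mD : measurable D.
  exact: (measurable_sublevel _ (@measurable_enorm R k)).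
have kR : 1 <= k%:R :> R by rewrite ler1n.
rewrite -(setUv D) ge0_integral_setU//; last 4 first.
- exact: measurableC.
- by rewrite setUv; apply/measurable_EFinP; exact: measurable_dom_weight.
- by move=> v _; rewrite lee_fin dom_weight_ge0.
- by rewrite disj_set2E setICr.
apply: lte_add_pinfty.
  rewrite (eq_integral (fun v => (enorm v `^ (- (k%:R - (1 - eta))))%:E)).
    apply: (le_lt_trans (@integral_powR_near _ _ _ _ (@enorm R k) k (2 ^+ k) _ _ _ _
      1 _ _ _ _)); rewrite ?ltry//.
    + exact: measurable_enorm.
    + exact: enorm_ge0.
    + exact: lebesgue_rV_enorm_le.
    + by rewrite subr_gt0 (lt_le_trans _ kR)// ltrBlDr ltrDl.
    + by rewrite ltrBlDr ltrDl subr_gt0.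
  by move=> v; rewrite inE /D/= /dom_weight => ->.
rewrite (eq_integral (fun v => (enorm v `^ (- (k%:R + eta)))%:E)).
  have far v : (~` D) v -> 1 < enorm v by rewrite /D/= => /negP; rewrite -ltNge.
  have kk : k%:R < k%:R + eta by rewrite ltrDl.
  have := integral_powR_far (measurable_enorm (k := k)) _
    (@lebesgue_rV_enorm_le R k) ltr01 (measurableC mD) far kk.
  by move=> h; apply: (le_lt_trans (h _)); rewrite ?ltry.
by move=> v; rewrite inE /D/= /dom_weight => /negP/negbTE ->.
Qed.

End dominating_weight.

(** * The covariance of the solution *)

Section trigonometric_bounds.
Context {R : realType}.

Let lip1 (f f' : R -> R) : (forall x : R, is_derive x 1 f (f' x)) ->
  (forall x, `|f' x| <= 1) -> forall x y, `|f x - f y| <= `|x - y|.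
Proof.
move=> df f1 x y; wlog xy : x y / y <= x => [h|].
  have [/h//|/ltW/h] := leP y x.
  by rewrite distrC => /le_trans; apply; rewrite distrC.
have cf : {within `[y, x], continuous f}.
  apply: continuous_subspaceT => z.
  by apply/differentiable_continuous/derivable1_diffP; case: (df z).
have [c _ ->] := MVT_segment xy (fun z _ => df z) cf.
by rewrite normrM ler_piMl.
Qed.

Lemma sin_lip (x y : R) : `|sin x - sin y| <= `|x - y|.
Proof.
apply: (lip1 (f' := cos)) => z.
by rewrite ler_norml cos_geN1 cos_le1.
Qed.

Lemma cos_lip (x y : R) : `|cos x - cos y| <= `|x - y|.
Proof.
apply: (lip1 (f' := fun z => - sin z)) => z.
by rewrite normrN ler_norml sin_geN1 sin_le1.
Qed.

Lemma sin_le_norm (x : R) : `|sin x| <= `|x|.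
Proof. by have := sin_lip x 0; rewrite sin0 !subr0. Qed.

Lemma normr_sin_le1 (x : R) : `|sin x| <= 1.
Proof. by rewrite ler_norml sin_geN1 sin_le1. Qed.

Lemma normr_cos_le1 (x : R) : `|cos x| <= 1.
Proof. by rewrite ler_norml cos_geN1 cos_le1. Qed.

(** Interpolation between a Lipschitz bound and a uniform one. *)
Lemma holder_interpolation (eta x y : R) : 0 < eta -> eta <= 1 -> 0 <= x ->
  y <= x -> y <= 2 -> y <= 2 * x `^ eta.
Proof.
move=> e0 e1 x0 yx y2; have [x1|x1] := leP x 1.
  apply: (le_trans yx); have [->|xn0] := eqVneq x 0; first by rewrite mulr_ge0 ?powR_ge0.
  have := @ger_powR _ x _ eta 1 e1; rewrite powRr1// lt_neqAle eq_sym xn0 x0 x1 => /(_ isT) h.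
  by apply: (le_trans h); rewrite ler_peMl ?powR_ge0// ler1n.
apply: (le_trans y2); rewrite ler_peMr// -(powRr0 x).
by rewrite ler_powR// ltW.
Qed.

End trigonometric_bounds.

Section wave_kernel.
Context {R : realType} (k : nat) (beta : R).
Hypotheses (k1 : (1 <= k)%N) (beta0 : 0 < beta) (beta2 : beta < 2)
  (betak : beta < k%:R).
Let eta : R := (2 - beta) / 2.
Let eta0 : 0 < eta. Proof. by rewrite divr_gt0// subr_gt0. Qed.
Let eta1 : eta < 1.
Proof. by rewrite ltr_pdivrMr// mul1r ltrBlDr ltrDl. Qed.
Let betaE : beta = 2 - 2 * eta.
Proof. by rewrite /eta mulrC divfK// opprB addrC subrK. Qed.

Notation nu := (lebesgue_measure \x lebesgue_rV R k)%E.

(** The indicator makes the range of the time integral independent of the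
    parameters. *)
Definition wave_sin (t : R) (z : measurableTypeR R * 'rV[R]_k) : R :=
  \1_(`[0, t]%classic : set R) z.1 * sin ((t - z.1) * enorm z.2).

Definition wave_kernel (p q : R * 'rV[R]_k) (z : measurableTypeR R * 'rV[R]_k) : R :=
  cos (edot z.2 (p.2 - q.2)) * (wave_sin p.1 z * wave_sin q.1 z) *
  enorm z.2 `^ (beta - k%:R - 2).

Let measurable_time_indic t : measurable_fun setT
  (fun z : measurableTypeR R * 'rV[R]_k => \1_(`[0, t]%classic : set R) z.1 : R).
Proof.
have h : measurable_fun setT
    (\1_(`[0, t]%classic : set (measurableTypeR R)) : measurableTypeR R -> R).
  by apply: measurable_indic; exact: measurable_itv.
exact: measurableT_comp h measurable_fst.
Qed.

Lemma measurable_wave_sin t : measurable_fun setT (wave_sin t).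
Proof.
apply: measurable_funM.
  exact: measurable_time_indic.
apply: measurableT_comp measurable_sin _; apply: measurable_funM.
  exact: measurable_funB.
exact: measurableT_comp (@measurable_enorm R k) _.
Qed.

Lemma measurable_spectral_weight :
  measurable_fun setT (fun v : 'rV[R]_k => enorm v `^ (beta - k%:R - 2)).
Proof.
apply: (@measurableT_comp _ _ _ _ _ _ (fun y : R => y `^ (beta - k%:R - 2))).
  exact: measurable_powR.
exact: measurable_enorm.
Qed.

Lemma measurable_wave_kernel p q : measurable_fun setT (wave_kernel p q).
Proof.
apply: measurable_funM; last exact: measurableT_comp measurable_spectral_weight _.
apply: measurable_funM.
  apply: measurableT_comp measurable_cos _.
  exact: measurableT_comp (measurable_edot _) _.
by apply: measurable_funM; exact: measurable_wave_sin.
Qed.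

(** A sine is at most [min 1 (T n)], while the increments are of order [n^eta]. The
    product of the two bounds makes the spectral weight integrable. *)
Let weight_bound (a b K T n : R) (v : 'rV[R]_k) : n = enorm v ->
  0 <= K -> 1 <= T -> `|a| <= 1 -> `|a| <= T * n -> `|b| <= K * n `^ eta ->
  `|a * b| * n `^ (beta - k%:R - 2) <= K * T * dom_weight eta v.
Proof.
move=> nE K0 T1 a1 aT bK.
have T0 : 0 < T by rewrite (lt_le_trans _ T1).
have n0 : 0 <= n by rewrite nE enorm_ge0.
have [nz|nz] := eqVneq n 0.
  move: aT; rewrite nz mulr0 normr_le0 => /eqP ->.
  by rewrite mul0r normr0 mul0r !mulr_ge0 ?dom_weight_ge0// ltW.
have {}n0 : 0 < n by rewrite lt_neqAle eq_sym nz n0.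
have pD x y : n `^ x * n `^ y = n `^ (x + y) by rewrite powRD// nz implybT.
rewrite normrM /dom_weight -nE.
have [n1|n1] := leP n 1.
  apply: (@le_trans _ _ (T * n * (K * n `^ eta) * n `^ (beta - k%:R - 2))).
    by rewrite ler_wpM2r ?powR_ge0// ler_pM.
  rewrite -[X in T * X](powRr1 (ltW n0)).
  have -> : T * n `^ 1 * (K * n `^ eta) * n `^ (beta - k%:R - 2) =
    K * T * (n `^ 1 * n `^ eta * n `^ (beta - k%:R - 2)) by ring.
  rewrite !pD betaE; apply: ler_wpM2l; first by rewrite mulr_ge0// ltW.
  by rewrite le_eqVlt; apply/orP; left; apply/eqP; congr (_ `^ _); ring.
apply: (@le_trans _ _ (1 * (K * n `^ eta) * n `^ (beta - k%:R - 2))).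
  by rewrite ler_wpM2r ?powR_ge0// ler_pM.
rewrite mul1r -mulrA pD betaE.
have -> : eta + (2 - 2 * eta - k%:R - 2) = - (k%:R + eta) by ring.
by rewrite ler_wpM2r ?powR_ge0// ler_peMr.
Qed.

Let norm_le_interpol (a T n : R) : 0 <= n -> 1 <= T -> `|a| <= 1 -> `|a| <= T * n ->
  `|a| <= 2 * T * n `^ eta.
Proof.
move=> n0 T1 a1 aT; have T0 : 0 <= T by rewrite (le_trans _ T1).
have h : `|a| <= 2 * (T * n) `^ eta.
  apply: holder_interpolation => //; first exact: ltW.
    exact: mulr_ge0.
  by rewrite (le_trans a1)// ler1n.
rewrite (le_trans h)// -mulrA ler_pM2l// powRM// ler_wpM2r ?powR_ge0//.
by rewrite -[leRHS](powRr1 T0) ler_powR// ltW.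
Qed.

Let wave_sin_le t T (z : measurableTypeR R * 'rV[R]_k) : t <= T -> 0 <= z.1 -> 1 <= T ->
  `|wave_sin t z| <= 1 /\ `|wave_sin t z| <= T * enorm z.2.
Proof.
move=> tT z0 T1; rewrite /wave_sin indicE; have [zt|zt] := leP z.1 t; last first.
  rewrite memNset/= ?in_itv/= ?(leNgt _ t) ?zt ?andbF//.
  by rewrite mul0r normr0 ler01 mulr_ge0 ?enorm_ge0// (le_trans _ T1).
rewrite mem_set/= ?in_itv/= ?z0// mul1r normr_sin_le1; split => //.
rewrite (le_trans (sin_le_norm _))// normrM (ger0_norm (enorm_ge0 _)).
rewrite ler_wpM2r ?enorm_ge0// ger0_norm ?subr_ge0//.
by rewrite lerBlDr (le_trans tT)// lerDl.
Qed.

Definition dominator (T : R) (z : measurableTypeR R * 'rV[R]_k) : R :=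
  \1_(`[0, T]%classic : set R) z.1 * dom_weight eta z.2.

Lemma dominator_ge0 T z : 0 <= dominator T z.
Proof. by rewrite mulr_ge0 ?dom_weight_ge0. Qed.

Lemma measurable_dominator T : measurable_fun setT (dominator T).
Proof.
apply: measurable_funM.
  exact: measurable_time_indic.
exact: measurableT_comp (@measurable_dom_weight R k eta) measurable_snd.
Qed.

Lemma integrable_dominator T : nu.-integrable setT (EFin \o dominator T).
Proof.
have mw : measurable_fun setT (fun v : 'rV[R]_k => (dom_weight eta v)%:E).
  by apply/measurable_EFinP; exact: measurable_dom_weight.
apply/integrable12ltyP.
  by apply/measurable_EFinP; exact: measurable_dominator.
under eq_integral.
  move=> r _.
  rewrite (eq_integral (fun v => (\1_(`[0, T]%classic : set R) r)%:E *
    (dom_weight eta v)%:E)%E); last first.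
    by move=> v _; rewrite /= ger0_norm ?dominator_ge0// EFinM.
  rewrite ge0_integralZl//.
  over.
  by move=> v _; rewrite lee_fin dom_weight_ge0.
rewrite ge0_integralZr//; last 2 first.
- by apply/measurable_EFinP; apply: measurable_indic; exact: measurable_itv.
- by apply: integral_ge0 => v _; rewrite lee_fin dom_weight_ge0.
have mI : measurable (`[0, T]%classic : set (measurableTypeR R)).
  exact: measurable_itv.
rewrite integral_indic//= setIT; apply: lte_mul_pinfty => //.
- by rewrite ge0_fin_numE// lebesgue_measure_itv/=; case: ifP; rewrite ltry.
- exact: (integral_dom_weight_lty k1 eta0 eta1).
Qed.

Let out_of_range T (z : measurableTypeR R * 'rV[R]_k) t : t <= T -> ~ (0 <= z.1 <= T) -> wave_sin t z = 0.
Proof.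
move=> tT zT; rewrite /wave_sin indicE memNset ?mul0r//=.
rewrite in_itv/= => /andP[z0 zt]; apply: zT.
by rewrite z0 (le_trans zt).
Qed.

Lemma wave_kernel_le p q T z : p.1 <= T -> q.1 <= T -> 1 <= T ->
  `|wave_kernel p q z| <= 2 * T * T * dominator T z.
Proof.
move=> pT qT T1.
have T0 : 0 <= T by rewrite (le_trans _ T1).
have [zT|/negP zT] := boolP (0 <= z.1 <= T); last first.
  rewrite /wave_kernel !(out_of_range _ zT)// !(mul0r, mulr0) normr0.
  by rewrite mulr_ge0 ?dominator_ge0// !mulr_ge0.
have z0 : 0 <= z.1 by case/andP: zT.
rewrite /dominator indicE mem_set/= ?in_itv//= mul1r.
have [a1 aT] := wave_sin_le pT z0 T1; have [b1 bT] := wave_sin_le qT z0 T1.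
rewrite /wave_kernel !normrM (ger0_norm (powR_ge0 _ _)) -!normrM.
apply: (le_trans _ (weight_bound _ _ T1 a1 aT (norm_le_interpol _ T1 b1 bT))) => //.
- rewrite ler_wpM2r ?powR_ge0// normrM ler_piMl//.
  exact: normr_cos_le1.
- by rewrite mulr_ge0.
- exact: enorm_ge0.
Qed.

Lemma integrable_wave_kernel (p q : R * 'rV[R]_k) : nu.-integrable setT (EFin \o wave_kernel p q).
Proof.
pose T := Num.max 1 (Num.max p.1 q.1).
have [T1 pT qT] : [/\ 1 <= T, p.1 <= T & q.1 <= T].
  by rewrite /T !le_max !lexx !orbT.
apply: le_integrable (integrableZl measurableT (2 * T * T) (integrable_dominator T)) => //.
  by apply/measurable_EFinP; exact: measurable_wave_kernel.
move=> z _; rewrite /= lee_fin (le_trans (wave_kernel_le _ pT qT T1))//.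
exact: ler_norm.
Qed.

Let weightE (v : 'rV[R]_k) : enorm v `^ (beta - k%:R - 2) =
  (enorm v ^+ 2)^-1 * spectral_density beta v.
Proof.
rewrite /spectral_density; have [->|n0] := eqVneq (enorm v) 0.
  rewrite !powR0 ?mulr0//; first by rewrite subr_eq0 lt_eqF.
  by rewrite lt_eqF// -addrA -opprD subr_lt0 (lt_trans betak)// ltrDl.
rewrite powRB; last by rewrite n0 implybT.
by rewrite mulrC powR_mulrn ?enorm_ge0.
Qed.

Let integrable_wave_kernel_section p q r :
  (lebesgue_rV R k).-integrable setT (fun v => (wave_kernel p q (r, v))%:E).
Proof.
pose T := Num.max 1 (Num.max p.1 q.1).
have [T1 pT qT] : [/\ 1 <= T, p.1 <= T & q.1 <= T].
  by rewrite /T !le_max !lexx !orbT.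
have T0 : 0 <= T by rewrite (le_trans _ T1).
have iw : (lebesgue_rV R k).-integrable setT (fun v => (dom_weight eta v)%:E).
  apply/integrableP; split.
    by apply/measurable_EFinP; exact: measurable_dom_weight.
  under eq_integral do rewrite /= ger0_norm ?dom_weight_ge0//.
  exact: (integral_dom_weight_lty k1 eta0 eta1).
apply: le_integrable (integrableZl measurableT (2 * T * T) iw) => //.
  apply/measurable_EFinP.
  exact: measurableT_comp (measurable_wave_kernel p q) (measurable_pair1 r).
move=> v _; rewrite /= lee_fin (le_trans (wave_kernel_le _ pT qT T1))//.
rewrite ger0_norm; last by rewrite mulr_ge0 ?dom_weight_ge0// !mulr_ge0.
rewrite ler_wpM2l ?mulr_ge0// /dominator indicE ler_piMl ?dom_weight_ge0//.
by case: (_ \in _).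
Qed.

Let wave_kernel_in p q r v : 0 <= r -> r <= p.1 -> r <= q.1 ->
  wave_kernel p q (r, v) = cos (edot v (p.2 - q.2)) *
    (sin ((p.1 - r) * enorm v) * sin ((q.1 - r) * enorm v) / enorm v ^+ 2) *
    spectral_density beta v.
Proof.
move=> r0 rp rq; rewrite /wave_kernel /wave_sin !indicE !mem_set/= ?in_itv/= ?r0//.
by rewrite !mul1r weightE !mulrA.
Qed.

Lemma wave_covE p q :
  (wave_cov beta p q)%:E = (\int[nu]_z (wave_kernel p q z)%:E)%E.
Proof.
have E : (\int[lebesgue_measure]_r (\int[lebesgue_rV R k]_v wave_kernel p q (r, v))%:E =
    \int[nu]_z (wave_kernel p q z)%:E)%E.
  rewrite -(@integral12_prod_meas1 _ _ _ _ _ lebesgue_measure (lebesgue_rV R k)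
    (EFin \o wave_kernel p q) (integrable_wave_kernel p q)).
  apply: eq_integral => r _; rewrite /Rintegral fineK//.
  exact: integrable_fin_num (integrable_wave_kernel_section p q r).
have Efin : (\int[nu]_z (wave_kernel p q z)%:E)%E \is a fin_num.
  exact: integrable_fin_num (integrable_wave_kernel p q).
suff -> : wave_cov beta p q = \int[lebesgue_measure]_r
    \int[lebesgue_rV R k]_v wave_kernel p q (r, v).
  by rewrite -E; apply: fineK; rewrite E.
rewrite /wave_cov [LHS]Rintegral_mkcond; apply: eq_Rintegral => r _.
rewrite patchE; case: ifPn => [|rm].
  rewrite inE/= in_itv/= le_min => /andP[r0 /andP[rp rq]].
  by apply: eq_Rintegral => v _; rewrite wave_kernel_in.
have -> : \int[lebesgue_rV R k]_v wave_kernel p q (r, v) =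
    \int[lebesgue_rV R k]_v (0 : R).
  apply: eq_Rintegral => v _; rewrite /wave_kernel /wave_sin !indicE/=.
  move: rm; rewrite notin_setE/= in_itv/= le_min => rm.
  have [r0|r0] := leP 0 r; last first.
    by rewrite !memNset/= ?in_itv/= ?leNgt ?r0// !(mul0r, mulr0).
  have [rp|rp] := leP r p.1; last first.
    by rewrite [_ \in `[0, p.1]%classic]memNset/= ?in_itv/= ?(leNgt _ p.1) ?rp ?andbF//
      !(mul0r, mulr0).
  have [rq|rq] := leP r q.1; last first.
    by rewrite [_ \in `[0, q.1]%classic]memNset/= ?in_itv/= ?(leNgt _ q.1) ?rq ?andbF//
      !(mul0r, mulr0).
  by exfalso; apply: rm; rewrite r0 rp rq.
by rewrite /Rintegral integral0.
Qed.

Lemma wave_cov_Rintegral p q :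
  wave_cov beta p q = \int[nu]_z wave_kernel p q z.
Proof. by apply: EFin_inj; rewrite wave_covE /Rintegral fineK//;
  exact: integrable_fin_num (integrable_wave_kernel p q). Qed.

Let wave_sin_diff (s t : R) (z : measurableTypeR R * 'rV[R]_k) : 0 <= z.1 ->
  `|wave_sin s z - wave_sin t z| <= `|s - t| * enorm z.2.
Proof.
move=> z0.
(* The sine vanishes where the indicator jumps. *)
have E u : wave_sin u z = sin (Num.max (u - z.1) 0 * enorm z.2).
  rewrite /wave_sin indicE; have [zu|zu] := leP z.1 u.
    by rewrite mem_set/= ?in_itv/= ?z0// mul1r max_l ?subr_ge0.
  rewrite memNset/= ?in_itv/= ?(leNgt _ u) ?zu ?andbF// max_r ?subr_le0 ?ltW//.
  by rewrite !mul0r sin0.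
rewrite !E (le_trans (sin_lip _ _))// -mulrBl normrM (ger0_norm (enorm_ge0 _)).
rewrite ler_wpM2r ?enorm_ge0//.
have -> : `|s - t| = `|(s - z.1) - (t - z.1)| by congr (`|_|); ring.
move: (s - _) (t - _) => x y; rewrite /Num.max; do 2 case: ifPn; rewrite -?leNgt.
- by rewrite subrr normr0.
- move=> y0 x0; rewrite sub0r normrN ger0_norm// ler0_norm; lra.
- move=> y0 x0; rewrite subr0 ger0_norm// ger0_norm; lra.
- by [].
Qed.

(** The difference has a factor [wave_sin p.1]. The other factor changes with the time
    increment and with the phase due to the space increment; both changes are
    bounded and Lipschitz in [delta |xi|], hence of order [(delta |xi|)^eta]. *)
Let kernel_diff (p q : R * 'rV[R]_k) T z : p.1 <= T -> q.1 <= T -> 1 <= T ->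
  `|wave_kernel p p z - wave_kernel p q z| <=
  4 * k%:R * Num.max `|p.1 - q.1| `|p.2 - q.2| `^ eta * T * dominator T z.
Proof.
move=> pT qT T1.
set del := Num.max _ _.
have d0 : 0 <= del by rewrite /del le_max normr_ge0.
have T0 : 0 <= T by rewrite (le_trans _ T1).
have kR : 1 <= k%:R :> R by rewrite ler1n.
have [zT|/negP zT] := boolP (0 <= z.1 <= T); last first.
  rewrite /wave_kernel !(out_of_range _ zT)// !(mul0r, mulr0) subrr normr0.
  by rewrite mulr_ge0 ?dominator_ge0// !mulr_ge0// powR_ge0.
have z0 : 0 <= z.1 by case/andP: zT.
rewrite /dominator indicE mem_set/= ?in_itv//= mul1r.
have [a1 aT] := wave_sin_le pT z0 T1; have [b1 bT] := wave_sin_le qT z0 T1.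
set n := enorm z.2; have n0 : 0 <= n by exact: enorm_ge0.
have e0 : edot z.2 (p.2 - p.2) = 0.
  by rewrite /edot big1// => i _; rewrite subrr mxE mulr0.
set th := edot z.2 (p.2 - q.2).
have -> : wave_kernel p p z - wave_kernel p q z = wave_sin p.1 z *
    (wave_sin p.1 z - cos th * wave_sin q.1 z) * n `^ (beta - k%:R - 2).
  by rewrite /wave_kernel e0 cos0 -/th -/n; ring.
rewrite normrM (ger0_norm (powR_ge0 _ _)).
apply: weight_bound => //; first by rewrite !mulr_ge0// powR_ge0.
have -> : wave_sin p.1 z - cos th * wave_sin q.1 z =
    (wave_sin p.1 z - wave_sin q.1 z) + wave_sin q.1 z * (1 - cos th) by ring.
rewrite (le_trans (ler_normD _ _))//.
have h1 : `|wave_sin p.1 z - wave_sin q.1 z| <= 2 * (del * n) `^ eta.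
  apply: holder_interpolation; [exact: eta0|exact: ltW eta1|exact: mulr_ge0| |].
    rewrite (le_trans (wave_sin_diff _ _ z0))// ler_wpM2r//.
    by rewrite /del le_max lexx.
  by rewrite (le_trans (ler_normB _ _))// (le_trans (lerD a1 b1)).
have h2 : `|wave_sin q.1 z * (1 - cos th)| <= 2 * (k%:R * (del * n)) `^ eta.
  rewrite normrM (@le_trans _ _ `|1 - cos th|) ?ler_piMl//.
  apply: holder_interpolation; [exact: eta0|exact: ltW eta1|by rewrite !mulr_ge0| |].
    have := cos_lip 0 th; rewrite cos0 sub0r normrN => /le_trans; apply.
    rewrite (le_trans (normr_edot_le _ _))// -/n mulrCA ler_wpM2l// mulrC.
    by rewrite ler_wpM2r// /del le_max lexx orbT.
  rewrite (le_trans (ler_normB _ _))// normr1 (_ : 2 = 1 + 1)// lerD2l.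
  exact: normr_cos_le1.
apply: (le_trans (lerD h1 h2)).
rewrite !powRM ?mulr_ge0//.
have kk : k%:R `^ eta <= k%:R :> R.
  by rewrite -[leRHS](powRr1 (ler0n _ _)) ler_powR// (ltW eta1).
have X0 : 0 <= del `^ eta * n `^ eta by rewrite mulr_ge0 ?powR_ge0.
rewrite -[leRHS]mulrA; move: (del `^ eta * n `^ eta) X0 => X X0.
have := ler_wpM2r X0 kk; have := ler_wpM2r X0 kR; rewrite mul1r.
by move: (k%:R `^ eta) (k%:R : R) => K1 K2 *; lra.
Qed.

Lemma wave_cov_diff_le (p q : R * 'rV[R]_k) T : p.1 <= T -> q.1 <= T -> 1 <= T ->
  `|wave_cov beta p p - wave_cov beta p q| <=
  4 * k%:R * Num.max `|p.1 - q.1| `|p.2 - q.2| `^ eta * T *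
    \int[nu]_z dominator T z.
Proof.
move=> pT qT T1.
have i1 := integrable_wave_kernel p p; have i2 := integrable_wave_kernel p q.
have iB := integrableB measurableT i1 i2.
rewrite !wave_cov_Rintegral -RintegralB//.
apply: (le_trans (le_normr_Rintegral _ _)) => //.
rewrite -RintegralZl//; last exact: integrable_dominator.
apply: le_Rintegral => //.
- exact: integrable_norm iB.
- exact: integrableZl (integrable_dominator T).
- by move=> z _; exact: kernel_diff.
Qed.

Lemma wave_cov_le (p q : R * 'rV[R]_k) T : p.1 <= T -> q.1 <= T -> 1 <= T ->
  `|wave_cov beta p q| <= 2 * T * T * \int[nu]_z dominator T z.
Proof.
move=> pT qT T1; have i1 := integrable_wave_kernel p q.
rewrite wave_cov_Rintegral (le_trans (le_normr_Rintegral _ _))//.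
rewrite -RintegralZl//; last exact: integrable_dominator.
apply: le_Rintegral => //.
- exact: integrable_norm i1.
- exact: integrableZl (integrable_dominator T).
- by move=> z _; exact: wave_kernel_le.
Qed.

End wave_kernel.

(** * Nondeterminism *)

Section sine_form.
Context {R : realType}.

Lemma cos_sqr_le_half (n : nat) (x : R) : `|x - (n%:R + 2^-1) * pi| <= pi / 4 ->
  cos x ^+ 2 <= 2^-1.
Proof.
set u := x - _ => hu; have p0 := @pi_gt0 R.
have -> : x = u + pi *+ n + pi / 2 by rewrite /u -mulr_natl; ring.
rewrite cosDpihalf sqrrN (alternatingn (@sinDpi R)) exprMn sqrr_sign mul1r.
have : 0 <= cos (u + u).
  by apply: cos_ge0_pihalf; move: hu; rewrite ler_norml => /andP[]; lra.
by rewrite cosD -!expr2 cos2sin2; lra.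
Qed.

(** A primitive of [r |-> sin ((s - r) rho) sin ((t - r) rho)]. *)
Let prim (rho s t r : R) : R :=
  2^-1 * (r * cos ((s - t) * rho) + sin ((s + t - 2 * r) * rho) / (2 * rho)).

Let prim_derive (rho s t r : R) : 0 < rho ->
  is_derive r 1 (prim rho s t) (sin ((s - r) * rho) * sin ((t - r) * rho)).
Proof.
move=> rho0; have rn0 : rho != 0 by rewrite gt_eqF.
have E : cos ((s - t) * rho) - cos ((s + t - 2 * r) * rho) =
    2 * (sin ((s - r) * rho) * sin ((t - r) * rho)).
  have -> : (s - t) * rho = (s - r) * rho - (t - r) * rho by ring.
  have -> : (s + t - 2 * r) * rho = (s - r) * rho + (t - r) * rho by ring.
  by rewrite cosB cosD; ring.
rewrite /prim; apply: is_derive_eq; rewrite /GRing.scale/=.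
set c1 := cos ((s - t) * rho) in E *; set c2 := cos ((s + t - 2 * r) * rho) in E *.
rewrite -[RHS](mulKf (_ : 2 != 0 :> R))// -E.
by field.
Qed.

Let prim_diff (rho s t t0 : R) : 0 < rho ->
  `|prim rho s t t0 - prim rho s t 0 - 2^-1 * t0 * cos ((s - t) * rho)| <=
  (2 * rho)^-1.
Proof.
move=> rho0.
have -> : prim rho s t t0 - prim rho s t 0 - 2^-1 * t0 * cos ((s - t) * rho) =
    2^-1 * (sin ((s + t - 2 * t0) * rho) - sin ((s + t - 2 * 0) * rho)) *
    (2 * rho)^-1 by rewrite /prim; ring.
have i0 : 0 <= (2 * rho)^-1 by rewrite invr_ge0 mulr_ge0// ltW.
rewrite normrM (ger0_norm i0) ler_piMl// normrM ger0_norm ?invr_ge0//.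
rewrite mulrC ler_pdivrMr// mul1r (le_trans (ler_normB _ _))//.
rewrite (_ : 2 = 1 + 1)//; apply: lerD; exact: normr_sin_le1.
Qed.

(** Over many periods, the time average of a product of two sines of frequency [rho]
    is half the cosine of their phase difference, up to [O(1 / rho)]. When this
    cosine, times [c], is at most [1 / sqrt 2] in absolute value, the form stays
    definite. *)
Lemma sine_form_ge (rho t0 s t a l c : R) : 0 < t0 -> 16 / t0 <= rho ->
  c ^+ 2 <= 1 -> (c * cos ((s - t) * rho)) ^+ 2 <= 2^-1 ->
  (((a ^+ 2 + l ^+ 2) * (t0 / 16))%:E <=
  \int[lebesgue_measure]_(r in `[0%R, t0])
    (a ^+ 2 * (sin ((s - r) * rho) * sin ((s - r) * rho)) -
     2 * a * l * c * (sin ((s - r) * rho) * sin ((t - r) * rho)) +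
     l ^+ 2 * (sin ((t - r) * rho) * sin ((t - r) * rho)))%:E)%E.
Proof.
move=> t00 rhot c1 cc.
have rho0 : 0 < rho by rewrite (lt_le_trans _ rhot)// divr_gt0.
pose F r := a ^+ 2 * prim rho s s r - 2 * a * l * c * prim rho s t r +
  l ^+ 2 * prim rho t t r.
have dP u v r := @prim_derive rho u v r rho0.
have cs u : continuous (fun r : R => sin ((u - r) * rho)).
  move=> r; apply: continuous_comp; last exact: continuous_sin.
  by apply: cvgM; [apply: cvgB; [exact: cvg_cst|exact: cvg_id]|exact: cvg_cst].
have cf u v b : continuous (fun r : R => b * (sin ((u - r) * rho) * sin ((v - r) * rho))).
  by move=> r; apply: cvgM; [exact: cvg_cst|apply: cvgM; exact: cs].
have dF (r : R) : is_derive r 1 F (a ^+ 2 * (sin ((s - r) * rho) * sin ((s - r) * rho)) -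
     2 * a * l * c * (sin ((s - r) * rho) * sin ((t - r) * rho)) +
     l ^+ 2 * (sin ((t - r) * rho) * sin ((t - r) * rho))).
  have d1 := dP s s r; have d2 := dP s t r; have d3 := dP t t r.
  rewrite /F; apply: is_derive_eq; rewrite /GRing.scale/=; by ring.
have cF : continuous F.
  by move=> r; apply: differentiable_continuous; apply/derivable1_diffP; case: (dF r).
rewrite (@continuous_FTC2 _ _ F)//; last 3 first.
- apply: continuous_subspaceT => r; apply: cvgD; last exact: cf.
  by apply: cvgB; exact: cf.
- split=> [r _||]; first by case: (dF r).
    exact: cvg_at_right_filter (cF _).
  exact: cvg_at_left_filter (cF _).
- by move=> r _; rewrite derive1E; case: (dF r).
rewrite -EFinB lee_fin /F.
set C := cos ((s - t) * rho) in cc.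
(* The lower bound [16 / t0] of [rho] makes the error terms at most [t0 / 32]. *)
have i0 : (2 * rho)^-1 <= t0 / 32.
  have -> : t0 / 32 = (2 * (16 / t0))^-1 by rewrite invfM invf_div; field.
  by rewrite lef_pV2 ?posrE ?mulr_gt0 ?divr_gt0 ?invr_gt0// ler_pM2l.
have ineg : 0 <= (2 * rho)^-1 by rewrite invr_ge0 mulr_ge0// ltW.
have := @prim_diff rho s s t0 rho0; rewrite subrr mul0r cos0 mulr1.
have := @prim_diff rho s t t0 rho0; rewrite -/C.
have := @prim_diff rho t t t0 rho0; rewrite subrr mul0r cos0 mulr1.
move: (_^-1) i0 ineg => i i0 ineg.
set D1 := prim _ s s _ - _; set D2 := prim _ s t _ - _; set D3 := prim _ t t _ - _.
have -> : a ^+ 2 * prim rho s s t0 - 2 * a * l * c * prim rho s t t0 +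
    l ^+ 2 * prim rho t t t0 -
    (a ^+ 2 * prim rho s s 0 - 2 * a * l * c * prim rho s t 0 +
     l ^+ 2 * prim rho t t 0) =
    a ^+ 2 * D1 - 2 * a * l * c * D2 + l ^+ 2 * D3.
  by rewrite /D1 /D2 /D3; ring.
move: D1 D2 D3 => D1 D2 D3 h3 h2 h1.
have a2 : 0 <= a ^+ 2 by exact: sqr_ge0.
have l2 : 0 <= l ^+ 2 by exact: sqr_ge0.
set S := a ^+ 2 + l ^+ 2; have S0 : 0 <= S by exact: addr_ge0.
have X1 : `|2 * a * l| <= S.
  by rewrite ler_norml /S; have := sqr_ge0 (a + l); have := sqr_ge0 (a - l);
    rewrite !expr2; lra.
have sq_le (x y : R) : 0 <= y -> x ^+ 2 <= y ^+ 2 -> `|x| <= y.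
  by move=> y0 xy; rewrite -(ger0_norm y0) -ler_sqr ?nnegrE// !real_normK ?num_real.
have c1' : `|c| <= 1 by apply: sq_le; rewrite ?expr1n.
have cC : `|c * C| <= 3 / 4.
  apply: sq_le; first by lra.
  by rewrite (le_trans cc)//; lra.
have Xc : `|2 * a * l * c| <= S.
  by rewrite normrM -[leRHS]mulr1 ler_pM.
have XcC : `|2 * a * l * (c * C)| <= S * (3 / 4).
  by rewrite normrM ler_pM.
have E2 : 2 * a * l * c * D2 <= S * i + 2^-1 * t0 * (S * (3 / 4)).
  have -> : 2 * a * l * c * D2 = 2 * a * l * c * (D2 - 2^-1 * t0 * C) +
    2^-1 * t0 * (2 * a * l * (c * C)) by ring.
  apply: lerD.
    by rewrite (le_trans (ler_norm _))// normrM ler_pM.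
  rewrite ler_wpM2l//; first by rewrite mulr_ge0 ?invr_ge0// ltW.
  exact: le_trans (ler_norm _) XcC.
have E1 : a ^+ 2 * (2^-1 * t0 - i) <= a ^+ 2 * D1.
  by rewrite ler_wpM2l//; move: h1; rewrite ler_norml => /andP[]; lra.
have E3 : l ^+ 2 * (2^-1 * t0 - i) <= l ^+ 2 * D3.
  by rewrite ler_wpM2l//; move: h3; rewrite ler_norml => /andP[]; lra.
have Si : S * i <= S * (t0 / 32) by rewrite ler_wpM2l.
(* Of the coefficient [t0 / 2], the cross term takes [3 t0 / 8] and the two error
   terms [t0 / 16]. *)
have E13 : a ^+ 2 * (2^-1 * t0 - i) + l ^+ 2 * (2^-1 * t0 - i) =
  S * t0 / 2 - S * i by rewrite /S; field.
have e1 : S * (t0 / 16) = S * t0 / 16 by ring.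
have e2 : S * (t0 / 32) = S * t0 / 32 by ring.
have e3 : 2^-1 * t0 * (S * (3 / 4)) = S * t0 * (3 / 8) by field.
rewrite e1; rewrite e2 in Si; rewrite e3 in E2.
move: (S * t0) (S * i) (a ^+ 2 * D1) (l ^+ 2 * D3) (2 * a * l * c * D2) E1 E2 E3 Si E13.
move: (a ^+ 2 * (2^-1 * t0 - i)) (l ^+ 2 * (2^-1 * t0 - i)).
by move=> x1 x2 x3 x4 x5 x6 x7; lra.
Qed.

End sine_form.

Section boxes.
Context {R : realType} (k : nat).

(** Frequencies close to [rho] times the [i]-th unit vector, where [|v|] is close to
    [rho] and the phase [v . w] to [rho w_i]. *)
Definition corner_box (i : 'I_k) (rho e : R) : set 'rV[R]_k :=
  [set v | forall j, `[rho * (j == i)%:R, rho * (j == i)%:R + e * rho]%classic (v 0 j)].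

Lemma measurable_corner_box i rho e : measurable (corner_box i rho e).
Proof.
apply: (@measurable_rV_box _ _ (fun j =>
  `[rho * (j == i)%:R, rho * (j == i)%:R + e * rho]%classic)) => j.
exact: measurable_itv.
Qed.

Lemma lebesgue_corner_box i rho e : 0 < rho -> 0 < e ->
  lebesgue_rV R k (corner_box i rho e) = ((e * rho) ^+ k)%:E.
Proof.
move=> rho0 e0; have er : 0 < e * rho by exact: mulr_gt0.
rewrite /corner_box (@lebesgue_rV_box R k (fun j =>
  `[rho * (j == i)%:R, rho * (j == i)%:R + e * rho]%classic)); last first.
  by move=> j; exact: measurable_itv.
rewrite (eq_bigr (fun=> (e * rho)%:E)) => [|j _].
  by rewrite prodEFin prodr_const card_ord.
rewrite lebesgue_measure_itv/= lte_fin ltrDl er -EFinB.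
by congr EFin; ring.
Qed.

Let corner_coord i rho e v j : 0 < rho -> 0 < e -> corner_box i rho e v ->
  `|v 0 j - rho * (j == i)%:R| <= e * rho.
Proof.
move=> rho0 e0 /(_ j); rewrite /= in_itv/= => /andP[v1 v2].
by rewrite ger0_norm ?subr_ge0// lerBlDl.
Qed.

Lemma corner_box_enorm i rho e v : 0 < rho -> 0 < e -> corner_box i rho e v ->
  rho <= enorm v <= rho + k%:R * (e * rho).
Proof.
move=> rho0 e0 vB; apply/andP; split.
  have := vB i; rewrite /= in_itv/= eqxx mulr1 => /andP[v1 _].
  rewrite (le_trans v1)// (le_trans (ler_norm _))//; exact: coord_le_enorm.
rewrite (le_trans (enorm_le_sum _))//.
apply: (@le_trans _ _ (\sum_(j < k) (rho * (j == i)%:R + e * rho))).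
  apply: ler_sum => j _.
  have -> : v 0 j = (v 0 j - rho * (j == i)%:R) + rho * (j == i)%:R by rewrite subrK.
  rewrite (le_trans (ler_normD _ _))// addrC lerD ?corner_coord//.
  by rewrite ger0_norm// mulr_ge0// ltW.
rewrite big_split/= sumr_const card_ord mulr_natl lerD2r.
by rewrite -mulr_sumr (bigD1 i)//= eqxx big1 ?addr0 ?mulr1// => j /negbTE ->.
Qed.

Lemma corner_box_edot i rho e v w : 0 < rho -> 0 < e -> corner_box i rho e v ->
  `|edot v w - rho * w 0 i| <= k%:R * (e * rho) * `|w|.
Proof.
move=> rho0 e0 vB.
have -> : edot v w - rho * w 0 i =
    \sum_j (v 0 j - rho * (j == i)%:R) * w 0 j.
  under [RHS]eq_bigr do rewrite mulrBl.
  rewrite sumrB; congr (_ - _).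
  rewrite (bigD1 i)//= eqxx mulr1 big1 ?addr0// => j /negbTE ->.
  by rewrite mulr0 mul0r.
rewrite (le_trans (ler_norm_sum _ _ _))//.
apply: (@le_trans _ _ (\sum_(j < k) (e * rho) * `|w|)).
  apply: ler_sum => j _; rewrite normrM ler_pM ?corner_coord//.
  exact: rV_coord_le.
by rewrite sumr_const card_ord -[leRHS]mulrA mulr_natl.
Qed.

End boxes.

Section nondeterminism.
Context {R : realType} (k : nat) (beta : R).
Hypotheses (k1 : (1 <= k)%N) (beta0 : 0 < beta) (beta2 : beta < 2)
  (betak : beta < k%:R).

Notation nu := (lebesgue_measure \x lebesgue_rV R k)%E.

Let quad_ge0 (a l c x y : R) : c ^+ 2 <= 1 ->
  0 <= a ^+ 2 * (x * x) - 2 * a * l * c * (x * y) + l ^+ 2 * (y * y).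
Proof.
move=> c1; have -> : a ^+ 2 * (x * x) - 2 * a * l * c * (x * y) + l ^+ 2 * (y * y) =
  (a * x - c * (l * y)) ^+ 2 + (1 - c ^+ 2) * (l * y) ^+ 2 by ring.
by rewrite addr_ge0 ?sqr_ge0// mulr_ge0 ?sqr_ge0// subr_ge0.
Qed.

Let cos_sqr_le1 (x : R) : cos x ^+ 2 <= 1.
Proof. by rewrite -(cos2Dsin2 x) lerDl sqr_ge0. Qed.

(** The spectral density of the variance of [a V p - l V q]. *)
Let form (p q : R * 'rV[R]_k) (a l : R) z : R :=
  a ^+ 2 * wave_kernel beta p p z - 2 * a * l * wave_kernel beta p q z +
  l ^+ 2 * wave_kernel beta q q z.

Let formE p q a l z : form p q a l z =
  enorm z.2 `^ (beta - k%:R - 2) *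
  (a ^+ 2 * (wave_sin p.1 z * wave_sin p.1 z) -
   2 * a * l * cos (edot z.2 (p.2 - q.2)) * (wave_sin p.1 z * wave_sin q.1 z) +
   l ^+ 2 * (wave_sin q.1 z * wave_sin q.1 z)).
Proof.
have e0 (x : 'rV[R]_k) : edot z.2 (x - x) = 0.
  by rewrite /edot big1// => i _; rewrite subrr mxE mulr0.
by rewrite /form /wave_kernel !e0 cos0; ring.
Qed.

Let form_ge0 p q a l z : 0 <= form p q a l z.
Proof.
by rewrite formE mulr_ge0 ?powR_ge0// quad_ge0.
Qed.

Let measurable_form p q a l : measurable_fun setT (form p q a l).
Proof.
have m (u v : R * 'rV[R]_k) : measurable_fun setT (wave_kernel beta u v).
  exact: measurable_wave_kernel.
by apply: measurable_funD; [apply: measurable_funB|]; exact: measurable_funM.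
Qed.

Let wave_cov_form p q a l :
  (a ^+ 2 * wave_cov beta p p - 2 * a * l * wave_cov beta p q +
   l ^+ 2 * wave_cov beta q q)%:E = (\int[nu]_z (form p q a l z)%:E)%E.
Proof.
have i u v := integrable_wave_kernel k1 beta0 beta2 u v.
have iM b u v : nu.-integrable setT (fun z => (b * wave_kernel beta u v z)%:E).
  exact: (integrableZl measurableT b (i u v)).
rewrite /form.
under eq_integral do rewrite EFinD EFinB.
rewrite integralD//; last exact: integrableB (iM _ _ _) (iM _ _ _).
rewrite integralB//.
have Z b u v : (\int[nu]_z (b * wave_kernel beta u v z)%:E =
    (b * wave_cov beta u v)%:E)%E.
  by rewrite EFinM wave_covE// -integralZl//; exact: (i u v).
by rewrite !Z.
Qed.

(** Either the time increment or the space increment, along its largest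
    coordinate, turns the phase by an odd multiple of a right angle, up to half
    a right angle, over a whole corner box of frequencies. *)
Let phase_box (n : nat) (p q : R * 'rV[R]_k) (x e : R) :
  let del := Num.max `|p.1 - q.1| `|p.2 - q.2| in
  0 < del -> x = (n%:R + 2^-1) * pi -> 0 < e -> k%:R * e * x = pi / 4 ->
  exists i : 'I_k, forall v, corner_box i (x / del) e v ->
    (cos (edot v (p.2 - q.2)) * cos ((p.1 - q.1) * enorm v)) ^+ 2 <= 2^-1.
Proof.
move=> del d0 xE e0 kex.
have x0 : 0 < x by rewrite xE mulr_gt0 ?pi_gt0// ltr_wpDl.
have r0 : 0 < x / del by exact: divr_gt0.
have dx : del * (x / del) = x by rewrite mulrC divfK// gt_eqF.
have [pq|pq] := leP `|p.2 - q.2| `|p.1 - q.1|.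
  have delE : del = `|p.1 - q.1| by rewrite /del max_l.
  exists (Ordinal k1) => v /corner_box_enorm => /(_ r0 e0)/andP[v1 v2].
  rewrite exprMn (@le_trans _ _ (cos ((p.1 - q.1) * enorm v) ^+ 2))//.
    by rewrite ler_piMl ?sqr_ge0.
  have -> : cos ((p.1 - q.1) * enorm v) = cos (del * enorm v).
    rewrite delE; have [_|_] := ger0P (p.1 - q.1) => //.
    by rewrite mulNr cosN.
  apply: (@cos_sqr_le_half _ n); rewrite -xE -{1}dx -mulrBr.
  rewrite ger0_norm; last by rewrite mulr_ge0 ?(ltW d0)// subr_ge0.
  have := ler_wpM2l (ltW d0) v2; rewrite mulrDr dx mulrBr dx lerBlDl => /le_trans; apply.
  rewrite lerD2l -kex le_eqVlt; apply/orP; left; apply/eqP.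
  by rewrite mulrCA [del * (e * _)]mulrCA dx mulrA.
have delE : del = `|p.2 - q.2| by rewrite /del max_r// ltW.
have hn0 : mx_norm (p.2 - q.2) != 0.
  by rewrite -[mx_norm _]/(`|p.2 - q.2|) -delE gt_eqF.
have [[i0 i] hi] := mx_norm_neq0 hn0.
have {}hi : del = `|(p.2 - q.2) 0 i|.
  by rewrite delE -[LHS]/(mx_norm (p.2 - q.2)) hi/= (ord1 i0).
exists i => v vB; have := corner_box_edot (p.2 - q.2) r0 e0 vB.
rewrite -delE => vh.
rewrite exprMn (@le_trans _ _ (cos (edot v (p.2 - q.2)) ^+ 2))//.
  by rewrite ler_piMr ?sqr_ge0.
have {}vh : `|edot v (p.2 - q.2) - x / del * (p.2 - q.2) 0 i| <= pi / 4.
  rewrite (le_trans vh)// -kex le_eqVlt; apply/orP; left; apply/eqP.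
  by rewrite -[in RHS]dx; ring.
have [h0|h0] := ger0P ((p.2 - q.2) 0 i).
  have xd : x / del * (p.2 - q.2) 0 i = x.
    by rewrite -[X in _ * X](ger0_norm h0) -hi divfK// gt_eqF.
  by apply: (@cos_sqr_le_half _ n); rewrite -xE -{1}xd.
rewrite -cosN; apply: (@cos_sqr_le_half _ n).
have xd : x / del * (p.2 - q.2) 0 i = - x.
  by rewrite -[X in _ * X]opprK -[X in - X](ltr0_norm h0) -hi mulrN divfK// gt_eqF.
by rewrite -xE -opprD normrN; move: vh; rewrite xd opprK.
Qed.

(** The form is nonnegative, so that the time integral may be restricted to
    [[0, t0]], where both indicators are [1]. *)
Let form_section_ge (t0 : R) (p q : R * 'rV[R]_k) (a l : R) v :
  0 < t0 -> t0 <= p.1 -> t0 <= q.1 -> 16 / t0 <= enorm v ->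
  (cos (edot v (p.2 - q.2)) * cos ((p.1 - q.1) * enorm v)) ^+ 2 <= 2^-1 ->
  ((enorm v `^ (beta - k%:R - 2) * ((a ^+ 2 + l ^+ 2) * (t0 / 16)))%:E <=
   \int[lebesgue_measure]_r (form p q a l (r, v))%:E)%E.
Proof.
move=> t00 tp tq tv cv.
have mI : measurable (`[0, t0]%classic : set (measurableTypeR R)).
  exact: measurable_itv.
have mf : measurable_fun setT (fun r : measurableTypeR R => (form p q a l (r, v))%:E).
  apply/measurable_EFinP.
  exact: measurableT_comp (measurable_form p q a l) (measurable_pair2 v).
apply: (@le_trans _ _ (\int[lebesgue_measure]_(r in `[0%R, t0])
    (form p q a l (r, v))%:E)%E); last first.
  apply: ge0_subset_integral => //.
  by move=> r _; rewrite lee_fin form_ge0.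
have := @sine_form_ge R (enorm v) t0 p.1 q.1 a l (cos (edot v (p.2 - q.2)))
  t00 tv (cos_sqr_le1 _) cv.
pose g (r : measurableTypeR R) : \bar R :=
  (a ^+ 2 * (sin ((p.1 - r) * enorm v) * sin ((p.1 - r) * enorm v)) -
   2 * a * l * cos (edot v (p.2 - q.2)) *
   (sin ((p.1 - r) * enorm v) * sin ((q.1 - r) * enorm v)) +
   l ^+ 2 * (sin ((q.1 - r) * enorm v) * sin ((q.1 - r) * enorm v)))%:E.
rewrite -[X in (_ <= X)%E -> _]/(\int[lebesgue_measure]_(r in `[0%R, t0]) g r)%E.
move=> hg.
have g0 r : (0 <= g r)%E by rewrite lee_fin quad_ge0.
have mg : measurable_fun (`[0, t0]%classic : set (measurableTypeR R)) g.
  have ms u : measurable_fun setT (fun r : measurableTypeR R => sin ((u - r) * enorm v)).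
    apply: measurableT_comp measurable_sin _; apply: measurable_funM => //.
    exact: measurable_funB.
  apply: measurable_funTS; apply/measurable_EFinP; apply: measurable_funD.
    by apply: measurable_funB; apply: measurable_funM => //; exact: measurable_funM.
  by apply: measurable_funM => //; exact: measurable_funM.
have -> : (\int[lebesgue_measure]_(r in `[0%R, t0]) (form p q a l (r, v))%:E =
    \int[lebesgue_measure]_(r in `[0%R, t0])
      ((enorm v `^ (beta - k%:R - 2))%:E * g r))%E.
  apply: eq_integral => r; rewrite inE/= in_itv/= => /andP[r0 rt].
  have S u : t0 <= u -> wave_sin u (r, v) = sin ((u - r) * enorm v).
    move=> tu; rewrite /wave_sin indicE mem_set/= ?mul1r// in_itv/= r0.
    exact: le_trans tu.
  by rewrite formE /= !S// /g -EFinM.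
rewrite ge0_integralZl//; last by rewrite lee_fin powR_ge0.
by rewrite EFinM lee_wpmul2l// lee_fin powR_ge0.
Qed.

(** The form being nonnegative, its integral is at least that over the box of
    frequencies of order [1 / delta] given by [phase_box], where it is at least of
    order [a^2 + l^2] times the spectral weight. The volume [delta^(- k)] of the box
    and the weight [delta^(k + 2 - beta)] combine to [delta^(2 - beta)]. *)
Lemma wave_cov_nondeterminism (t0 D : R) : 0 < t0 -> 0 < D ->
  exists2 c : R, 0 < c & forall (p q : R * 'rV[R]_k) (a l : R),
    t0 <= p.1 -> t0 <= q.1 -> Num.max `|p.1 - q.1| `|p.2 - q.2| <= D ->
    c * (a ^+ 2 + l ^+ 2) * Num.max `|p.1 - q.1| `|p.2 - q.2| `^ (2 - beta) <=
    a ^+ 2 * wave_cov beta p p - 2 * a * l * wave_cov beta p q +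
    l ^+ 2 * wave_cov beta q q.
Proof.
(* The number of half turns [n] makes the frequency [x / delta] exceed [16 / t0] for
   all [delta <= D], and the size [e] of the box bounds the variation of the phase
   by [pi / 4]. *)
move=> t00 D0; pose n := (Num.truncn (16 * D / t0)).+1.
pose x : R := (n%:R + 2^-1) * pi.
have kR : 0 < k%:R :> R by rewrite ltr0n.
have pi1 : 1 <= pi :> R by have := @pihalf_ge1 R; lra.
have xD : 16 * D / t0 <= x.
  apply: (le_trans (ltW (truncnS_gt _))); rewrite -/n /x.
  rewrite -[leLHS]mulr1 ler_pM//.
  by rewrite lerDl invr_ge0.
have x0 : 0 < x by rewrite (lt_le_trans _ xD)// divr_gt0// mulr_gt0.
pose e : R := pi / 4 / (k%:R * x).
have e0 : 0 < e by rewrite !divr_gt0 ?mulr_gt0 ?pi_gt0.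
have kex : k%:R * e * x = pi / 4.
  by rewrite /e mulrAC mulrC divfK// mulf_neq0 ?gt_eqF.
have ke1 : k%:R * e <= 1.
  have xpi : pi / 4 <= x.
    rewrite /x mulrC ler_pM2r ?pi_gt0//.
    by rewrite (le_trans (y := 2^-1))// ?lerDr// lef_pV2 ?posrE// ler_nat.
  by rewrite -(ler_pM2r x0) kex mul1r.
exists ((2 * x) `^ (beta - k%:R - 2) * (e * x) ^+ k * (t0 / 16)).
  apply: mulr_gt0; last exact: divr_gt0.
  by apply: mulr_gt0; [apply: powR_gt0|apply: exprn_gt0]; exact: mulr_gt0.
move=> p q a l tp tq dD; set del := Num.max _ _ in dD *.
rewrite -lee_fin wave_cov_form.
have [d0|d0] := eqVneq del 0.
  rewrite d0 powR0 ?mulr0; last by rewrite subr_eq0 gt_eqF.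
  by apply: integral_ge0 => z _; rewrite lee_fin form_ge0.
have {}d0 : 0 < del by rewrite lt_neqAle eq_sym d0 /del le_max normr_ge0.
have [i iB] := @phase_box n p q x e d0 erefl e0 kex.
rewrite -/del in iB; set rho := x / del in iB.
have rho0 : 0 < rho by exact: divr_gt0.
have trho : 16 / t0 <= rho.
  rewrite /rho ler_pdivlMr// (le_trans _ xD)// mulrAC ler_pM2r ?invr_gt0//.
  by rewrite ler_pM2l.
pose K := (2 * rho) `^ (beta - k%:R - 2) * ((a ^+ 2 + l ^+ 2) * (t0 / 16)).
have S0 : 0 <= (a ^+ 2 + l ^+ 2) * (t0 / 16).
  by rewrite mulr_ge0 ?addr_ge0 ?sqr_ge0// divr_ge0// ltW.
have K0 : 0 <= K by rewrite mulr_ge0 ?powR_ge0.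
apply: (@le_trans _ _ (\int[lebesgue_rV R k]_(v in corner_box i rho e) K%:E)%E).
  rewrite integral_cst; last exact: measurable_corner_box.
  rewrite [X in (_ <= _ * X)%E](_ : _ = ((e * rho) ^+ k)%:E); last first.
    exact: lebesgue_corner_box.
  rewrite -EFinM lee_fin le_eqVlt; apply/orP; left; apply/eqP.
  have dV y : (del^-1) `^ y = del `^ (- y).
    by rewrite -powR_inv1 ?ltW// -powRrM mulN1r.
  have xx : 0 <= 2 * x by apply: mulr_ge0 => //; exact: ltW.
  have dd : 0 <= del^-1 by rewrite invr_ge0 ltW.
  rewrite /K /rho (mulrA 2) (powRM _ xx dd).
  rewrite dV (mulrA e) (exprMn _ (e * x)) exprVn -powR_invn ?ltW//.
  have -> : del `^ (2 - beta) = del `^ (- (beta - k%:R - 2)) * del `^ (- k%:R).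
    rewrite -powRD; last by rewrite (gt_eqF d0) implybT.
    by congr (_ `^ _); ring.
  by ring.
have mf : measurable_fun setT (EFin \o form p q a l).
  by apply/measurable_EFinP; exact: measurable_form.
have f0 z : (0 <= (EFin \o form p q a l) z)%E by rewrite lee_fin form_ge0.
rewrite (@fubini_tonelli2 _ _ _ _ _ lebesgue_measure (lebesgue_rV R k) _ mf f0).
have mG := @measurable_fun_fubini_tonelli_G _ _ _ _ _ lebesgue_measure _ mf f0.
apply: (@le_trans _ _ (\int[lebesgue_rV R k]_(v in corner_box i rho e)
    fubini_G lebesgue_measure (EFin \o form p q a l) v)%E).
  apply: ge0_le_integral => //.
  - exact: measurable_corner_box.
  - exact: measurable_funTS.
  move=> v vB; have /andP[v1 v2] := corner_box_enorm rho0 e0 vB.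
  have v0 : 0 < enorm v by rewrite (lt_le_trans rho0).
  apply: (le_trans _ (form_section_ge a l t00 tp tq (le_trans trho v1) (iB _ vB))).
  rewrite lee_fin ler_wpM2r//.
  rewrite (_ : beta - k%:R - 2 = - (k%:R + 2 - beta)); last by ring.
  apply: ler_powRN => //.
    apply: (le_trans v2); rewrite mulrA (mulrDl 1 1) mul1r lerD2l.
    by apply: ler_piMl => //; exact: ltW.
  by rewrite subr_ge0 (le_trans (ltW betak))// lerDl.
apply: ge0_subset_integral => //; first exact: measurable_corner_box.
by move=> v _; apply: integral_ge0 => r _.
Qed.

End nondeterminism.

(** * The joint density at two parameters *)

Section two_points.
Context {R : realType}.

(** By [n]-th roots: [t <= (1 + a n) (1 + t^2 / (a n)) <= (1 + a n) exp (t^2 / (a n))]. *)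
Lemma exp_decay_le (n : nat) (a t : R) : (0 < n)%N -> 0 < a -> 0 <= t ->
  t ^+ n * expR (- (t ^+ 2 / a)) <= (1 + a * n%:R) ^+ n.
Proof.
move=> n0 a0 t0; have an : 0 < a * n%:R by rewrite mulr_gt0// ltr0n.
have t2 : 0 <= t ^+ 2 by exact: sqr_ge0.
have -> : expR (- (t ^+ 2 / a)) = (expR (t ^+ 2 / (a * n%:R)))^-1 ^+ n.
  rewrite exprVn -expRM_natl expRN; congr (expR _)^-1.
  by field; rewrite !gt_eqF// ltr0n.
have u0 : 0 <= t * (expR (t ^+ 2 / (a * n%:R)))^-1.
  by rewrite mulr_ge0// invr_ge0 expR_ge0.
have v0 : 0 <= 1 + a * n%:R by rewrite addr_ge0// ltW.
rewrite -exprMn; apply: lerXn2r; rewrite ?nnegrE//.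
rewrite ler_pdivrMr ?expR_gt0//.
have h : 1 + t ^+ 2 / (a * n%:R) <= expR (t ^+ 2 / (a * n%:R)) by exact: expR_ge1Dx.
apply: (@le_trans _ _ ((1 + a * n%:R) * (1 + t ^+ 2 / (a * n%:R)))); last first.
  by rewrite ler_wpM2l// addr_ge0// ltW.
have -> : (1 + a * n%:R) * (1 + t ^+ 2 / (a * n%:R)) =
    1 + a * n%:R + t ^+ 2 / (a * n%:R) + t ^+ 2.
  by field; rewrite !gt_eqF// ltr0n.
have : 0 <= t ^+ 2 / (a * n%:R) by rewrite divr_ge0// ltW.
have := sqr_ge0 (t - 1); rewrite !expr2 => h1 h2.
by set x := t * t / _ in h2 *; move: (a * n%:R) an => y an; nra.
Qed.

(** Given [V], the conditional variance of [V'] is at least [c0 del^(2 eta)],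
    while the regression coefficient [B / A] differs from [1] by at most the
    order of [del^eta]. Hence the regression error contributes only a bounded
    factor to the exponential. *)
Lemma two_point_bound (n : nat) (c0 c1 c2 K eta M : R) : (0 < n)%N ->
  0 < c0 -> 0 < c1 -> 0 <= c2 -> 0 <= K -> 0 <= M ->
  exists2 C : R, 0 < C &
  forall (d : measure_display) (W : measurableType d) (P : probability W R)
    (V V' : 'I_n -> W -> R) (A B D del e : R) (z z' : 'I_n -> R),
  (forall i, measurable_fun setT (V i)) ->
  (forall i, measurable_fun setT (V' i)) ->
  (forall (a b : 'I_n -> R) c,
    (\int[P]_w (cos (\sum_i (a i * V i w + b i * V' i w) + c))%:E =
    (cos c * \prod_i expR (- (a i ^+ 2 * A + 2 * a i * b i * B +
      b i ^+ 2 * D) / 2))%:E)%E) ->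
  c1 <= A -> `|B| <= c2 -> 0 <= del -> `|A - B| <= K * del `^ eta ->
  c0 * del `^ (2 * eta) <= D - B ^+ 2 / A -> 0 < e ->
  (forall i, `|z i| <= M) ->
  let I := (\int[P]_w (\prod_i (gauss ((V i w - z i) / e) *
    gauss ((V' i w - z' i) / e)))%:E)%E in
  let r := Num.sqrt (\sum_i (z i - z' i) ^+ 2) in
  (0 < del -> (I <= (C * (e ^+ 2) ^+ n * del `^ (- (eta * n%:R)))%:E)%E) /\
  (0 < r -> (I <= (C * (e ^+ 2) ^+ n * r ^- n)%:E)%E).
Proof.
move=> n0 c00 c10 c20 K0 M0.
pose L := c2 / c1; pose La := 1 + 2 * L ^+ 2.
have La0 : 0 < La by rewrite ltr_pwDl// mulr_ge0// sqr_ge0.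
pose K2 := (K / c1) ^+ 2 * (n%:R * M ^+ 2) / c0.
pose b := Num.sqrt 2 / Num.sqrt c1.
have b0 : 0 < b by rewrite divr_gt0 ?sqrtr_gt0.
pose C1 := b ^+ n * (Num.sqrt c0) ^- n.
pose C2 := b ^+ n * (expR (K2 / (2 * La)) * (1 + 4 * La * n%:R) ^+ n).
have C10 : 0 < C1 by rewrite mulr_gt0 ?invr_gt0 ?exprn_gt0 ?sqrtr_gt0.
have C20 : 0 < C2.
  rewrite mulr_gt0 ?exprn_gt0// mulr_gt0 ?expR_gt0// exprn_gt0//.
  by rewrite ltr_pwDl// !mulr_ge0// ltW.
exists (C1 + C2); first exact: addr_gt0.
move=> d W P V V' A B D del e z z' mV mV' VV' cA Bc2 d0 AB CD e0 zM I r.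
have A0 : 0 < A by rewrite (lt_le_trans c10).
set C := D - B ^+ 2 / A in CD.
have C0 : 0 <= C by rewrite (le_trans _ CD)// mulr_ge0 ?powR_ge0// ltW.
have BL : `|B / A| <= L.
  rewrite normrM normfV (gtr0_norm A0) /L ler_pM ?invr_ge0 ?(ltW A0)//.
  by rewrite lef_pV2 ?posrE.
have := pair_gauss_le z z' mV mV' VV' A0 C0 BL e0; rewrite -/I -/C -/La.
have e2 : 0 < e ^+ 2 by exact: exprn_gt0.
set S := Num.sqrt (e ^+ 2 + C).
have S2 : S ^+ 2 = e ^+ 2 + C by rewrite sqr_sqrtr// addr_ge0// ltW.
have S0 : 0 < S by rewrite sqrtr_gt0 ltr_pwDl.
set l := B / A.
have -> : \prod_(i < n) (Num.sqrt 2 / Num.sqrt A * e ^+ 2 *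
    (S^-1 * expR (- (l * z i - z' i) ^+ 2 / La / (2 * (e ^+ 2 + C))))) =
    (Num.sqrt 2 / Num.sqrt A) ^+ n * (e ^+ 2) ^+ n * (S ^- n *
      expR (- (\sum_i (l * z i - z' i) ^+ 2) / La / (2 * S ^+ 2))).
  rewrite big_split/= prodr_const card_ord exprMn; congr (_ * _).
  rewrite big_split/= prodr_const card_ord exprVn; congr (_ * _).
  rewrite -expR_sum S2; congr expR.
  by rewrite -!mulr_suml -sumrN.
move=> hI.
have {}hI : (I <= (b ^+ n * (e ^+ 2) ^+ n * (S ^- n *
    expR (- (\sum_i (l * z i - z' i) ^+ 2) / La / (2 * S ^+ 2))))%:E)%E.
  apply: (le_trans hI); rewrite lee_fin -!mulrA ler_wpM2r//.
    by rewrite !mulr_ge0 ?expR_ge0 ?invr_ge0 ?exprn_ge0// ltW.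
  rewrite lerXn2r ?nnegrE ?divr_ge0 ?sqrtr_ge0// ler_pM2l ?sqrtr_gt0//.
  by rewrite lef_pV2 ?posrE ?sqrtr_gt0// ler_wsqrtr.
have en0 : 0 <= (e ^+ 2) ^+ n by rewrite exprn_ge0// ltW.
(* The first bound keeps the conditional variance and drops the exponential. *)
split=> [del0|r0].
  apply: (le_trans hI); rewrite lee_fin.
  have -> : (C1 + C2) * (e ^+ 2) ^+ n * del `^ (- (eta * n%:R)) =
    (C1 + C2) * del `^ (- (eta * n%:R)) * (e ^+ 2) ^+ n by ring.
  rewrite mulrAC ler_wpM2r//.
  apply: (@le_trans _ _ (C1 * del `^ (- (eta * n%:R)))); last first.
    by rewrite ler_wpM2r ?powR_ge0// lerDl ltW.
  rewrite /C1 -[leRHS]mulrA; apply: ler_wpM2l; first by rewrite exprn_ge0// ltW.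
  have -> : del `^ (- (eta * n%:R)) = (del `^ eta) ^- n.
    by rewrite powRN powRrM powR_mulrn// powR_ge0.
  rewrite -[leLHS]mulr1 -[leRHS]mulr1.
  apply: (@le_trans _ _ (S ^- n * 1)).
    rewrite mulr1 ler_wpM2l ?invr_ge0 ?exprn_ge0 ?(ltW S0)//.
    rewrite -[leRHS]expR0 ler_expR !mulNr oppr_le0 !divr_ge0 ?sumr_ge0//.
    - by move=> i _; exact: sqr_ge0.
    - exact: ltW.
    - by rewrite mulr_ge0// sqr_ge0.
  rewrite !mulr1 -invfM -exprMn.
  have hc : 0 < Num.sqrt c0 * del `^ eta by rewrite mulr_gt0 ?sqrtr_gt0 ?powR_gt0.
  rewrite lef_pV2 ?posrE; [|exact: exprn_gt0..].
  apply: lerXn2r; rewrite ?nnegrE; [exact: ltW..|].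
  have -> : Num.sqrt c0 * del `^ eta = Num.sqrt (c0 * del `^ (2 * eta)).
    rewrite sqrtrM ?(ltW c00)//; congr (_ * _).
    by rewrite mulrC powRrM powR_mulrn ?powR_ge0// sqrtr_sqr ger0_norm ?powR_ge0.
  by rewrite ler_wsqrtr// (le_trans CD)// lerDr ltW.
(* In the second, the exponential in [r / S] absorbs the factor [S ^- n]. *)
apply: (le_trans hI); rewrite lee_fin.
have -> : (C1 + C2) * (e ^+ 2) ^+ n * r ^- n =
  (C1 + C2) * r ^- n * (e ^+ 2) ^+ n by ring.
rewrite mulrAC ler_wpM2r//.
apply: (@le_trans _ _ (C2 * r ^- n)); last first.
  by rewrite ler_wpM2r ?invr_ge0 ?exprn_ge0 ?(ltW r0)// lerDr ltW.
rewrite /C2 -[leRHS]mulrA; apply: ler_wpM2l; first by rewrite exprn_ge0// ltW.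
have r2 : r ^+ 2 = \sum_i (z i - z' i) ^+ 2.
  by rewrite sqr_sqrtr// sumr_ge0// => i _; exact: sqr_ge0.
have l1 : (1 - l) ^+ 2 * (n%:R * M ^+ 2) <= K2 * S ^+ 2.
  have hl : (1 - l) ^+ 2 <= (K / c1) ^+ 2 * (C / c0).
    have l1E : 1 - l = (A - B) / A by rewrite /l mulrBl divff// gt_eqF.
    have hh : `|1 - l| <= K / c1 * del `^ eta.
      rewrite l1E normrM normfV (gtr0_norm A0).
      apply: (@le_trans _ _ (K * del `^ eta / c1)); last by rewrite mulrAC.
      by rewrite ler_pM ?invr_ge0 ?(ltW A0)// lef_pV2 ?posrE.
    rewrite -real_normK ?num_real//.
    apply: (@le_trans _ _ ((K / c1 * del `^ eta) ^+ 2)).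
      by rewrite lerXn2r ?nnegrE ?mulr_ge0 ?powR_ge0 ?invr_ge0// ltW.
    rewrite exprMn ler_wpM2l ?sqr_ge0//.
    rewrite -powR_mulrn ?powR_ge0// -powRrM mulrC ler_pdivlMr// mulrC.
    by rewrite mulrC [_ * c0]mulrC.
  have nM : 0 <= n%:R * M ^+ 2 by rewrite mulr_ge0// sqr_ge0.
  apply: (le_trans (ler_wpM2r nM hl)).
  have -> : (K / c1) ^+ 2 * (C / c0) * (n%:R * M ^+ 2) = K2 * C by rewrite /K2; ring.
  rewrite ler_wpM2l ?S2 ?lerDr ?(ltW e2)//.
  by rewrite /K2 divr_ge0 ?(ltW c00)// mulr_ge0// sqr_ge0.
(* Since [l z - z' = (z - z') - (1 - l) z], the squared regression error is at most
   of the order of the conditional variance, which [S] includes. *)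
have zz : r ^+ 2 / 2 - K2 * S ^+ 2 <= \sum_i (l * z i - z' i) ^+ 2.
  apply: (@le_trans _ _ (\sum_i ((z i - z' i) ^+ 2 / 2 - (1 - l) ^+ 2 * M ^+ 2))).
    rewrite sumrB -mulr_suml -r2 lerD2l lerN2 sumr_const card_ord.
    by rewrite -mulrnAr -mulr_natl.
  apply: ler_sum => i _.
  have zi : z i ^+ 2 <= M ^+ 2.
    by rewrite -real_normK ?num_real// lerXn2r ?nnegrE// zM.
  have := ler_wpM2l (sqr_ge0 (1 - l)) zi.
  have -> : l * z i - z' i = (z i - z' i) - (1 - l) * z i by ring.
  have := sqr_ge0 ((z i - z' i) - 2 * ((1 - l) * z i)).
  have -> : (1 - l) ^+ 2 * z i ^+ 2 = ((1 - l) * z i) ^+ 2 by ring.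
  by move: (z i - z' i) ((1 - l) * z i) (_ * M ^+ 2) => x y w; rewrite !expr2; lra.
apply: (@le_trans _ _ (S ^- n * (expR (K2 / (2 * La)) *
    expR (- ((r / S) ^+ 2 / (4 * La)))))).
  rewrite ler_wpM2l ?invr_ge0 ?exprn_ge0 ?(ltW S0)// -expRD ler_expR.
  have iS : 0 < (La * (2 * S ^+ 2))^-1.
    by rewrite invr_gt0 !mulr_gt0// exprn_gt0.
  have := ler_wpM2r (ltW iS) zz.
  have -> : (r ^+ 2 / 2 - K2 * S ^+ 2) / (La * (2 * S ^+ 2)) =
      (r / S) ^+ 2 / (4 * La) - K2 / (2 * La).
    by field; rewrite !gt_eqF.
  have -> : - (\sum_i (l * z i - z' i) ^+ 2) / La / (2 * S ^+ 2) =
    - ((\sum_i (l * z i - z' i) ^+ 2) / (La * (2 * S ^+ 2))).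
    by field; rewrite !gt_eqF.
  by lra.
have La4 : 0 < 4 * La by rewrite mulr_gt0.
have rS0 : 0 <= r / S by rewrite divr_ge0// ltW.
have := exp_decay_le n0 La4 rS0.
set X := expR _; rewrite expr_div_n => h.
rewrite [leLHS]mulrCA -[leRHS]mulrA; apply: ler_wpM2l; first exact: expR_ge0.
rewrite ler_pdivlMr ?exprn_gt0// (le_trans _ h)//.
by rewrite le_eqVlt; apply/orP; left; apply/eqP; ring.
Qed.

End two_points.

(** * The Riesz kernel as an integral over the parameters *)

Section kernel_integral.
Context {R : realType}.

(** There are [O(1 + |ln r|)] dyadic shells between [r^(1 / eta)] and [Dmax], and for
    [r <= rmax < cstar] the logarithm of [cstar / r] is bounded away from [0]. *)
Let dyadic_count (rmax cstar Dmax eta : R) : 0 < rmax -> rmax < cstar ->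
  0 < Dmax -> 0 < eta ->
  exists2 K : R, 0 < K & forall r, 0 < r <= rmax ->
    exists2 J : nat, Dmax <= 2 ^+ J * r `^ (eta^-1) & J%:R <= K * ln (cstar / r).
Proof.
move=> rmax0 rc D0 eta0.
have c0 : 0 < cstar by rewrite (lt_trans rmax0).
pose l0 := ln (cstar / rmax).
have l00 : 0 < l0 by rewrite ln_gt0// ltr_pdivlMr// mul1r.
have ln20 : 0 < ln 2 :> R by rewrite ln_gt0// ltr1n.
pose a := (`|ln Dmax| + `|ln cstar| / eta) / ln 2 + 1.
have a0 : 0 < a.
  by rewrite ltr_pwDr// divr_ge0 ?(ltW ln20)// addr_ge0// divr_ge0// ltW.
exists (a / l0 + (eta * ln 2)^-1).
  by rewrite addr_gt0// ?divr_gt0// invr_gt0 mulr_gt0.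
move=> r /andP[r0 rm].
have lr : l0 <= ln (cstar / r).
  by rewrite ler_ln ?posrE ?divr_gt0// ler_pM2l// lef_pV2 ?posrE.
set l := ln (cstar / r) in lr *.
have l1 : 0 < l by rewrite (lt_le_trans l00).
have lE : ln r = ln cstar - l by rewrite /l ln_div ?posrE// opprB addrC subrK.
pose x := (ln Dmax - ln r / eta) / ln 2.
pose y := Num.max x 0.
have y0 : 0 <= y by rewrite le_max lexx orbT.
exists (Num.truncn y).+1.
  rewrite -[leLHS]lnK ?posrE// -[2]lnK ?posrE// -expRM_natl -[X in _ * X]lnK ?posrE ?powR_gt0//.
  rewrite -expRD ler_expR ln_powR -lerBlDr -ler_pdivrMr// [X in _ - X]mulrC.
  by apply: ltW; apply: (le_lt_trans _ (truncnS_gt y)); rewrite le_max lexx.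
have yl : y <= a - 1 + l / (eta * ln 2).
  rewrite ge_max; apply/andP; split; last first.
    rewrite addr_ge0//; last by rewrite divr_ge0 ?(ltW l1)// mulr_ge0// ltW.
    by rewrite /a addrK divr_ge0 ?(ltW ln20)// addr_ge0// divr_ge0// ltW.
  rewrite /a addrK /x lE.
  have -> : l / (eta * ln 2) = (l / eta) / ln 2 by rewrite invfM mulrA.
  rewrite -mulrDl ler_pM2r ?invr_gt0// [X in _ - X]mulrBl.
  have := ler_norm (ln Dmax); have := ler_norm (- (ln cstar / eta)).
  rewrite normrN normrM normfV (gtr0_norm eta0).
  by move: `|_| (_ / _) (_ / _) => ? ? ?; lra.
have tr : (Num.truncn y).+1%:R <= y + 1.
  by rewrite -[(Num.truncn y).+1%:R]natr1 lerD2r truncn_le.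
apply: (le_trans tr).
apply: (@le_trans _ _ (a + l / (eta * ln 2))); first by lra.
rewrite mulrDl [_^-1 * l]mulrC lerD2r.
by rewrite mulrAC ler_pdivlMr// ler_pM2l.
Qed.

(** The kernel dominates the integral of the minimum of [N^{-eta d}] and
    [r^{-d}]: the two bounds agree where [N = r^{1/eta}], and the growth
    [mu {N <= t} = O(t^m)] makes the part below this radius of order
    [r^{-d + m/eta}]. The part above it is dominated by its lower end, by its
    upper end, or evenly by all scales, according to the sign of [eta d - m],
    which is the sign of the index of the kernel; for a negative index the first bound
    alone is integrable. *)
Lemma kernel_integral_le (eta rmax cstar Dmax C0 : R) (n m : nat) :
  0 < eta -> 0 < rmax -> rmax < cstar -> 0 < Dmax -> 0 <= C0 ->
  (0 < n)%N -> (0 < m)%N ->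
  exists2 C : R, 0 < C &
  forall (d : measure_display) (T : measurableType d)
    (mu : {measure set T -> \bar R}) (N : T -> R) (S : set T) (f : T -> \bar R)
    (r : R),
  measurable_fun setT N -> (forall x, 0 <= N x) ->
  (forall t, (0 < t)%R -> mu [set x | (N x <= t)%R] <= (C0 * t ^+ m)%:E)%E ->
  measurable S -> (forall x, S x -> N x <= Dmax) ->
  measurable_fun S f -> (forall x, S x -> 0 <= f x)%E -> 0 <= r <= rmax ->
  (forall x, S x -> (0 < N x)%R -> f x <= (N x `^ (- (eta * n%:R)))%:E)%E ->
  (forall x, S x -> (0 < r)%R -> f x <= (r ^- n)%:E)%E ->
  (\int[mu]_(x in S) f x <=
   C%:E * riesz_kernel cstar (n%:R - m%:R / eta) r)%E.
Proof.
move=> eta0 rmax0 rc D0 C00 n0 m0.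
set g := n%:R - m%:R / eta; set kappa := eta * n%:R.
have k0 : 0 < kappa by rewrite mulr_gt0// ltr0n.
have kg : m%:R - kappa = - (eta * g).
  by rewrite /g /kappa mulrBr opprB mulrCA divff ?gt_eqF// mulr1.
have c0 : 0 < cstar by rewrite (lt_trans rmax0).
have [K K0 hK] := dyadic_count rmax0 rc D0 eta0.
pose l0 := ln (cstar / rmax).
have l00 : 0 < l0 by rewrite ln_gt0// ltr_pdivlMr// mul1r.
pose A1 := C0 * 2 ^+ m * Dmax `^ (m%:R - kappa) * 2 `^ (kappa - m%:R) /
     (1 - 2 `^ (kappa - m%:R)).
pose A2 := C0 * 2 ^+ m / (1 - 2 `^ (m%:R - kappa)).
pose A3 := C0 / l0 + C0 * 2 ^+ m * K.
(* The constants [A1], [C0 + A2] and [A3] serve a negative, a positive and a zero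
   index. *)
exists (1 + `|A1| + C0 + `|A2| + `|A3|).
  by rewrite -!addrA ltr_pwDl// !addr_ge0.
set C := 1 + _ + _ + _ + _.
have CA1 : A1 <= C.
  rewrite (le_trans (ler_norm _))// /C -!addrA [1 + _]addrC -!addrA lerDl.
  by rewrite !addr_ge0.
have CA2 : C0 + A2 <= C.
  have := ler_norm A2; have := normr_ge0 A1; have := normr_ge0 A3.
  by rewrite /C; lra.
have CA3 : A3 <= C.
  have := ler_norm A3; have := normr_ge0 A1; have := normr_ge0 A2.
  by rewrite /C; lra.
have Cp : 0 < C by rewrite /C -!addrA ltr_pwDl// !addr_ge0.
move=> d T mu N S f r mN N0 muN mS ND mf f0 /andP[r0 rm] fN fr.
have mle t := measurable_sublevel t mN.
rewrite /riesz_kernel; case: ifPn => [gneg|].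
  have km : kappa < m%:R.
    rewrite -subr_gt0 kg oppr_gt0 pmulr_rlt0//.
  rewrite mule1.
  (* The bounds say nothing about [f] where [N] vanishes, a null set. *)
  have N00 : mu [set x | N x <= 0] = 0%E.
    apply/eqP; rewrite eq_le measure_ge0 andbT; apply/lee_addgt0Pr => e e0.
    rewrite add0e.
    have s0 : 0 < e / (C0 + 1) by rewrite divr_gt0// ltr_wpDl.
    pose t := Num.min 1 (e / (C0 + 1)).
    have t0 : 0 < t by rewrite lt_min ltr01.
    apply: (@le_trans _ _ (mu [set x | N x <= t])).
      by apply: le_measure; rewrite ?inE// => x /= h; rewrite (le_trans h)// ltW.
    apply: (le_trans (muN _ t0)); rewrite lee_fin.
    apply: (@le_trans _ _ (C0 * t)).
      rewrite ler_wpM2l// -[leRHS]expr1 ler_wiXn2l// ?(ltW t0)//.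
      by rewrite ge_min lexx.
    apply: (@le_trans _ _ (C0 * (e / (C0 + 1)))).
      by rewrite ler_wpM2l// ge_min lexx orbT.
    rewrite mulrCA -[leRHS]mulr1 ler_wpM2l ?(ltW e0)// ler_pdivrMr; lra.
  have SE : S = (S `&` [set x | N x <= 0]) `|` (S `&` ~` [set x | N x <= 0]).
    by rewrite -setIUr setUv setIT.
  have mS1 : measurable (S `&` [set x | N x <= 0]) by exact: measurableI.
  have mS2 : measurable (S `&` ~` [set x | N x <= 0]).
    by apply: measurableI => //; exact: measurableC.
  rewrite SE ge0_integral_setU//; last 3 first.
  - by rewrite -SE.
  - by rewrite -SE => x Sx; exact: f0.
  - by apply/disj_setPS => x [[_ h1] [_ h2]]; exact: h2.
  rewrite null_set_integral//; last 2 first.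
  - by apply: measurable_funS mf => // x [].
  - apply/eqP; rewrite eq_le measure_ge0 andbT -N00.
    by apply: le_measure; rewrite ?inE//; exact: subIsetr.
  rewrite add0e.
  apply: (@le_trans _ _ (\int[mu]_(x in [set x | (N x <= Dmax)%R])
      (N x `^ (- kappa))%:E)%E); last first.
    apply: (le_trans (integral_powR_near mN N0 C00 muN D0 k0 km)).
    by rewrite lee_fin.
  apply: (@le_trans _ _ (\int[mu]_(x in S `&` ~` [set x | (N x <= 0)%R])
      (N x `^ (- kappa))%:E)%E).
    apply: ge0_le_integral => //.
    - by move=> x [Sx _]; exact: f0.
    - by apply: measurable_funS mf => // x [].
    - apply: measurable_funTS; apply/measurable_EFinP.
      exact: (measurableT_comp (measurable_powR _)).
    - move=> x [Sx /negP]; rewrite -ltNge => Nx; exact: fN.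
  apply: ge0_subset_integral => //.
  - apply: measurable_funTS; apply/measurable_EFinP.
    exact: (measurableT_comp (measurable_powR _)).
  - by move=> x _; rewrite lee_fin powR_ge0.
  - by move=> x [Sx _]; exact: ND.
rewrite -leNgt => g0.
case: ifPn => [_|rn0]; first by rewrite mulry gtr0_sg// mul1e leey.
have {}r0 : 0 < r by rewrite lt_neqAle eq_sym rn0.
pose rho := r `^ (eta^-1); have rho0 : 0 < rho by rewrite powR_gt0.
have rhoE x : rho `^ x = r `^ (x / eta) by rewrite /rho -powRrM mulrC.
have SE : S = (S `&` [set x | N x <= rho]) `|` (S `&` ~` [set x | N x <= rho]).
  by rewrite -setIUr setUv setIT.
have mS1 : measurable (S `&` [set x | N x <= rho]) by exact: measurableI.
have mS2 : measurable (S `&` ~` [set x | N x <= rho]).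
  by apply: measurableI => //; exact: measurableC.
have near : (\int[mu]_(x in S `&` [set x | (N x <= rho)%R]) f x <=
    (C0 * r `^ (- g))%:E)%E.
  apply: (@le_trans _ _ (\int[mu]_(x in S `&` [set x | (N x <= rho)%R])
      (r ^- n)%:E)%E).
    apply: ge0_le_integral => //.
    - by move=> x [Sx _]; exact: f0.
    - by apply: measurable_funS mf => // x [].
    - by move=> x [Sx _]; exact: fr.
  rewrite integral_cst//.
  have rn : 0 <= r ^- n by rewrite invr_ge0 exprn_ge0// ltW.
  apply: (@le_trans _ _ ((r ^- n)%:E * (C0 * rho ^+ m)%:E)%E).
    apply: lee_wpmul2l; first by rewrite lee_fin.
    apply: le_trans (muN _ rho0).
    by apply: le_measure; rewrite ?inE//; exact: subIsetr.
  rewrite -EFinM lee_fin mulrCA ler_wpM2l//.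
  have -> : rho ^+ m = r `^ (m%:R / eta).
    by rewrite -[LHS]powR_mulrn ?(ltW rho0)// rhoE.
  rewrite -powR_invn ?(ltW r0)//.
  rewrite -powRD; last by rewrite (gt_eqF r0) implybT.
  by rewrite /g opprB addrC.
rewrite SE ge0_integral_setU//; last 3 first.
- by rewrite -SE.
- by rewrite -SE => x Sx; exact: f0.
- by apply/disj_setPS => x [[_ h1] [_ h2]]; exact: h2.
have far : (\int[mu]_(x in S `&` ~` [set x | (N x <= rho)%R]) f x <=
    \int[mu]_(x in S `&` ~` [set x | (N x <= rho)%R]) (N x `^ (- kappa))%:E)%E.
  apply: ge0_le_integral => //.
  - by move=> x [Sx _]; exact: f0.
  - by apply: measurable_funS mf => // x [].
  - apply: measurable_funTS; apply/measurable_EFinP.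
    exact: (measurableT_comp (measurable_powR _)).
  - by move=> x [Sx /negP]; rewrite -ltNge => Nx; apply: fN => //; exact: lt_trans Nx.
apply: (le_trans (leeD near far)).
have [gE|gn0] := eqVneq g 0.
  have [|J DJ JK] := hK r; first by rewrite r0 rm.
  have km : kappa = m%:R.
    by apply/esym/eqP; rewrite -subr_eq0 kg gE mulr0 oppr0.
  rewrite km gE oppr0 powRr0 mulr1.
  apply: (@le_trans _ _ (C0%:E + (C0 * 2 ^+ m * J%:R)%:E)%E).
    apply: leeD; first exact: lexx.
    apply: (integral_powR_log mN muN rho0) => //.
    move=> x [Sx /negP]; rewrite -ltNge => -> /=.
    by rewrite (le_trans (ND _ Sx)).
  rewrite -EFinM -EFinD lee_fin.
  have lr : l0 <= ln (cstar / r).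
    by rewrite ler_ln ?posrE ?divr_gt0// ler_pM2l// lef_pV2 ?posrE.
  apply: (@le_trans _ _ (A3 * ln (cstar / r))); last first.
    by rewrite ler_wpM2r// (le_trans (ltW l00)).
  rewrite /A3 mulrDl lerD//.
    by rewrite mulrAC ler_pdivlMr// ler_wpM2l.
  by rewrite -!mulrA ler_wpM2l// ler_wpM2l// exprn_ge0.
have {gn0}g0 : 0 < g by rewrite lt_neqAle eq_sym gn0.
have km : m%:R < kappa by rewrite -subr_lt0 kg oppr_lt0 mulr_gt0.
rewrite -EFinM.
apply: (@le_trans _ _ ((C0 * r `^ (- g))%:E + (C0 * 2 ^+ m * rho `^ (m%:R - kappa) /
    (1 - 2 `^ (m%:R - kappa)))%:E)%E).
  apply: leeD => //; apply: (integral_powR_far mN C00 muN rho0) => //.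
  by move=> x [Sx /negP]; rewrite -ltNge.
rewrite -EFinD lee_fin rhoE.
have -> : (m%:R - kappa) / eta = - g.
  by rewrite kg mulNr mulrAC divff ?gt_eqF// mul1r.
apply: (@le_trans _ _ ((C0 + A2) * r `^ (- g))); last first.
  by rewrite ler_wpM2r// powR_ge0.
by rewrite mulrDl lerD2l /A2 le_eqVlt; apply/orP; left; apply/eqP; ring.
Qed.

End kernel_integral.

(** * The second moment method *)

Section second_moment.
Context {R : realType}.
Local Open Scope ereal_scope.

(** On the event [Z >= a / 2], [Z] is at most the average of [t Z^2] and [1/t];
    off this event it is less than half of the bound on its mean. *)
Lemma paley_zygmund d (W : measurableType d) (P : probability W R)
    (Z : W -> \bar R) (a b : R) :
  measurable_fun setT Z -> (forall w, 0 <= Z w) -> (0 < a)%R -> (0 < b)%R ->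
  a%:E <= \int[P]_w Z w -> \int[P]_w (Z w * Z w) <= b%:E ->
  (a ^+ 2 / (4 * b))%:E <= P [set w | (a / 2)%:E <= Z w].
Proof.
move=> mZ Z0 a0 b0 aZ Zb; set B := [set w | _].
have mB : measurable B by rewrite -[B]setTI; exact: emeasurable_fun_c_infty.
(* This value makes the second moment contribute [a / 4]. *)
pose t := (a / (2 * b))%R; have t0 : (0 < t)%R by rewrite divr_gt0// mulr_gt0.
pose q := fine (P B); have PB : P B = q%:E by rewrite fineK// fin_num_measure.
pose h w : \bar R := (a / 2)%:E + ((t / 2)%:E * (Z w * Z w) + ((2 * t)^-1)%:E * (\1_B w)%:E).
have mZZ : measurable_fun setT (fun w => Z w * Z w) by exact: emeasurable_funM.
have ZZ0 w : 0 <= Z w * Z w by exact: mule_ge0.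
have t20 : (0 <= t / 2)%R by rewrite divr_ge0// ltW.
have t2V : (0 <= (2 * t)^-1)%R by rewrite invr_ge0 mulr_ge0// ltW.
have Zh w : Z w <= h w.
  rewrite /h indicE; have := Z0 w; have [wB|wB] := boolP (w \in B).
    case: (Z w) => [r r0| _|//]; last first.
      have t2 : 0 < (t / 2)%:E by rewrite lte_fin divr_gt0.
      by rewrite mulyy (gt0_muley t2) -EFinM.
    rewrite -!EFinM -!EFinD lee_fin mulr1.
    apply: (@le_trans _ _ (t / 2 * (r * r) + (2 * t)^-1)%R); last first.
      by rewrite lerDr divr_ge0// ltW.
    rewrite -subr_ge0.
    have -> : (t / 2 * (r * r) + (2 * t)^-1 - r = (t * r - 1) ^+ 2 / (2 * t))%R.
      by field; rewrite gt_eqF.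
    by rewrite divr_ge0 ?sqr_ge0// mulr_ge0// ltW.
  move=> _; have /negP := wB; rewrite inE /B/= => /negP; rewrite -ltNge => Zw.
  rewrite mule0 adde0 (le_trans (ltW Zw))// leeDl// mule_ge0//.
have : \int[P]_w Z w <= (a / 2 + t / 2 * b + (2 * t)^-1 * q)%:E.
  apply: (@le_trans _ _ (\int[P]_w h w)).
    apply: ge0_le_integral => //.
    apply: emeasurable_funD => //; apply: emeasurable_funD.
      exact: measurable_funeM.
    by apply: measurable_funeM; apply/measurable_EFinP; exact: measurable_indic.
  rewrite ge0_integralD//; last 3 first.
  - by rewrite lee_fin divr_ge0// ltW.
  - by move=> w _; rewrite adde_ge0// mule_ge0// lee_fin.
  - apply: emeasurable_funD; first exact: measurable_funeM.
    by apply: measurable_funeM; apply/measurable_EFinP; exact: measurable_indic.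
  rewrite integral_cst// [X in _ * X](_ : _ = 1%E); last exact: probability_setT.
  rewrite mule1 ge0_integralD//; last 4 first.
  - by move=> w _; rewrite mule_ge0.
  - exact: measurable_funeM.
  - by move=> w _; rewrite mule_ge0// lee_fin.
  - by apply: measurable_funeM; apply/measurable_EFinP; exact: measurable_indic.
  have hB : \int[P]_w (\1_B w)%:E = q%:E by rewrite integral_indic// setIT.
  rewrite ge0_integralZl// ge0_integralZl ?lee_fin//; last first.
    by apply/measurable_EFinP; exact: measurable_indic.
  rewrite hB EFinD EFinD -addeA.
  by rewrite leeD2l// EFinM [in leRHS]EFinM leeD2r// lee_wpmul2l// lee_fin.
move=> /(le_trans aZ); rewrite PB !lee_fin => h1.
have t2 : (0 < (2 * t)^-1)%R by rewrite invr_gt0 mulr_gt0.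
rewrite -(ler_pM2l t2).
have -> : ((2 * t)^-1 * (a ^+ 2 / (4 * b)) = a / 4)%R.
  by rewrite /t; field; rewrite !gt_eqF.
have E : (t / 2 * b = a / 4)%R by rewrite /t; field; rewrite gt_eqF.
by move: h1; rewrite E; lra.
Qed.

(** The square is an integral over pairs; Tonelli in one variable at a time leaves
    iterated integrals. *)
Lemma sqr_integral d (W : measurableType d) (P : probability W R)
    dX (X : measurableType dX) (mu : {sigma_finite_measure set X -> \bar R})
    (g : X * W -> \bar R) :
  measurable_fun setT g -> (forall x, 0 <= g x) ->
  \int[P]_w ((\int[mu]_x g (x, w)) * (\int[mu]_x g (x, w))) =
  \int[mu]_x \int[mu]_x' \int[P]_w (g (x, w) * g (x', w)).
Proof.
move=> mg g0; pose Z w := \int[mu]_x g (x, w).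
have Z0 w : 0 <= Z w by exact: integral_ge0.
have mZ : measurable_fun setT Z.
  exact: (@measurable_fun_fubini_tonelli_G _ _ _ _ _ mu _ mg g0).
have mgw w : measurable_fun setT (fun x => g (x, w)).
  exact: (measurableT_comp mg (measurable_pair2 w)).
have mgx x : measurable_fun setT (fun w => g (x, w)).
  exact: (measurableT_comp mg (measurable_pair1 x)).
transitivity (\int[P]_w \int[mu]_x (g (x, w) * Z w)).
  by apply: eq_integral => w _; rewrite ge0_integralZr.
have := @fubini_tonelli _ _ _ _ _ mu P (fun x => g x * Z x.2).
move=> /= <-; last 2 first.
- by apply: emeasurable_funM => //; exact: measurableT_comp.
- by move=> x; exact: mule_ge0.
apply: eq_integral => x _.
transitivity (\int[P]_w \int[mu]_x' (g (x, w) * g (x', w))).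
  by apply: eq_integral => w _; rewrite ge0_integralZl.
have := @fubini_tonelli _ _ _ _ _ mu P (fun x' => g (x, x'.2) * g x').
move=> /= <- //.
- by apply: emeasurable_funM => //; exact: measurableT_comp (mgx x) measurable_snd.
- by move=> x'; exact: mule_ge0.
Qed.

(** The unions of the tails decrease to the upper limit, and [P] is continuous from
    above. *)
Lemma le_lim_sup_set d (W : measurableType d) (P : probability W R)
    (F : (set W)^nat) (a : R) : (forall n, measurable (F n)) ->
  (forall n, a%:E <= P (F n)) ->
  measurable (lim_sup_set F) /\ a%:E <= P (lim_sup_set F).
Proof.
move=> mF aF; have mG n : measurable (\bigcup_(j >= n) F j).
  by apply: bigcup_measurable => j _.
have mL : measurable (lim_sup_set F) by exact: bigcapT_measurable.
split => //.
have := @nonincreasing_cvg_mu _ _ _ P (fun n => \bigcup_(j >= n) F j).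
move=> /(_ _ mG mL) h.
have {}h := h (le_lt_trans (probability_le1 P (mG _)) (ltry 1)).
have nG : nonincreasing_seq (fun n => \bigcup_(j >= n) F j).
  move=> n m nm; apply/subsetPset => x [j /= mj Fj].
  by exists j => //=; exact: leq_trans mj.
apply: (cvge_ge _ (h nG)); apply: nearW => n /=.
apply: (le_trans (aF n)); apply: le_measure; rewrite ?inE//.
by move=> x Fx; exists n => /=.
Qed.

End second_moment.

Section product_measure.
Context {R : realType} d1 (T1 : measurableType d1) d2 (T2 : measurableType d2).
Variables (m1 : {sigma_finite_measure set T1 -> \bar R})
  (m2 : {sigma_finite_measure set T2 -> \bar R}).

(** A name of its own lets the product carry the structure of a sigma-finite measure. *)
Definition prod_measure : set (T1 * T2) -> \bar R := (m1 \x m2)%E.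

HB.instance Definition _ := Measure.copy prod_measure (m1 \x m2)%E.

Let prod_measure_sigma_finite : sigma_finite setT prod_measure.
Proof.
have /sigma_finiteP[F [TF ndF Foo]] := sigma_finiteT m1.
have /sigma_finiteP[G [TG ndG Goo]] := sigma_finiteT m2.
exists (fun i => F i `*` G i).
  apply/esym/seteqP; split => // -[x y] _.
  have [i _ Fx] : (\bigcup_i F i) x by rewrite -TF.
  have [j _ Gy] : (\bigcup_i G i) y by rewrite -TG.
  exists (maxn i j) => //; split => /=.
    by move: x Fx; exact/subsetPset/ndF/leq_maxl.
  by move: y Gy; exact/subsetPset/ndG/leq_maxr.
move=> i; have [mF Fi] := Foo i; have [mG Gi] := Goo i; split.
  exact: measurableX.
by rewrite [ltLHS]product_measure1E// lte_mul_pinfty// ge0_fin_numE.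
Qed.

HB.instance Definition _ := Measure_isSigmaFinite.Build _ _ _ prod_measure
  prod_measure_sigma_finite.

Lemma prod_measureE (A : set T1) (B : set T2) : measurable A -> measurable B ->
  prod_measure (A `*` B) = (m1 A * m2 B)%E.
Proof. exact: product_measure1E. Qed.

End product_measure.

Section smeared_occupation.
Context {R : realType} (n : nat) dE (E : measurableType dE) dW
  (W : measurableType dW) dY (Y : measurableType dY).
Variables (P : probability W R) (m : {sigma_finite_measure set Y -> \bar R})
  (nu : {sigma_finite_measure set E -> \bar R}).
Variables (V : 'I_n -> E -> W -> R) (z : 'I_n -> Y -> R).
Variables (S : set E) (K : set Y).
Hypotheses (mS : measurable S) (mK : measurable K).
Hypothesis mV : forall i, measurable_fun setT (fun x : E * W => V i x.1 x.2).
Hypothesis mz : forall i, measurable_fun setT (z i).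

(** Up to the factor [(2 pi)^(n / 2)], the value at [V x.1] of the Gaussian density
    with mean [z x.2] and standard deviation [e]. *)
Definition mollifier (e : R) (x : E * Y) (w : W) : R :=
  \prod_i (e^-1 * gauss ((V i x.1 w - z i x.2) / e)).

(** As [e] tends to [0], this approximates the time that [V] spends, under [nu] on
    [S], at the points [z y], averaged over [y] in [K]. *)
Definition smeared (e : R) (w : W) : \bar R :=
  (\int[prod_measure nu m]_x (\1_(S `*` K) x * mollifier e x w)%:E)%E.

Lemma mollifier_ge0 e x w : 0 < e -> 0 <= mollifier e x w.
Proof.
by move=> e0; apply: prodr_ge0 => i _; rewrite mulr_ge0 ?gauss_ge0// invr_ge0 ltW.
Qed.

Lemma measurable_mollifier e :
  measurable_fun setT (fun xw : (E * Y) * W => mollifier e xw.1 xw.2).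
Proof.
apply: measurable_prod => i _; apply: measurable_funM => //.
apply: measurableT_comp measurable_gauss _; apply: measurable_funM => //.
apply: measurable_funB.
  have h : measurable_fun setT (fun xw : (E * Y) * W => (xw.1.1, xw.2)).
    apply: measurable_fun_pair; last exact: measurable_snd.
    exact: measurableT_comp measurable_fst measurable_fst.
  exact: (measurableT_comp (mV i) h).
apply: (measurableT_comp (mz i)).
exact: measurableT_comp measurable_snd measurable_fst.
Qed.

Local Notation nm := (prod_measure nu m).

Variable e : R.
Hypothesis e0 : 0 < e.

Let g (xw : (E * Y) * W) : \bar R :=
  (\1_(S `*` K) xw.1 * mollifier e xw.1 xw.2)%:E.

Let g0 xw : (0 <= g xw)%E.
Proof. by rewrite lee_fin mulr_ge0// mollifier_ge0. Qed.

Let mg : measurable_fun setT g.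
Proof.
apply/measurable_EFinP; apply: measurable_funM; last exact: measurable_mollifier.
by apply: measurableT_comp => //; apply: measurable_indic; exact: measurableX.
Qed.

Lemma smeared_ge0 w : (0 <= smeared e w)%E.
Proof. by apply: integral_ge0 => x _; exact: (g0 (x, w)). Qed.

Lemma measurable_smeared : measurable_fun setT (smeared e).
Proof.
exact: (@measurable_fun_fubini_tonelli_G _ _ _ _ _ nm _ mg g0).
Qed.

Lemma mean_smeared_ge (c : R) : 0 <= c ->
  (forall p y, S p -> K y -> (c%:E <= \int[P]_w (mollifier e (p, y) w)%:E)%E) ->
  (c%:E * (nu S * m K) <= \int[P]_w smeared e w)%E.
Proof.
move=> c0 hc.
have mI : measurable_fun setT (fun x : E * Y => (\1_(S `*` K) x)%:E : \bar R).
  by apply/measurable_EFinP; apply: measurable_indic; exact: measurableX.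
have := @fubini_tonelli _ _ _ _ _ nm P g mg g0.
rewrite /smeared => /= <-.
apply: (@le_trans _ _ (\int[nm]_x (c%:E * (\1_(S `*` K) x)%:E))%E).
  rewrite ge0_integralZl//.
  rewrite integral_indic//; last exact: measurableX.
  rewrite setIT [X in (_ <= _ * X)%E](_ : _ = (nu S * m K)%E)//.
  exact: prod_measureE.
apply: ge0_le_integral => //.
- by move=> x _; rewrite mule_ge0// lee_fin.
- exact: measurable_funeM.
- exact: (@measurable_fun_fubini_tonelli_F _ _ _ _ _ P g mg g0).
move=> -[p y] _; rewrite /g/= indicE.
have [|_] := boolP ((p, y) \in S `*` K); last first.
  by rewrite mule0; apply: integral_ge0 => w _; rewrite mul0r.
rewrite inE => -[/= Sp Ky]; rewrite mule1.
by under eq_integral do rewrite mul1r; exact: hc.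
Qed.

(** The second moment is an integral over two parameters and two points. The hypothesis
    bounds the integral over the second parameter uniformly in the first one, whose
    own integral contributes [nu S]. *)
Lemma sqr_smeared_le (k : Y -> Y -> \bar R) :
  measurable_fun setT (fun yy : Y * Y => k yy.1 yy.2) ->
  (forall y y', 0 <= k y y')%E ->
  (forall p y y', S p -> K y -> K y' ->
    (\int[nu]_(q in S) \int[P]_w
      (mollifier e (p, y) w * mollifier e (q, y') w)%:E <= k y y')%E) ->
  (\int[P]_w (smeared e w * smeared e w) <=
    nu S * \int[m]_(y in K) \int[m]_(y' in K) k y y')%E.
Proof.
move=> mk k0 hk.
rewrite [leLHS](@sqr_integral _ _ _ P _ _ nm g mg g0).
have mk1 : measurable_fun setT (fun yy : Y * Y => (\1_K yy.2)%:E * k yy.1 yy.2)%E.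
  apply: emeasurable_funM => //; apply/measurable_EFinP.
  by apply: measurableT_comp => //; exact: measurable_indic.
have k10 yy : (0 <= (\1_K yy.2)%:E * k yy.1 yy.2)%E by rewrite mule_ge0// lee_fin.
pose h y := (\int[m]_y' ((\1_K y')%:E * k y y'))%E.
have h0 y : (0 <= h y)%E by apply: integral_ge0 => y' _; exact: (k10 (y, y')).
have mh : measurable_fun setT h.
  have H := @measurable_fun_fubini_tonelli_F _ _ _ _ _ m _ mk1 k10.
  exact: H.
have toI dT (T : measurableType dT) (mu : {measure set T -> \bar R})
    (A : set T) (f : T -> \bar R) : measurable A ->
    (\int[mu]_(x in A) f x = \int[mu]_x ((\1_A x)%:E * f x))%E.
  move=> mA; rewrite integral_mkcond; apply: eq_integral => x _.
  by rewrite patchE indicE; case: ifP => _; rewrite ?mul1e ?mul0e.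
have hE y : (\int[m]_(y' in K) k y y' = h y)%E by rewrite toI.
under [X in (_ * X)%E]eq_integral do rewrite hE.
have mI (A : set Y) : measurable A -> measurable_fun setT (fun y => (\1_A y)%:E : \bar R).
  by move=> mA; apply/measurable_EFinP; exact: measurable_indic.
pose G (xx : (E * Y) * (E * Y)) := (\int[P]_w (g (xx.1, w) * g (xx.2, w)))%E.
have mgg : measurable_fun setT
    (fun xxw : ((E * Y) * (E * Y)) * W => g (xxw.1.1, xxw.2) * g (xxw.1.2, xxw.2))%E.
  apply: emeasurable_funM; apply: (measurableT_comp mg).
    apply: measurable_fun_pair; last exact: measurable_snd.
    exact: measurableT_comp measurable_fst measurable_fst.
  apply: measurable_fun_pair; last exact: measurable_snd.
  exact: measurableT_comp measurable_snd measurable_fst.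
have gg0 (xxw : ((E * Y) * (E * Y)) * W) :
    (0 <= g (xxw.1.1, xxw.2) * g (xxw.1.2, xxw.2))%E by exact: mule_ge0 (g0 _) (g0 _).
have mG : measurable_fun setT G.
  exact: (@measurable_fun_fubini_tonelli_F _ _ _ _ _ P _ mgg gg0).
have G0 xx : (0 <= G xx)%E by apply: integral_ge0 => w _; exact: mule_ge0 (g0 _) (g0 _).
have SKE q y : \1_(S `*` K) (q, y) = \1_S q * \1_K y :> R.
  by rewrite !indicE in_setX/=; case: (q \in S); case: (y \in K);
    rewrite ?mul1r ?mul0r.
have mm x : measurable_fun setT (mollifier e x).
  exact: (measurableT_comp (@measurable_mollifier e) (measurable_pair1 x)).
have GE p y q y' : G ((p, y), (q, y')) =
    ((\1_S p * \1_K y * (\1_S q * \1_K y'))%:E *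
     \int[P]_w (mollifier e (p, y) w * mollifier e (q, y') w)%:E)%E.
  rewrite /G -ge0_integralZl//; last 2 first.
  - by apply/measurable_EFinP; exact: measurable_funM.
  - by move=> w _; rewrite lee_fin mulr_ge0// mollifier_ge0.
  by apply: eq_integral => w _; rewrite /g/= !SKE -!EFinM; congr EFin; ring.
have inner p y y' : S p -> K y ->
    (\int[nu]_q G ((p, y), (q, y')) <= (\1_K y')%:E * k y y')%E.
  move=> Sp Ky; rewrite indicE; have [|y'K] := boolP (y' \in K); last first.
    rewrite mul0e integral0_eq// => q _.
    by rewrite GE [\1_K y']indicE (negbTE y'K) !mulr0 mul0e.
  rewrite inE => Ky'; rewrite mul1e; apply: (le_trans _ (hk p y y' Sp Ky Ky')).
  rewrite le_eqVlt; apply/orP; left; apply/eqP; rewrite [RHS]toI//.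
  apply: eq_integral => q _.
  by rewrite GE [\1_S p]indicE [\1_K y]indicE [\1_K y']indicE !mem_set// !mul1r mulr1.
have outer x : (\int[nm]_x' G (x, x') <=
    (\1_S x.1)%:E * ((\1_K x.2)%:E * h x.2))%E.
  case: x => p y /=; rewrite !indicE.
  have [|xSK] := boolP ((p, y) \in S `*` K); last first.
    rewrite integral0_eq; last first.
      by move=> [q y'] _; rewrite GE -SKE [X in X * _]indicE (negbTE xSK) mul0r mul0e.
    by rewrite !mule_ge0// lee_fin.
  rewrite inE => -[/= Sp Ky]; rewrite !mem_set// !mul1e.
  have mGx : measurable_fun setT (fun x' => G ((p, y), x')).
    exact: (measurableT_comp mG (measurable_pair1 (p, y))).
  have := @fubini_tonelli2 _ _ _ _ _ nu m (fun x' => G ((p, y), x')) mGx.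
  move=> -> //; apply: ge0_le_integral => //.
  - by move=> y' _; exact: integral_ge0.
  - have := @measurable_fun_fubini_tonelli_G _ _ _ _ _ nu
      (fun x' => G ((p, y), x')) mGx; exact.
  - exact: (measurableT_comp mk1 (measurable_pair1 y)).
  - by move=> y' _; exact: inner.
have mIS : measurable_fun setT (fun p => (\1_S p)%:E : \bar R).
  by apply/measurable_EFinP; exact: measurable_indic.
have mIh : measurable_fun setT (fun y => (\1_K y)%:E * h y)%E.
  by apply: emeasurable_funM => //; exact: mI.
have Ih0 y : (0 <= (\1_K y)%:E * h y)%E by rewrite mule_ge0// lee_fin.
have m3 : measurable_fun setT (fun x : E * Y => (\1_S x.1)%:E * ((\1_K x.2)%:E * h x.2))%E.
  apply: emeasurable_funM; first exact: (measurableT_comp mIS measurable_fst).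
  exact: (measurableT_comp mIh measurable_snd).
have p3 (x : E * Y) : (0 <= (\1_S x.1)%:E * ((\1_K x.2)%:E * h x.2))%E.
  by rewrite mule_ge0// lee_fin.
apply: (@le_trans _ _ (\int[nm]_x ((\1_S x.1)%:E * ((\1_K x.2)%:E * h x.2)))%E).
  apply: ge0_le_integral => //.
  - by move=> x _; apply: integral_ge0 => x' _; exact: (G0 (x, x')).
  - exact: (@measurable_fun_fubini_tonelli_F _ _ _ _ _ nm _ mG G0).
  - by move=> x _; exact: outer.
rewrite (@fubini_tonelli1 _ _ _ _ _ nu m _ m3 p3) (toI _ _ m K)//.
rewrite le_eqVlt; apply/orP; left; apply/eqP.
transitivity (\int[nu]_p ((\1_S p)%:E * \int[m]_y ((\1_K y)%:E * h y)))%E.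
  apply: eq_integral => p _; rewrite /fubini_F/=.
  apply: (@ge0_integralZl _ _ _ m setT measurableT (fun y => (\1_K y)%:E * h y)%E mIh (\1_S p)%:E).
    by move=> y _; exact: Ih0.
  by rewrite lee_fin.
by rewrite ge0_integralZr ?integral_indic ?setIT//; exact: integral_ge0.
Qed.

End smeared_occupation.

Section hitting.
Context {R : realType} (n : nat) dE (E : measurableType dE) dW
  (W : measurableType dW) dY (Y : measurableType dY).
Variables (P : probability W R) (m : {sigma_finite_measure set Y -> \bar R})
  (nu : {sigma_finite_measure set E -> \bar R}).
Variables (V : 'I_n -> E -> W -> R) (z : 'I_n -> Y -> R).
Variables (S : set E) (K : set Y).
Hypotheses (mS : measurable S) (mK : measurable K).
Hypothesis mV : forall i, measurable_fun setT (fun x : E * W => V i x.1 x.2).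
Hypothesis mz : forall i, measurable_fun setT (z i).

Let mollifier_le (e eta : R) p y w : 0 < e -> 0 < eta ->
  (exists i, eta <= `|V i p w - z i y|) ->
  mollifier V z e (p, y) w <= e^-1 ^+ n * expR (- ((e^-1) ^+ 2 / (2 / eta ^+ 2))).
Proof.
move=> e0 eta0 [i hi]; rewrite /mollifier big_split/= prodr_const card_ord.
apply: ler_wpM2l; first by rewrite exprn_ge0// invr_ge0 ltW.
rewrite (bigD1 i)//= -[leRHS]mulr1; apply: ler_pM.
- exact: gauss_ge0.
- by apply: prodr_ge0 => j _; exact: gauss_ge0.
- rewrite /gauss ler_expR mulNr lerN2.
  have -> : (e^-1) ^+ 2 / (2 / eta ^+ 2) = (eta / e) ^+ 2 / 2.
    by field; rewrite !gt_eqF.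
  rewrite ler_wpM2r// -[leRHS]real_normK ?num_real//.
  rewrite lerXn2r ?nnegrE ?divr_ge0 ?(ltW eta0) ?(ltW e0)//.
  by rewrite normrM ler_pM ?invr_ge0 ?(ltW e0) ?(ltW eta0)// ger0_norm ?invr_ge0// ltW.
- by apply: prodr_ile1 => j _; rewrite gauss_ge0 gauss_le1.
Qed.

(** The smeared occupation of the points of [K] cannot stay bounded away from [0]
    as [e] tends to [0] along a trajectory that stays at positive distance from
    these points. Hence [H] contains the upper limit of the events of the inequality
    of Paley and Zygmund. *)
Lemma hitting_prob_ge (c s kappa b : R) (k : Y -> Y -> \bar R) (H : set W) :
  0 < c -> 0 < s -> 0 < kappa -> 0 < b ->
  nu S = s%:E -> m K = kappa%:E ->
  (forall e p y, 0 < e <= 1 -> S p -> K y ->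
    (c%:E <= \int[P]_w (mollifier V z e (p, y) w)%:E)%E) ->
  measurable_fun setT (fun yy : Y * Y => k yy.1 yy.2) ->
  (forall y y', 0 <= k y y')%E ->
  (forall e p y y', 0 < e <= 1 -> S p -> K y -> K y' ->
    (\int[nu]_(q in S) \int[P]_w
      (mollifier V z e (p, y) w * mollifier V z e (q, y') w)%:E <= k y y')%E) ->
  (\int[m]_(y in K) \int[m]_(y' in K) k y y' <= b%:E)%E ->
  (forall w, ~ H w -> exists2 eta, 0 < eta &
    forall p y, S p -> K y -> exists i, eta <= `|V i p w - z i y|) ->
  ((c ^+ 2 * s * kappa ^+ 2 / (4 * b))%:E <= inner_prob P H)%E.
Proof.
move=> c0 s0 kappa0 b0 nuS mKE hc mk k0 hk kb hH.
pose a := c * (s * kappa); have a0 : 0 < a by rewrite !mulr_gt0.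
pose e (j : nat) : R := j.+1%:R^-1.
have e01 j : 0 < e j <= 1.
  by rewrite invr_gt0 ltr0n/= invf_le1 ?ltr0n// ler1n.
have e0 j : 0 < e j by have /andP[] := e01 j.
pose F j := [set w | ((a / 2)%:E <= smeared m nu V z S K (e j) w)%E].
have mF j : measurable (F j).
  rewrite -[F j]setTI; apply: emeasurable_fun_c_infty => //.
  exact: measurable_smeared.
have PF j : ((c ^+ 2 * s * kappa ^+ 2 / (4 * b))%:E <= P (F j))%E.
  have sb0 : 0 < s * b by rewrite mulr_gt0.
  have -> : c ^+ 2 * s * kappa ^+ 2 / (4 * b) = a ^+ 2 / (4 * (s * b)).
    by rewrite /a; field; rewrite !gt_eqF.
  apply: paley_zygmund => //.
  - exact: measurable_smeared.
  - by move=> w; exact: smeared_ge0.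
  - apply: le_trans (mean_smeared_ge (P := P) m nu mS mK mV mz (e0 j) (ltW c0) _).
      by rewrite nuS mKE /a !EFinM.
    by move=> p y Sp Ky; exact: hc.
  - apply: (le_trans (@sqr_smeared_le _ _ _ _ _ _ _ _ P m nu V z S K mS mK mV mz
      (e j) (e0 j) k mk k0 _)).
      by move=> p y y' Sp Ky Ky'; exact: hk.
    by rewrite nuS EFinM; apply: lee_wpmul2l => //; rewrite lee_fin ltW.
have [mL PL] := le_lim_sup_set mF PF.
apply: (le_trans PL); apply: ereal_sup_ubound; exists (lim_sup_set F) => //.
split => // w wL; apply: contrapT => /hH[eta eta0 far].
(* One power more than the dimension in [exp_decay_le] makes the mollifier
   [O(1 / t)], where [t = 1 / e]. *)
pose C : R := (1 + 2 / eta ^+ 2 * n.+1%:R) ^+ n.+1.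
pose N := Num.truncn (2 * C * (s * kappa) / a).
have [j /= Nj] := wL N I; rewrite /F/= leNgt => /negP; apply.
set t : R := j.+1%:R.
have t0 : 0 < t by rewrite ltr0n.
have tC : 2 * C * (s * kappa) / a < t.
  by apply: (lt_le_trans (truncnS_gt _)); rewrite ler_nat.
pose M := t ^+ n * expR (- (t ^+ 2 / (2 / eta ^+ 2))).
have M0 : 0 <= M by rewrite mulr_ge0 ?expR_ge0// exprn_ge0// ltW.
have MC : M * t <= C.
  have eta2 : 0 < 2 / eta ^+ 2 by rewrite divr_gt0// exprn_gt0.
  apply: le_trans (exp_decay_le (ltn0Sn n) eta2 (ltW t0)).
  by rewrite /M mulrAC -exprSr.
have mI : measurable_fun setT (fun x : E * Y => (\1_(S `*` K) x)%:E : \bar R).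
  by apply/measurable_EFinP; apply: measurable_indic; exact: measurableX.
apply: (@le_lt_trans _ _ (M%:E * (s * kappa)%:E)%E); last first.
  rewrite -EFinM lte_fin -(ltr_pM2r t0).
  apply: (@le_lt_trans _ _ (C * (s * kappa))).
    by rewrite mulrAC ler_wpM2r// mulr_ge0// ltW.
  move: tC; rewrite ltr_pdivrMr// => tC.
  have -> : C * (s * kappa) = 2 * C * (s * kappa) / 2 by field.
  by rewrite [ltRHS]mulrAC ltr_pM2r// [ltRHS]mulrC.
rewrite [X in (_ <= _ * X)%E](_ : _ = \int[prod_measure nu m]_x (\1_(S `*` K) x)%:E)%E; last first.
  rewrite integral_indic//; last exact: measurableX.
  rewrite setIT EFinM -nuS -mKE; apply/esym; exact: prod_measureE.
rewrite -ge0_integralZl//.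
apply: ge0_le_integral => //.
- by move=> x _; rewrite lee_fin mulr_ge0// mollifier_ge0.
- apply/measurable_EFinP; apply: measurable_funM.
    by apply: measurable_indic; exact: measurableX.
  have := @measurable_mollifier R n _ E _ W _ Y V z mV mz (e j).
  by move=> h; exact: (measurableT_comp h (measurable_pair2 w)).
- exact: measurable_funeM.
move=> [p y] _; rewrite -EFinM lee_fin mulrC indicE.
have [|_] := boolP ((p, y) \in S `*` K); last by rewrite !mulr0.
rewrite inE => -[/= Sp Ky]; rewrite !mulr1.
by have := mollifier_le (e0 j) eta0 (far p y Sp Ky); rewrite /e invrK.
Qed.

End hitting.

(** * Inner regularity *)

Section inner_regularity.
Context {R : realType} (n : nat).
Variable m : probability 'rV[R]_n R.
Implicit Types A F : set 'rV[R]_n.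

Lemma closed_measurable_rV F : closed F -> measurable F.
Proof.
move=> cF; rewrite -(setCK F); apply: measurableC.
by apply: open_measurable_rV; exact: closed_openC.
Qed.

Let approx A := measurable A /\ forall e : R, 0 < e ->
  exists F, [/\ closed F, F `<=` A & (m (A `\` F) <= e%:E)%E].

Let closed_approx F : closed F -> approx F.
Proof.
move=> cF; split=> [|e e0]; first exact: closed_measurable_rV.
by exists F; split => //; rewrite setDv measure0 lee_fin ltW.
Qed.

Let choose_approx (A : (set 'rV[R]_n)^nat) (e : R) : 0 < e ->
  (forall i, approx (A i)) ->
  exists F : (set 'rV[R]_n)^nat, forall i,
    [/\ closed (F i), F i `<=` A i & (m (A i `\` F i) <= (e / (2 ^ i.+1)%:R)%:E)%E].
Proof.
move=> e0 hA; pose Q i F := [/\ closed F, F `<=` A i &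
  (m (A i `\` F) <= (e / (2 ^ i.+1)%:R)%:E)%E].
have [|F hF] := @choice _ _ Q; last by exists F.
by move=> i; have [_] := hA i; apply; rewrite divr_gt0// ltr0n expn_gt0.
Qed.

Let sum_le (B : (set 'rV[R]_n)^nat) (X : set 'rV[R]_n) (e : R) : 0 < e ->
  measurable X -> (forall i, measurable (B i)) -> X `<=` \bigcup_i B i ->
  (forall i, m (B i) <= (e / (2 ^ i.+1)%:R)%:E)%E -> (m X <= e%:E)%E.
Proof.
move=> e0 mX mB XB Be; apply: (le_trans (@measure_sigma_subadditive _ _ _ m X B mB mX XB)).
apply: le_trans (epsilon_trick0 xpredT (ltW e0)).
by apply: lee_nneseries => [i _ _|i _]; [exact: measure_ge0|exact: Be].
Qed.

Let bigcap_approx (A : (set 'rV[R]_n)^nat) : (forall i, approx (A i)) ->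
  approx (\bigcap_i A i).
Proof.
move=> hA; have mA i : measurable (A i) by have [] := hA i.
split=> [|e e0]; first exact: bigcapT_measurable.
have [F hF] := choose_approx e0 hA.
have mF i : measurable (F i).
  by have [cF _ _] := hF i; exact: closed_measurable_rV.
exists (\bigcap_i F i); split.
- by apply: closed_bigI => i _; have [] := hF i.
- by apply: subset_bigcap => i _; have [] := hF i.
apply: (@sum_le (fun i => A i `\` F i)) => //.
- by apply: measurableD; exact: bigcapT_measurable.
- by move=> i; exact: measurableD.
- move=> x [Ax] /existsNP[i /not_implyP[_ Fx]]; exists i => //.
  by split => //; exact: Ax.
- by move=> i; have [] := hF i.
Qed.

(** The union of the closed sets is replaced by a finite subunion, which is closed; the
    loss is small by continuity from above. *)
Let bigcup_approx (A : (set 'rV[R]_n)^nat) : (forall i, approx (A i)) ->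
  approx (\bigcup_i A i).
Proof.
move=> hA; have mA i : measurable (A i) by have [] := hA i.
split=> [|e e0]; first exact: bigcupT_measurable.
have e20 : 0 < e / 2 by rewrite divr_gt0.
have [F hF] := choose_approx e20 hA.
have mF i : measurable (F i).
  by have [cF _ _] := hF i; exact: closed_measurable_rV.
pose G j := \bigcup_(i in `I_j) F i.
have mG j : measurable (G j) by apply: bigcup_measurable => i _.
have mU : measurable (\bigcup_i A i) by exact: bigcupT_measurable.
have mUG : measurable (\bigcap_j (\bigcup_i A i `\` G j)).
  by apply: bigcapT_measurable => j; exact: measurableD.
have hU : (m (\bigcap_j (\bigcup_i A i `\` G j)) <= (e / 2)%:E)%E.
  apply: (@sum_le (fun i => A i `\` F i)) => //.
  - by move=> i; exact: measurableD.
  - move=> x hx; have [[i _ Aix] _] := hx 0%N I; exists i => //; split => // Fix'.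
    by have [_ /=] := hx i.+1 I; apply; exists i => /=.
  - by move=> i; have [] := hF i.
have [j hj] : exists j, (m (\bigcup_i A i `\` G j) <= e%:E)%E.
  apply: contrapT => /forallNP hn.
  have := @nonincreasing_cvg_mu _ _ _ m (fun j => \bigcup_i A i `\` G j).
  have mD j : measurable (\bigcup_i A i `\` G j) by exact: measurableD.
  move=> /(_ (le_lt_trans (probability_le1 m (mD 0%N)) (ltry 1)) mD mUG) h.
  have {}h : (e%:E <= m (\bigcap_j (\bigcup_i A i `\` G j)))%E.
    have nD : nonincreasing_seq (fun j => \bigcup_i A i `\` G j).
      move=> a b ab; apply/subsetPset; apply: setDS.
      by apply: bigcup_sub => i /= ia; apply: bigcup_sup => /=; exact: leq_trans ab.
    apply: (cvge_ge _ (h nD)); apply: nearW => j /=.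
    by rewrite ltW// ltNge; apply/negP; exact: hn.
  by have := le_trans h hU; rewrite lee_fin leNgt ltr_pdivrMr// ltr_pMr// ltr1n.
exists (G j); split => //.
- by apply: closed_bigcup => // i _; have [] := hF i.
- by apply: bigcup_sub => i _; have [_ FA _] := hF i; apply: (subset_trans FA); exact: bigcup_sup.
Qed.

(** An open set is a countable union of closed boxes with rational vertices. *)
Let open_approx A : open A -> approx A.
Proof.
move=> oA.
pose box (q : 'rV[rat]_n * 'rV[rat]_n) : set 'rV[R]_n :=
  [set v | forall i, ratr (q.1 0 i) <= v 0 i <= ratr (q.2 0 i)].
have cbox q : closed (box q).
  rewrite (_ : box q = \bigcap_(i in [set: 'I_n])
      ((fun v : 'rV[R]_n => v 0 i) @^-1` `[ratr (q.1 0 i), ratr (q.2 0 i)])).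
    apply: closed_bigI => i _; apply: preimage_closed; last exact: itv_closed.
    by move=> v _; exact: coord_continuous.
  apply/seteqP; split=> [v h i _|v h i]; first by rewrite /= in_itv/=; exact: h.
  by have := h i I; rewrite /= in_itv.
pose C (j : nat) := if unpickle j is Some q then
  (if `[< box q `<=` A >] then box q else set0) else set0.
suff -> : A = \bigcup_j C j.
  apply: bigcup_approx => j; apply: closed_approx; rewrite /C.
  case: unpickle => [q|]; last exact: closed0.
  by case: ifP => _; [exact: cbox|exact: closed0].
apply/seteqP; split=> [v Av|v [j _]]; last first.
  by rewrite /C; case: unpickle => [q|//]; case: ifPn => // /asboolP; exact.
have /nbhs_ballP[e /= e0 eA] := open_nbhs_nbhs (conj oA Av).
have qa i : {q : rat | ratr q \in `](v 0 i - e), (v 0 i)[}.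
  by apply/cid/rat_in_itvoo; rewrite ltrBlDr ltrDl.
have qb i : {q : rat | ratr q \in `](v 0 i), (v 0 i + e)[}.
  by apply/cid/rat_in_itvoo; rewrite ltrDl.
pose q := (\row_i projT1 (qa i), \row_i projT1 (qb i)).
exists (pickle q) => //; rewrite /C pickleK; case: ifPn => [_ i|/asboolP[]].
  rewrite !mxE; have := projT2 (qa i); have := projT2 (qb i).
  by rewrite !in_itv/= => /andP[/ltW -> _] /andP[_ /ltW ->].
apply: subset_trans eA => w boxw; split => // i j; rewrite (ord1 i).
have := boxw j; rewrite !mxE; have := projT2 (qa j); have := projT2 (qb j).
rewrite !in_itv/= => /andP[_ b1] /andP[a1 _] /andP[wa wb].
by rewrite /ball/= distrC ltr_distl (lt_le_trans a1 wa) (le_lt_trans wb b1).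
Qed.

(** The sets that are approximable together with their complement form a sigma-algebra,
    which contains the open sets. *)
Lemma probability_inner_closed A (e : R) : measurable A -> 0 < e ->
  exists F, [/\ closed F, F `<=` A & (m (A `\` F) <= e%:E)%E].
Proof.
move=> mA e0; suff /(_ A mA)[[_ h] _] :
    measurable `<=` [set A | approx A /\ approx (~` A)] by exact: h.
apply: smallest_sub => [|U oU]; last first.
  split; first exact: open_approx.
  by apply: closed_approx; exact: open_closedC.
split.
- by split; [apply: closed_approx; exact: closed0|rewrite setC0;
    apply: closed_approx; exact: closedT].
- by move=> B [B1 B2]; rewrite /= setTD setCK.
- move=> B hB; split; first by apply: bigcup_approx => i; have [] := hB i.
  by rewrite setC_bigcup; apply: bigcap_approx => i; have [] := hB i.
Qed.

End inner_regularity.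

(** * Continuous processes *)

Section joint_measurability.
Context {R : realType}.

Let measurable_countable_comp dE (E : measurableType dE) dW (W : measurableType dW)
    (X : countType) (c : E -> X) (f : X -> W -> R) :
  (forall x, measurable (c @^-1` [set x])) ->
  (forall x, measurable_fun setT (f x)) ->
  measurable_fun setT (fun ew : E * W => f (c ew.1) ew.2).
Proof.
move=> mc mf _ B mB; rewrite setTI.
rewrite (_ : _ @^-1` B = \bigcup_x ((c @^-1` [set x]) `*` (f x @^-1` B))).
  apply: countable_bigcupT_measurable => // x; apply: measurableX => //.
  by rewrite -[X in measurable X]setTI; exact: mf.
apply/seteqP; split=> [[e w] /= fB|[e w] [x _ [/= <-]]//].
by exists (c e).
Qed.

Let measurable_floor_eq (a : int) : measurable [set t : R | Num.floor t = a].
Proof.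
rewrite (_ : [set t | _] = `[a%:~R, (a + 1)%:~R[%classic) //.
apply/seteqP; split=> t /=; rewrite in_itv/=; last exact: floor_def.
by move=> <-; exact: floor_itv.
Qed.

Let grid (N : nat) (x : int) : R := x%:~R / N.+1%:R.

Let grid_floor (N : nat) (t : R) :
  `|t - grid N (Num.floor (N.+1%:R * t))| < N.+1%:R^-1.
Proof.
have N0 : 0 < N.+1%:R :> R by rewrite ltr0n.
have /andP[h1 h2] := floor_itv (N.+1%:R * t).
have -> : t - grid N (Num.floor (N.+1%:R * t)) =
    (N.+1%:R * t - (Num.floor (N.+1%:R * t))%:~R) / N.+1%:R.
  by rewrite /grid mulrBl mulrAC divff ?mul1r// gt_eqF.
rewrite normrM normfV (gtr0_norm N0) ger0_norm ?subr_ge0//.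
by rewrite -[ltRHS]mul1r ltr_pM2r ?invr_gt0// ltrBlDl -[X in _ + X]/(1%:~R) -intrD.
Qed.

(** The process is the limit of its compositions with the rounding of the
    parameter to a finer and finer grid, which take countably many values. *)
Lemma measurable_continuous_process (k : nat) dW (W : measurableType dW)
    (u : R * 'rV[R]_k -> W -> R) : (forall p, measurable_fun setT (u p)) ->
  (forall w, continuous (fun p => u p w)) ->
  measurable_fun setT (fun pw : (R * 'rV[R]_k) * W => u pw.1 pw.2).
Proof.
move=> mu cu.
pose c (N : nat) (p : R * 'rV[R]_k) : int * 'rV[int]_k :=
  (Num.floor (N.+1%:R * p.1), \row_i Num.floor (N.+1%:R * p.2 0 i)).
pose g (N : nat) (x : int * 'rV[int]_k) : R * 'rV[R]_k :=
  (grid N x.1, \row_i grid N (x.2 0 i)).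
apply: (@measurable_fun_cvg _ _ _ setT
  (fun N (pw : (R * 'rV[R]_k) * W) => u (g N (c N pw.1)) pw.2)).
  move=> N; apply: (@measurable_countable_comp _ _ _ _ _ (c N) (fun x => u (g N x))).
    move=> [a b].
    rewrite (_ : _ @^-1` _ =
      (fun p : R * 'rV[R]_k => N.+1%:R * p.1) @^-1` [set t | Num.floor t = a] `&`
      \bigcap_(i in [set: 'I_k]) ((fun p : R * 'rV[R]_k => N.+1%:R * p.2 0 i) @^-1`
        [set t | Num.floor t = b 0 i])).
      apply: measurableI.
        rewrite -[X in measurable X]setTI.
        have h : measurable_fun setT (fun p : R * 'rV[R]_k => N.+1%:R * p.1).
          by apply: measurable_funM => //; exact: measurable_fst.
        exact: (h measurableT _ (measurable_floor_eq a)).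
      apply: fin_bigcap_measurable => // i _; rewrite -[X in measurable X]setTI.
      have h : measurable_fun setT (fun p : R * 'rV[R]_k => N.+1%:R * p.2 0 i).
        apply: measurable_funM => //.
        exact: measurableT_comp (measurable_coord i) measurable_snd.
      exact: (h measurableT _ (measurable_floor_eq (b 0 i))).
    apply/seteqP; split=> [p [/= <- <-]|p [/= <- h]].
      by split => //= i _ /=; rewrite mxE.
    by rewrite /c; congr pair; apply/rowP => i; rewrite mxE; exact: h.
  by move=> x; exact: mu.
move=> [p w] _.
suff hg : g N (c N p) @[N --> \oo] --> p by exact: (@cvg_comp _ _ _ (fun N => g N (c N p)) (fun q => u q w) _ _ _ hg (cu w p)).
have small (e : R) : 0 < e -> \forall N \near \oo, N.+1%:R^-1 < e.
  move=> e0; near=> N; rewrite -[e]invrK ltf_pV2 ?posrE ?invr_gt0//.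
  apply: (lt_le_trans (truncnS_gt _)); rewrite ler_nat ltnS.
  by near: N; exact: nbhs_infty_ge.
apply/cvg_ballP => e e0; near=> N; split => [/=|].
  rewrite /ball/= (lt_trans (grid_floor N _))//.
  by near: N; exact: small.
split => // i j; rewrite (ord1 i) !mxE /ball/= (lt_trans (grid_floor N _))//.
by near: N; exact: small.
Unshelve. all: by end_near. Qed.

Lemma continuous_within_comp (X Y Z : topologicalType) (D : set Y) (f : Y -> Z)
    (g : X -> Y) : {within D, continuous f} -> continuous g ->
  (forall x, D (g x)) -> continuous (f \o g).
Proof.
move=> /subspace_continuousP cf cg gD x.
apply: (@cvg_trans _ (f @ within D (nbhs (g x)))); last exact: cf.
move=> B hB; have hB' : nbhs (g x) [set y | D y -> B (f y)] by exact: hB.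
have := cg x _ hB'; rewrite /= => h.
suff : nbhs x [set y | B (f (g y))] by [].
by apply: (@filterS _ (nbhs x) _ _ _ _ h) => y /= hy; exact: hy (gD y).
Qed.

(** The sum of the distances between the coordinates is continuous, and its image of the
    compact [S `*` K] is closed and avoids [0]. *)
Lemma compact_far (X Y : topologicalType) (n : nat) (S : set X) (K : set Y)
    (V : 'I_n -> X -> R) (z : 'I_n -> Y -> R) : (0 < n)%N ->
  compact S -> compact K -> (forall i, continuous (V i)) ->
  (forall i, continuous (z i)) ->
  (forall p y, S p -> K y -> exists i, V i p != z i y) ->
  exists2 eta, 0 < eta & forall p y, S p -> K y ->
    exists i, eta <= `|V i p - z i y|.
Proof.
move=> n0 cS cK cV cz hn.
pose g (x : X * Y) : R := \sum_i `|V i x.1 - z i x.2|.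
have cg : continuous g.
  move=> x; rewrite /g; apply: (@cvg_big R _ +%R 0 xpredT) => [|i _]; first exact: add_continuous.
  apply: cvg_norm; apply: cvgB.
    by apply: continuous_comp; [exact: cvg_fst|exact: cV].
  by apply: continuous_comp; [exact: cvg_snd|exact: cz].
have cI : closed (g @` (S `*` K)).
  apply: compact_closed; first exact: Rhausdorff.
  apply: continuous_compact; last exact: compact_setX.
  exact: continuous_subspaceT.
have g0 : (~` (g @` (S `*` K))) 0.
  move=> [[p y] [/= Sp Ky] /eqP]; rewrite psumr_eq0// => /allP h.
  have [i /negP] := hn p y Sp Ky; apply; rewrite -subr_eq0 -normr_eq0.
  by have := h i (mem_index_enum i).
have /nbhs_ballP[e /= e0 he] := open_nbhs_nbhs (conj (closed_openC cI) g0).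
exists (e / n%:R); first by rewrite divr_gt0// ltr0n.
move=> p y Sp Ky; apply: contrapT => /forallNP hi.
apply: (he (g (p, y))); last by exists (p, y).
have gp : 0 <= g (p, y) by apply: sumr_ge0.
rewrite /ball/= sub0r normrN ger0_norm//.
apply: (@lt_le_trans _ _ (\sum_(i < n) (e / n%:R))); last first.
  by rewrite sumr_const card_ord -[X in X <= _]mulr_natr divfK// pnatr_eq0 -lt0n.
apply: ltr_sum => [|i _]; first by apply/hasP; exists (Ordinal n0) => //; exact: mem_index_enum.
by rewrite ltNge; apply/negP; exact: hi.
Qed.

End joint_measurability.

(** * Trigonometric moments of a Gaussian field *)

Section gaussian_moments.
Context {R : realType}.
Notation mu := (@lebesgue_measure R).

Let normal_prob_scale (s : R) (f : R -> R) : 0 < s -> continuous f ->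
  (forall x, 0 <= f x) ->
  (\int[normal_prob 0 s]_x (f x)%:E = \int[normal_prob 0 1]_x (f (s * x))%:E)%E.
Proof.
move=> s0 cf f0; have sn0 : s != 0 by rewrite gt_eqF.
have mf : measurable_fun setT f by exact: continuous_measurable_fun.
have csx : continuous (fun x : R => s * x) by exact: mulrl_continuous.
have mfs : measurable_fun setT (fun x => f (s * x)).
  by apply: measurableT_comp => //; exact: continuous_measurable_fun.
rewrite !ge0_integral_normal_prob; last 4 first.
- by move=> x; rewrite lee_fin.
- exact/measurable_EFinP.
- by move=> x; rewrite lee_fin.
- exact/measurable_EFinP.
have dF (x : R) : is_derive x 1 (fun x : R => s * x) s.
  by apply: is_derive_eq; rewrite /GRing.scale/= mulr1.
have dFE : derive1 (fun x : R => s * x) = fun=> s.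
  by apply/funext => x; rewrite derive1E; exact: derive_val.
have := @increasing_ge0_integration_by_substitutionT R (fun x => s * x)
  (fun x => f x * normal_pdf 0 s x).
rewrite dFE => h; under eq_integral do rewrite -EFinM.
rewrite {}h.
- apply: eq_integral => x _; rewrite -EFinM; congr EFin.
  rewrite -[LHS]mulrA; congr (_ * _).
  have pdfE (a y : R) : a != 0 -> normal_pdf 0 a y = normal_peak a * normal_fun 0 a y.
    by move=> a0; rewrite normal_pdfE.
  rewrite !pdfE ?oner_neq0// /normal_fun !subr0 /normal_peak.
  have -> : s ^+ 2 * pi *+ 2 = s ^+ 2 * (1 ^+ 2 * pi *+ 2) by rewrite expr1n mul1r mulrnAr.
  rewrite sqrtrM ?sqr_ge0// sqrtr_sqr (gtr0_norm s0).
  have -> : - (s * x) ^+ 2 / (s ^+ 2 *+ 2) = - x ^+ 2 / (1 ^+ 2 *+ 2).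
    by rewrite expr1n -[s ^+ 2 *+ 2]mulr_natr; field.
  by rewrite invfM mulrC !mulrA divff// mul1r.
- by move=> x y; rewrite ltr_pM2l.
- exact: cst_continuous.
- exact: is_cvg_cst.
- exact: is_cvg_cst.
- by move=> x; exact: ex_derive.
- by apply: gt0_cvgMrNy => //; exact: cvg_id.
- by apply: gt0_cvgMry => //; exact: cvg_id.
- by move=> x; apply: cvgM; [exact: cf|exact: continuous_normal_pdf].
- by move=> x; rewrite mulr_ge0// normal_pdf_ge0.
Qed.

Context d (W : measurableType d) (P : probability W R).

Let centered_normalE (X : W -> R) : centered_normal P X ->
  exists2 s : R, 0 <= s & forall f : R -> R, continuous f -> (forall x, 0 <= f x) ->
  (\int[P]_w (f (X w))%:E = \int[normal_prob 0 1]_x (f (s * x))%:E)%E.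
Proof.
move=> [mX [s s0 Xs]]; exists s => // f cf f0.
have mf : measurable_fun setT f by exact: continuous_measurable_fun.
have mX' : measurable_fun setT (X : W -> measurableTypeR R) by exact: mX.
pose Xp : {mfun W >-> measurableTypeR R} :=
  HB.pack X (isMeasurableFun.Build _ _ _ _ _ mX').
have := @ge0_integral_pushforward _ _ W (measurableTypeR R) R X mX' P setT (EFin \o f) measurableT.
rewrite preimage_setT => /= <-; last 2 first.
- exact/measurable_EFinP.
- by move=> x _; rewrite lee_fin.
have [sE|sn0] := eqVneq s 0.
  transitivity (\int[\d_(0%R : measurableTypeR R)]_y (f y)%:E)%E.
    apply: (@eq_measure_integral _ (measurableTypeR R) R setT
      (\d_(0 : measurableTypeR R)) (pushforward P Xp)).
    by move=> A mA _; have := Xs A mA; rewrite sE eqxx.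
  rewrite integral_dirac//; last exact/measurable_EFinP.
  rewrite diracT mul1e (eq_integral (cst (f 0)%:E)); last first.
    by move=> x _; rewrite sE mul0r.
  by rewrite integral_cst// [X in (_ * X)%E](_ : _ = 1%E) ?mule1//; exact: probability_setT.
transitivity (\int[normal_prob 0 s]_y (f y)%:E)%E.
  apply: (@eq_measure_integral _ (measurableTypeR R) R setT
    (normal_prob 0 s) (pushforward P Xp)).
  by move=> A mA _; have := Xs A mA; rewrite (negbTE sn0).
by apply: normal_prob_scale => //; rewrite lt_neqAle eq_sym sn0.
Qed.

(** The law of [X] is that of [s G] with [G] standard normal, and [v = s^2]. *)
Lemma centered_normal_moments (X : W -> R) : centered_normal P X ->
  exists v : R, (\int[P]_w (X w ^+ 2)%:E = v%:E)%E /\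
  forall c : R, (\int[P]_w (cos (X w + c))%:E = (cos c * expR (- v / 2))%:E)%E.
Proof.
move=> cX; have [s s0 Xs] := centered_normalE cX; have mX := cX.1.
exists (s ^+ 2); split.
  rewrite (Xs (fun x => x ^+ 2)); last 2 first.
  - exact: exprn_continuous.
  - by move=> x; exact: sqr_ge0.
  under eq_integral do rewrite exprMn EFinM.
  rewrite ge0_integralZl//; last 3 first.
  - by apply/measurable_EFinP; exact: measurable_funX.
  - by move=> x _; rewrite lee_fin sqr_ge0.
  - by rewrite lee_fin sqr_ge0.
  by rewrite integral_normal_sqr mule1.
(* The constant [1] makes the integrand nonnegative, as the change of variables
   requires. *)
move=> c; have ccos : continuous (fun x : R => 1 + cos (x + c)).
  move=> x; apply: cvgD; first exact: cvg_cst.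
  apply: continuous_comp; last exact: continuous_cos.
  by apply: cvgD; [exact: cvg_id|exact: cvg_cst].
have cos0 (x : R) : 0 <= 1 + cos (x + c) by have := cos_geN1 (x + c); lra.
have split_cos d' (T : measurableType d') (Q : probability T R) (Y : T -> R) :
    measurable_fun setT Y ->
    (\int[Q]_t (1 + cos (Y t + c))%:E = 1 + \int[Q]_t (cos (Y t + c))%:E)%E.
  move=> mY; have mc : measurable_fun setT (fun t => cos (Y t + c)).
    by apply: measurableT_comp measurable_cos _; exact: measurable_funD.
  rewrite (_ : (fun t => _) = (fun t => (cst 1 t : \bar R) + (cos (Y t + c))%:E)%E)//.
  rewrite integralD//; last 2 first.
  - exact: finite_measure_integrable_cst.
  - by apply: (@bounded_integrable _ _ _ _ _ 1) => // t; rewrite ler_norml cos_geN1 cos_le1.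
  by rewrite integral_cst// [X in (1 * X)%E](_ : _ = 1%E) ?mule1//; exact: probability_setT.
have := Xs _ ccos cos0.
rewrite split_cos// split_cos; last by exact: measurable_funM.
rewrite integral_normal_cos => /(congr1 (fun x => x - 1)%E).
by rewrite !(addeC 1%E) !addeK.
Qed.

End gaussian_moments.

(** * The solution and its decorrelation *)

Lemma wave_covC (R : realType) (k : nat) (beta : R) (p q : R * 'rV[R]_k) :
  wave_cov beta p q = wave_cov beta q p.
Proof.
rewrite /wave_cov minC; apply: eq_Rintegral => r _; apply: eq_Rintegral => xi _.
rewrite [sin ((q.1 - r) * _) * _]mulrC; congr (_ * _ * _).
rewrite -cosN; congr cos; rewrite /edot -sumrN; apply: eq_bigr => i _.
by rewrite !mxE -mulrN opprB.
Qed.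

Section quadratic_forms.
Context {R : realType} d (W : measurableType d) (P : probability W R).

Let integrable_mul (X Y : W -> R) (a b : R) :
  measurable_fun setT X -> measurable_fun setT Y ->
  (\int[P]_w (X w ^+ 2)%:E = a%:E)%E -> (\int[P]_w (Y w ^+ 2)%:E = b%:E)%E ->
  P.-integrable setT (fun w => (X w * Y w)%:E).
Proof.
move=> mX mY Xa Yb.
have isq (Z : W -> R) (c : R) : measurable_fun setT Z ->
    (\int[P]_w (Z w ^+ 2)%:E = c%:E)%E -> P.-integrable setT (fun w => (Z w ^+ 2)%:E).
  move=> mZ Zc; apply/integrableP; split.
    by apply/measurable_EFinP; exact: measurable_funX.
  under eq_integral do rewrite abse_EFin ger0_norm ?sqr_ge0//.
  by rewrite Zc ltry.
apply: (le_integrable _ _ _ (integrableD _ (isq _ _ mX Xa) (isq _ _ mY Yb))) => //.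
  by apply/measurable_EFinP; exact: measurable_funM.
move=> w _; rewrite -EFinD !abse_EFin lee_fin normrM.
rewrite [leRHS]ger0_norm ?addr_ge0 ?sqr_ge0//.
rewrite -(real_normK (num_real (X w))) -(real_normK (num_real (Y w))).
have := sqr_ge0 (`|X w| - `|Y w|); have := sqr_ge0 `|X w|; have := sqr_ge0 `|Y w|.
by rewrite !expr2; lra.
Qed.

Lemma integral_sqr_lincomb (K : finType) (X : K -> W -> R) (x : K -> R)
    (c : K -> K -> R) :
  (forall i, measurable_fun setT (X i)) ->
  (forall i j, (\int[P]_w (X i w * X j w)%:E = (c i j)%:E)%E) ->
  (\int[P]_w ((\sum_i x i * X i w) ^+ 2)%:E =
   (\sum_i \sum_j x i * x j * c i j)%:E)%E.
Proof.
move=> mX Xc.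
have iX i j : P.-integrable setT (fun w => (X i w * X j w)%:E).
  apply: (@integrable_mul _ _ (c i i) (c j j)) => //.
  - by under eq_integral do rewrite expr2; exact: Xc.
  - by under eq_integral do rewrite expr2; exact: Xc.
have ixX i j : P.-integrable setT (fun w => (x i * x j)%:E * (X i w * X j w)%:E)%E.
  exact: integrableZl.
transitivity (\int[P]_w (\sum_i \sum_j ((x i * x j)%:E * (X i w * X j w)%:E)))%E.
  apply: eq_integral => w _; rewrite expr2 big_distrl/= -sumEFin.
  apply: eq_bigr => i _; rewrite big_distrr/= -sumEFin.
  by apply: eq_bigr => j _; rewrite -EFinM; congr EFin; ring.
rewrite integral_sum//; last by move=> i; exact: integrable_sum.
rewrite -sumEFin; apply: eq_bigr => i _.
rewrite integral_sum// -sumEFin; apply: eq_bigr => j _.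
by rewrite integralZl// Xc -EFinM.
Qed.

End quadratic_forms.

Section solution.
Context {R : realType} (k d : nat) (beta T : R) (sigma : 'M[R]_d).
Hypotheses (T0 : 0 <= T) (sigma_inv : sigma \in unitmx).
Context (disp : measure_display) (W : measurableType disp) (P : probability W R).
Variable u : R * 'rV[R]_k -> W -> 'rV[R]_d.
Hypothesis solu : wave_solution beta T sigma P u.

Definition clamp_time (p : R * 'rV[R]_k) : R * 'rV[R]_k :=
  (Num.max 0 (Num.min p.1 T), p.2).

Let clamp_in p : (`[0, T] `*` setT) (clamp_time p).
Proof.
split => //=; rewrite in_itv/= le_max lexx/= ge_max T0/=.
by rewrite ge_min lexx orbT.
Qed.

Lemma clamp_time_id (p : R * 'rV[R]_k) : 0 <= p.1 <= T -> clamp_time p = p.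
Proof.
by case: p => t x /= /andP[t0 tT]; rewrite /clamp_time/= min_l// max_r.
Qed.

(** Multiplication by the inverse of [sigma] makes the components independent and
    identically distributed; the clamping extends them continuously to all times. *)
Definition decorrelated (i : 'I_d) (p : R * 'rV[R]_k) (w : W) : R :=
  (u (clamp_time p) w *m (invmx sigma)^T) 0 i.

Lemma decorrelated_solution (p : R * 'rV[R]_k) w y : 0 <= p.1 <= T ->
  (forall i, decorrelated i p w = (y *m (invmx sigma)^T) 0 i) -> u p w = y.
Proof.
move=> pT h; have : u p w *m (invmx sigma)^T = y *m (invmx sigma)^T.
  by apply/rowP => i; rewrite -h /decorrelated clamp_time_id.
move=> /(congr1 (fun v => v *m sigma^T)).
by rewrite -!mulmxA -trmx_mul mulmxV// trmx1 !mulmx1.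
Qed.

Let measurable_component p j : (`[0, T] `*` setT) p ->
  measurable_fun setT (fun w => u p w 0 j).
Proof.
move=> Dp; have [gf _ _] := solu.
have [+ _] := gf 1%N (fun=> p) (fun=> delta_mx 0 j) (fun=> Dp).
congr (measurable_fun _ _); apply/funext => w.
rewrite big_ord1 /edot (bigD1 j)//= mxE !eqxx mul1r big1 ?addr0// => i ij.
by rewrite mxE (negbTE ij) andbF mul0r.
Qed.

Lemma measurable_decorrelated i p : measurable_fun setT (decorrelated i p).
Proof.
rewrite /decorrelated; under eq_fun do rewrite mxE.
apply: measurable_sum => j; apply: measurable_funM => //.
exact: measurable_component (clamp_in p).
Qed.

Lemma continuous_decorrelated i w : continuous (fun p => decorrelated i p w).
Proof.
have [_ _ cu] := solu.
have cc : continuous clamp_time.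
  move=> p.
  have h1 : Num.max 0 (Num.min q.1 T) @[q --> p] --> Num.max 0 (Num.min p.1 T).
    apply: (@continuous_comp _ _ _ (@fst R 'rV[R]_k) (fun t : R => Num.max 0 (Num.min t T))).
      exact: cvg_fst.
    apply: continuous_max; first exact: cvg_cst.
    by apply: continuous_min; [exact: cvg_id|exact: cvg_cst].
  have h2 : q.2 @[q --> p] --> p.2 by exact: cvg_snd.
  exact: (cvg_pair h1 h2).
have cuc := continuous_within_comp (cu w) cc clamp_in.
have E : (fun p => decorrelated i p w) =
    (fun p => \sum_j u (clamp_time p) w 0 j * (invmx sigma)^T j i).
  by apply/funext => p; rewrite /decorrelated mxE.
rewrite E => p; apply: (@cvg_big R _ +%R 0 xpredT) => [|j _]; first exact: add_continuous.
apply: cvgM; last exact: cvg_cst.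
apply: (@continuous_comp _ _ _ (fun p => u (clamp_time p) w) (fun v : 'rV[R]_d => v 0 j)).
  exact: cuc.
exact: coord_continuous.
Qed.

(** In the variance of the linear combination, the factor [sigma sigma^T] of the
    covariance cancels the inverses of [sigma] that decorrelate. *)
Lemma decorrelated_cos (p q : R * 'rV[R]_k) (a b : 'I_d -> R) (c : R) :
  0 <= p.1 <= T -> 0 <= q.1 <= T ->
  (\int[P]_w (cos (\sum_i (a i * decorrelated i p w + b i * decorrelated i q w) + c))%:E =
   (cos c * \prod_i expR (- (a i ^+ 2 * wave_cov beta p p +
      2 * a i * b i * wave_cov beta p q + b i ^+ 2 * wave_cov beta q q) / 2))%:E)%E.
Proof.
move=> pT qT; have [gf cov _] := solu.
have Dp : (`[0, T] `*` setT) p by split => //=; rewrite in_itv.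
have Dq : (`[0, T] `*` setT) q by split => //=; rewrite in_itv.
pose pt (s : 'I_2) := if s == 0 then p else q.
have Dpt s : (`[0, T] `*` setT) (pt s) by rewrite /pt; case: ifP.
pose r (s : 'I_2) : 'rV[R]_d := if s == 0 then \row_i a i else \row_i b i.
pose A s := r s *m invmx sigma.
have XE w : \sum_i (a i * decorrelated i p w + b i * decorrelated i q w) =
    \sum_s edot (A s) (u (pt s) w).
  have edotE (x v : 'rV[R]_d) : edot (x *m invmx sigma) v =
      \sum_i x 0 i * (v *m (invmx sigma)^T) 0 i.
    transitivity ((x *m invmx sigma *m v^T) 0 0).
      by rewrite mxE; apply: eq_bigr => i _; rewrite [v^T _ _]mxE.
    rewrite -mulmxA mxE; apply: eq_bigr => i _; congr (_ * _).
    by rewrite -[in RHS](trmxK v) -trmx_mul [RHS]mxE.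
  rewrite big_ord_recl big_ord1 /A /pt /r/= !edotE -big_split/=.
  by apply: eq_bigr => i _; rewrite !mxE /decorrelated !clamp_time_id// !mxE.
have [v [Xv charX]] := centered_normal_moments (gf 2%N pt A Dpt).
under eq_integral do rewrite XE.
rewrite charX -expR_sum; congr (_ * expR _)%:E.
rewrite -mulr_suml sumrN; congr (- _ / 2).
apply: EFin_inj; rewrite -Xv.
pose x (l : 'I_2 * 'I_d) := A l.1 0 l.2.
pose X (l : 'I_2 * 'I_d) w := u (pt l.1) w 0 l.2.
transitivity (\int[P]_w ((\sum_l x l * X l w) ^+ 2)%:E)%E.
  apply: eq_integral => w _; congr (_ ^+ 2)%:E.
  by rewrite /edot pair_big.
rewrite (@integral_sqr_lincomb _ _ _ _ _ X x (fun l l' =>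
  (sigma *m sigma^T) l.2 l'.2 * wave_cov beta (pt l.1) (pt l'.1))); last 2 first.
- by move=> l; exact: measurable_component.
- by move=> l l'; have := cov (pt l.1) (pt l'.1) l.2 l'.2 (Dpt _) (Dpt _); rewrite unlock.
congr EFin.
transitivity (\sum_s \sum_s' wave_cov beta (pt s) (pt s') * (\sum_i r s 0 i * r s' 0 i)).
  rewrite -(pair_big xpredT xpredT (fun s j => \sum_l' x (s, j) * x l' *
    ((sigma *m sigma^T) j l'.2 * wave_cov beta (pt s) (pt l'.1))))/=.
  apply: eq_bigr => s _.
  transitivity (\sum_j \sum_s' \sum_j' A s 0 j * A s' 0 j' *
      ((sigma *m sigma^T) j j' * wave_cov beta (pt s) (pt s'))).
    by apply: eq_bigr => j _; rewrite pair_big/=.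
  rewrite exchange_big/=; apply: eq_bigr => s' _.
  have -> : \sum_i r s 0 i * r s' 0 i = (A s *m (sigma *m sigma^T) *m (A s')^T) 0 0.
    rewrite /A -!mulmxA -trmx_mul -!mulmxA mulVmx// mulmx1 !mulmxA.
    rewrite -[r s *m _ *m _]mulmxA mulVmx// mulmx1.
    by rewrite mxE; apply: eq_bigr => i _; rewrite [_^T _ _]mxE.
  rewrite mxE mulr_sumr exchange_big/=; apply: eq_bigr => j' _.
  rewrite [(A s *m _) 0 j']mxE [(A s')^T _ _]mxE mulr_suml mulr_sumr.
  by apply: eq_bigr => j _; ring.
rewrite !big_ord_recl !big_ord0 !addr0 /pt /r/= [wave_cov beta q p]wave_covC.
move: (wave_cov beta p p) (wave_cov beta p q) (wave_cov beta q q) => Cpp Cpq Cqq.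
rewrite !mulr_sumr -!big_split/=; apply: eq_bigr => i _.
by rewrite !mxE; ring.
Qed.

End solution.

(** * Bounds on the covariance *)

Section covariance_bounds.
Context {R : realType} (k : nat) (beta : R).
Hypotheses (k1 : (1 <= k)%N) (beta0 : 0 < beta) (beta2 : beta < 2)
  (betak : beta < k%:R).

Definition sup_dist (p q : R * 'rV[R]_k) : R := Num.max `|p.1 - q.1| `|p.2 - q.2|.

Lemma sup_dist_ge0 p q : 0 <= sup_dist p q.
Proof. by rewrite le_max normr_ge0. Qed.

(** The conditional variance is the variance of [V q - (B / A) V p], with [A] the
    variance of [V p] and [B] its covariance with [V q], so that nondeterminism
    applies to it. *)
Lemma wave_cov_bounds (t0 T D : R) : 0 < t0 -> 0 < D ->
  exists c0 c1 c2 K : R, [/\ 0 < c0, 0 < c1, 0 <= c2, 0 <= K &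
  forall p q : R * 'rV[R]_k, t0 <= p.1 <= T -> t0 <= q.1 <= T ->
    sup_dist p q <= D ->
    [/\ c1 <= wave_cov beta p p, `|wave_cov beta p q| <= c2,
      `|wave_cov beta p p - wave_cov beta p q| <= K * sup_dist p q `^ ((2 - beta) / 2)
      & c0 * sup_dist p q `^ (2 * ((2 - beta) / 2)) <=
        wave_cov beta q q - wave_cov beta p q ^+ 2 / wave_cov beta p p]].
Proof.
move=> t00 D0.
have [c c_gt0 hc] := wave_cov_nondeterminism k1 beta0 beta2 betak t00 D0.
(* The bounds on the spectral integrals assume a horizon of at least [1]. *)
pose T1 := Num.max 1 T.
have T11 : 1 <= T1 by rewrite le_max lexx.
pose M := `|\int[(lebesgue_measure \x lebesgue_rV R k)%E]_z dominator beta T1 z|.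
have MI : \int[(lebesgue_measure \x lebesgue_rV R k)%E]_z dominator beta T1 z <= M by exact: ler_norm.
have M0 : 0 <= M by exact: normr_ge0.
have T10 : 0 <= T1 by rewrite (le_trans _ T11).
exists c, (c * D `^ (2 - beta)), (2 * T1 * T1 * M), (4 * k%:R * T1 * M); split => //.
- by rewrite mulr_gt0// powR_gt0.
- by rewrite !mulr_ge0.
- by rewrite !mulr_ge0.
move=> p q /andP[tp pT] /andP[tq qT] pqD.
have pT1 : p.1 <= T1 by rewrite le_max pT orbT.
have qT1 : q.1 <= T1 by rewrite le_max qT orbT.
have cA : c * D `^ (2 - beta) <= wave_cov beta p p.
  (* The second point, at distance [D], has coefficient [0]. *)
  have := hc p (p.1 + D, p.2) 1 0 tp; rewrite /= subrr normr0.
  rewrite opprD addrA subrr sub0r normrN (gtr0_norm D0) max_l ?(ltW D0)//.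
  rewrite !expr1n expr0n/= addr0 !mulr1 !mulr0 !mul0r subr0 addr0 mul1r; apply => //.
  by rewrite (le_trans tp)// lerDl ltW.
have A0 : 0 < wave_cov beta p p.
  by rewrite (lt_le_trans _ cA)// mulr_gt0// powR_gt0.
split => //.
- apply: (le_trans (wave_cov_le k1 beta0 beta2 betak pT1 qT1 T11)).
  by rewrite ler_wpM2l// !mulr_ge0.
- apply: (le_trans (wave_cov_diff_le k1 beta0 beta2 betak pT1 qT1 T11)).
  rewrite -/(sup_dist p q).
  have -> : 4 * k%:R * T1 * M * sup_dist p q `^ ((2 - beta) / 2) =
    4 * k%:R * sup_dist p q `^ ((2 - beta) / 2) * T1 * M by ring.
  by rewrite ler_wpM2l// !mulr_ge0 ?powR_ge0.
- set A := wave_cov beta p p in A0 *; set B := wave_cov beta p q.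
  set C := wave_cov beta q q.
  have := hc p q (B / A) 1 tp tq pqD; rewrite -/(sup_dist p q) -/A -/B -/C.
  have -> : 2 * ((2 - beta) / 2) = 2 - beta by field.
  have -> : (B / A) ^+ 2 * A - 2 * (B / A) * 1 * B + 1 ^+ 2 * C = C - B ^+ 2 / A.
    by field; rewrite gt_eqF.
  apply: le_trans; rewrite -mulrA ler_wpM2l ?(ltW c_gt0)//.
  by rewrite expr1n -[leLHS]mul1r ler_wpM2r ?powR_ge0// lerDr sqr_ge0.
Qed.

End covariance_bounds.

(** * Energy and capacity *)

Section riesz_kernel.
Context {R : realType}.

Lemma riesz_kernel_ge0 (c gamma r : R) : 0 <= r < c -> (0 <= riesz_kernel c gamma r)%E.
Proof.
move=> /andP[r0 rc]; rewrite /riesz_kernel; case: ifP => // _; case: eqP => // /eqP rn0.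
have {rn0}r0' : 0 < r by rewrite lt_neqAle eq_sym rn0.
case: ifP => _; rewrite lee_fin ?powR_ge0//.
by rewrite ln_ge0// ler_pdivlMr// mul1r ltW.
Qed.

Lemma measurable_riesz_kernel d (T : measurableType d) (f : T -> R) (c gamma : R) :
  measurable_fun setT f -> (forall x, 0 <= f x) ->
  measurable_fun setT (fun x => riesz_kernel c gamma (f x)).
Proof.
move=> mf f0; have [g0|g0] := boolP (gamma < 0).
  rewrite (_ : (fun x => _) = cst 1%E) //.
  by apply/funext => x; rewrite /riesz_kernel g0.
rewrite (_ : (fun x => _) = (fun x => if f x == 0 then +oo%E else
    (if gamma == 0 then ln (c * f x `^ (-1)) else f x `^ (- gamma))%:E)).
  apply: measurable_fun_ifT => //.
    apply: (measurable_fun_bool true).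
    rewrite (_ : _ @^-1` _ = f @^-1` [set 0]).
      exact: (mf measurableT _ (measurable_set1 (0 : R))).
    by apply/seteqP; split=> x /= /eqP.
  have mp x : measurable_fun setT (fun t => f t `^ x).
    exact: (measurableT_comp (measurable_powR x)).
  apply/measurable_EFinP; case: (gamma == 0) => //.
  by apply: measurableT_comp; [exact: measurable_ln|exact: measurable_funM].
apply/funext => x; rewrite /riesz_kernel (negbTE g0); case: ifP => //.
by case: ifP => //; rewrite powR_inv1.
Qed.

(** In the hypothesis, [x] is the mass that a compact subset of [A] retains. As [x] tends
    to [1] and [b] to the energy, every energy is seen to be at least [c / p]. *)
Lemma capacity_le (d : nat) (cstar gamma c : R) (A : set 'rV[R]_d) (p : \bar R) :
  0 < c -> (0 <= p <= 1)%E ->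
  (forall (m : probability 'rV[R]_d R) (b x : R), m A = 1%E -> 0 < b -> 0 < x < 1 ->
    (energy cstar gamma A m <= b%:E)%E -> ((c * x ^+ 2 / b)%:E <= p)%E) ->
  (forall m : probability 'rV[R]_d R, m A = 1%E -> 0 <= energy cstar gamma A m)%E ->
  (c%:E * capacity cstar gamma A <= p)%E.
Proof.
move=> c0 /andP[p0 p1] hp E0.
have [r rE] : exists r, p = r%:E.
  by case: p p0 p1 {hp} => [r _ _|//|//]; exists r.
move: p0 p1 hp; rewrite {}rE !lee_fin => r0 r1 hp.
have hp1 (m : probability 'rV[R]_d R) (b : R) : m A = 1%E -> 0 < b ->
    (energy cstar gamma A m <= b%:E)%E -> c <= r * b.
  move=> mA b0 Eb; rewrite leNgt; apply/negP => rb.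
  pose g := c - r * b; have g0 : 0 < g by rewrite subr_gt0.
  (* For [x = 1 - y] with this [y], [c * x^2] is still larger than [r * b]. *)
  pose y := Num.min 2^-1 (g / (4 * c)).
  have y0 : 0 < y by rewrite lt_min invr_gt0 ltr0n/= divr_gt0// mulr_gt0.
  have y1 : y <= 2^-1 by rewrite ge_min lexx.
  have yg : y * (4 * c) <= g by rewrite -ler_pdivlMr ?mulr_gt0// ge_min lexx orbT.
  have x01 : 0 < 1 - y < 1.
    by rewrite subr_gt0 gtrBl y0 andbT (le_lt_trans y1)// invf_lt1 ?ltr1n.
  have := hp m b (1 - y) mA b0 x01 Eb; rewrite lee_fin ler_pdivrMr//.
  have := sqr_ge0 y; rewrite /g in yg g0 *; rewrite !expr2.
  by move: (r * b) (y * y) yg g0 => rb' yy; nra.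
rewrite /capacity; set i := ereal_inf _.
have [r_eq0|rn0] := eqVneq r 0.
  suff iy : i = +oo%E by rewrite iy invey mule0 lee_fin.
  apply/eqP; rewrite -leye_eq; apply: le_ereal_inf_tmp => _ [m mA <-].
  have := E0 m mA; have := @hp1 m _ mA.
  case: (energy cstar gamma A m) => [e|//|//] h _.
  have := h (Num.max e 1); rewrite r_eq0 mul0r lt_max ltr01 orbT lee_fin le_max lexx.
  by move=> /(_ isT isT); rewrite leNgt c0.
have {rn0}r0 : 0 < r by rewrite lt_neqAle eq_sym rn0.
have ci : ((c / r)%:E <= i)%E.
  apply: le_ereal_inf_tmp => _ [m mA <-]; rewrite leNgt; apply/negP => hlt.
  have := E0 m mA; have := @hp1 m _ mA; move: hlt.
  case: (energy cstar gamma A m) => [e|//|//]; rewrite lte_fin => ec h _.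
  (* A positive number between the energy and [c / r]. *)
  pose b := (Num.max e 0 + c / r) / 2.
  have cr0 : 0 < c / r by rewrite divr_gt0.
  have m0 : 0 <= Num.max e 0 by rewrite le_max lexx orbT.
  have mc : Num.max e 0 < c / r by rewrite gt_max ec.
  have em : e <= Num.max e 0 by rewrite le_max lexx.
  have b0 : 0 < b by rewrite divr_gt0// ltr_wpDl.
  have eb : (e%:E <= b%:E)%E by rewrite lee_fin /b; lra.
  have := h b b0 eb; rewrite leNgt => /negP; apply.
  by rewrite mulrC -ltr_pdivlMr// /b; lra.
have cr0 : 0 < c / r by rewrite divr_gt0.
case: i ci => [s|_|//]; last by rewrite invey mule0 lee_fin ltW.
rewrite lee_fin => cs; have s0 : 0 < s by rewrite (lt_le_trans cr0).
rewrite inver gt_eqF// -EFinM lee_fin ler_pdivrMr// mulrC -ler_pdivrMr//.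
Qed.

End riesz_kernel.

(** * Hitting probabilities over a parameter set *)

Section linear_change.
Context {R : realType} (d : nat).

Lemma enorm_mulmx_le (A : 'M[R]_d) (v : 'rV[R]_d) :
  enorm (v *m A) <= (1 + \sum_i \sum_j `|A i j|) * enorm v.
Proof.
apply: (le_trans (enorm_le_sum _)).
apply: (@le_trans _ _ ((\sum_i \sum_j `|A i j|) * enorm v)); last first.
  by rewrite ler_wpM2r ?enorm_ge0// lerDr.
rewrite exchange_big/= mulr_suml; apply: ler_sum => j _.
rewrite mxE mulr_suml (le_trans (ler_norm_sum _ _ _))//.
apply: ler_sum => i _; rewrite normrM mulrC ler_wpM2l//.
exact: coord_le_enorm.
Qed.

Lemma enorm_sub_le (N : R) (v w : 'rV[R]_d) : 0 <= N ->
  (forall i, `|v 0 i| <= N) -> (forall i, `|w 0 i| <= N) ->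
  enorm (v - w) <= 2 * N * Num.sqrt d%:R.
Proof.
move=> N0 vN wN.
have -> : 2 * N * Num.sqrt d%:R = Num.sqrt ((2 * N) ^+ 2 * d%:R).
  by rewrite sqrtrM ?sqr_ge0// sqrtr_sqr ger0_norm// mulr_ge0.
apply: ler_wsqrtr; apply: (@le_trans _ _ (\sum_(i < d) (2 * N) ^+ 2)).
  apply: ler_sum => i _; rewrite !mxE -real_normK ?num_real//.
  rewrite lerXn2r ?nnegrE ?mulr_ge0// (le_trans (ler_normB _ _))//.
  by rewrite mulr_natl mulr2n lerD.
by rewrite sumr_const card_ord mulr_natr.
Qed.

Lemma continuous_mulmx (A : 'M[R]_d) i :
  continuous (fun v : 'rV[R]_d => (v *m A) 0 i).
Proof.
have -> : (fun v : 'rV[R]_d => (v *m A) 0 i) = (fun v => \sum_j v 0 j * A j i).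
  by apply/funext => v; rewrite mxE.
have cj j : continuous (fun v : 'rV[R]_d => v 0 j * A j i).
  by move=> v; apply: continuousM; [exact: coord_continuous|exact: cst_continuous].
have ac : continuous (fun x : R * R => x.1 + x.2) by exact: add_continuous.
move=> v; apply: (@cvg_big R 'I_d +%R 0 xpredT ac _ (nbhs v) (index_enum _)
  (fun j v => v 0 j * A j i)) => j _.
exact: cj.
Qed.

Lemma continuous_measurable_rV (f : 'rV[R]_d -> R) : continuous f ->
  measurable_fun setT f.
Proof.
move=> cf; apply: (measurability _ (measurable_realfun.RGenOpens.measurableE R)).
move=> _ [_ [a [b ->] <-]]; rewrite setTI; apply: open_measurable_rV.
by apply: open_comp => // v _; exact: cf.
Qed.

End linear_change.

Lemma measurable_integral_section (R : realType) d1 (T1 : measurableType d1) d2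
    (T2 : measurableType d2) (m : {sigma_finite_measure set T2 -> \bar R})
    (A : set T2) (h : T1 * T2 -> \bar R) : measurable A ->
  measurable_fun setT h -> (forall x, 0 <= h x)%E ->
  measurable_fun setT (fun y => \int[m]_(y' in A) h (y, y'))%E.
Proof.
move=> mA mh h0.
have -> : (fun y => \int[m]_(y' in A) h (y, y'))%E =
    (fun y => \int[m]_y' ((\1_A y')%:E * h (y, y')))%E.
  apply/funext => y; rewrite integral_mkcond; apply: eq_integral => y' _.
  by rewrite patchE indicE; case: ifP => _; rewrite ?mul1e ?mul0e.
have mg : measurable_fun setT (fun x : T1 * T2 => (\1_A x.2)%:E * h x)%E.
  apply: emeasurable_funM => //; apply/measurable_EFinP.
  by apply: measurableT_comp => //; exact: measurable_indic.
have g0 (x : T1 * T2) : (0 <= (\1_A x.2)%:E * h x)%E by rewrite mule_ge0// lee_fin.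
exact: (@measurable_fun_fubini_tonelli_F _ _ _ _ _ m _ mg g0).
Qed.

Section hitting_estimate.
Context {R : realType} (k d : nat) (beta N cstar : R) (sigma : 'M[R]_d).
Hypotheses (k1 : (1 <= k)%N) (d1 : (1 <= d)%N) (beta0 : 0 < beta)
  (beta2 : beta < 2) (betak : beta < k%:R) (sigma_inv : sigma \in unitmx)
  (N0 : 0 < N) (hcstar : 2 * N * Num.sqrt d%:R < cstar).

Let eta := (2 - beta) / 2.

(** The decorrelated coordinates of a point of the target. *)
Let z (i : 'I_d) (y : 'rV[R]_d) : R := (y *m (invmx sigma)^T) 0 i.

Let M := N * \sum_i \sum_j `|(invmx sigma) i j|.

Let M0 : 0 <= M.
Proof.
rewrite mulr_ge0 ?(ltW N0)// sumr_ge0// => i _; exact: sumr_ge0.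
Qed.

Let z_le i (y : 'rV[R]_d) : (forall j, `|y 0 j| <= N) -> `|z i y| <= M.
Proof.
move=> yN; rewrite /z mxE (le_trans (ler_norm_sum _ _ _))//.
apply: (@le_trans _ _ (N * \sum_j `|invmx sigma i j|)).
  rewrite mulr_sumr; apply: ler_sum => j _.
  by rewrite normrM mxE ler_wpM2r.
rewrite ler_wpM2l ?(ltW N0)// [leRHS](bigD1 i)//= lerDl.
by apply: sumr_ge0 => j _; exact: sumr_ge0.
Qed.

Let L := 1 + \sum_i \sum_j `|sigma^T i j|.

Let L1 : 1 <= L.
Proof. by rewrite lerDl sumr_ge0// => i _; exact: sumr_ge0. Qed.

Let enorm_z (y y' : 'rV[R]_d) : enorm (y - y') <=
  L * Num.sqrt (\sum_i (z i y - z i y') ^+ 2).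
Proof.
have E : y - y' = (y - y') *m (invmx sigma)^T *m sigma^T.
  by rewrite -mulmxA -trmx_mul mulmxV// trmx1 mulmx1.
rewrite {1}E; apply: (le_trans (enorm_mulmx_le _ _)).
rewrite -/L; have -> // : enorm ((y - y') *m (invmx sigma)^T) =
  Num.sqrt (\sum_i (z i y - z i y') ^+ 2).
by congr Num.sqrt; apply: eq_bigr => i _; rewrite /z mulmxBl !mxE.
Qed.

(** Here [phi] embeds the measure space of the parameters into time and space, and [m]
    is the growth exponent of the measure. The constant comes before the process and
    its horizon [T], as it depends only on the numbers that describe the parameter
    set. *)
Lemma hitting_capacity_ge (t0 T1 D C0 s : R) (m : nat) :
  0 < t0 -> 0 < D -> 0 <= C0 -> 0 < s -> (0 < m)%N ->
  exists2 c : R, 0 < c &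
  forall (dE : measure_display) (E : measurableType dE)
    (nu : {sigma_finite_measure set E -> \bar R})
    (phi : E -> R * 'rV[R]_k) (S : set E),
  measurable_fun setT phi -> measurable S -> nu S = s%:E ->
  compact (phi @` S) -> (forall x, S x -> t0 <= (phi x).1 <= T1) ->
  (forall x y, S x -> S y -> sup_dist (phi x) (phi y) <= D) ->
  (forall x r, S x -> 0 < r ->
    (nu [set y | (sup_dist (phi x) (phi y) <= r)%R] <= (C0 * r ^+ m)%:E)%E) ->
  forall T : R, (forall x, S x -> (phi x).1 <= T) ->
  forall (disp : measure_display) (W : measurableType disp)
    (P : probability W R) (u : R * 'rV[R]_k -> W -> 'rV[R]_d),
  wave_solution beta T sigma P u ->
  forall A : set 'rV[R]_d, measurable A ->
  A `<=` [set v : 'rV[R]_d | forall i, `|v 0 i| <= N] ->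
  (c%:E * capacity cstar (d%:R - m%:R / eta) A
     <= inner_prob P (hitting_event u (phi @` S) A))%E.
Proof.
move=> t00 D0 C00 s0 m0.
have eta0 : 0 < eta by rewrite divr_gt0// subr_gt0.
have [c0 [c1 [c2 [K [c00 c10 c20 K0 hcov]]]]] :=
  @wave_cov_bounds R k beta k1 beta0 beta2 betak t0 T1 D t00 D0.
have [C2 C20 hC2] := @two_point_bound R d c0 c1 c2 K eta M d1 c00 c10 c20 K0 M0.
pose rmax := 2 * N * Num.sqrt d%:R.
have rmax0 : 0 < rmax by rewrite !mulr_gt0// sqrtr_gt0 ltr0n.
have [Ck Ck0 hCk] := @kernel_integral_le R eta rmax cstar D C0 d m eta0 rmax0
  hcstar D0 C00 d1 m0.
(* Decorrelation changes the distances in the target by at most the factor [L]. *)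
pose C' := C2 * L ^+ d.
have L0 : 0 < L by rewrite (lt_le_trans _ L1).
have C'0 : 0 < C' by rewrite mulr_gt0// exprn_gt0.
have C2C' : C2 <= C' by rewrite ler_peMr ?(ltW C20)//; exact: exprn_ege1 L1.
(* A lower bound of the mollified one-point density, where the variance is between
   [c1] and [1 + c2] and the coordinates are at most [M]. *)
pose clow := ((Num.sqrt (1 + c2))^-1 * expR (- (M ^+ 2 / (2 * c1)))) ^+ d.
have clow0 : 0 < clow.
  by rewrite exprn_gt0// mulr_gt0 ?expR_gt0// invr_gt0 sqrtr_gt0 ltr_pwDl.
have CC0 : 0 < C' * Ck by rewrite mulr_gt0.
exists (clow ^+ 2 * s / (4 * (C' * Ck))).
  by rewrite divr_gt0 ?mulr_gt0// exprn_gt0.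
move=> dE E nu phi S mphi mS nuS cS St SD Snu T ST disp W P u solu A mA AN.
set ga := d%:R - m%:R / eta.
have S0 : exists x, S x.
  apply: contrapT => hS.
  have SE : S = set0 by apply/seteqP; split => x // Sx; case: hS; exists x.
  by move: nuS; rewrite SE measure0 => -[] /eqP; rewrite lt_eqF.
have T0 : 0 <= T.
  by have [x Sx] := S0; have /andP[tx _] := St x Sx;
    rewrite (le_trans (ltW t00))// (le_trans tx)// ST.
pose V i x w := decorrelated T sigma u i (phi x) w.
have tS x : S x -> 0 <= (phi x).1 <= T.
  by move=> Sx; have /andP[tx _] := St x Sx; rewrite (le_trans (ltW t00) tx)/= ST.
have mVp i x : measurable_fun setT (V i x).
  exact: (measurable_decorrelated T0 solu).
have cV i w : continuous (fun p => decorrelated T sigma u i p w).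
  by apply: continuous_decorrelated; [exact: T0|exact: solu].
have mV i : measurable_fun setT (fun x : E * W => V i x.1 x.2).
  have h := measurable_continuous_process
    (fun p => measurable_decorrelated T0 solu i p)
    (cV i).
  have h2 : measurable_fun setT (fun x : E * W => (phi x.1, x.2)).
    apply: measurable_fun_pair; last exact: measurable_snd.
    exact: measurableT_comp mphi measurable_fst.
  exact: (measurableT_comp h h2).
have mz i : measurable_fun setT (z i).
  by apply: continuous_measurable_rV; exact: continuous_mulmx.
(* The logarithmic kernel is negative at distances larger than [cstar], which do not
   occur in [A]; the second moment bound asks for a kernel that is nonnegative
   everywhere. *)
pose kk (y y' : 'rV[R]_d) : \bar R :=
  ((C' * Ck)%:E * maxe 0%E (riesz_kernel cstar ga (enorm (y - y'))))%E.
have mdiff : measurable_fun setT (fun yy : 'rV[R]_d * 'rV[R]_d => enorm (yy.1 - yy.2)).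
  apply: (measurableT_comp (@measurable_enorm R d)); apply: measurable_rVP => i.
  under eq_fun do rewrite !mxE.
  apply: measurable_funB.
    exact: measurableT_comp (measurable_coord i) measurable_fst.
  exact: measurableT_comp (measurable_coord i) measurable_snd.
have mh : measurable_fun setT (fun yy : 'rV[R]_d * 'rV[R]_d =>
    maxe 0%E (riesz_kernel cstar ga (enorm (yy.1 - yy.2)))).
  apply: measurable_maxe => //; apply: measurable_riesz_kernel => //.
  by move=> x; exact: enorm_ge0.
have mkk : measurable_fun setT (fun yy : 'rV[R]_d * 'rV[R]_d => kk yy.1 yy.2).
  exact: measurable_funeM.
have kk0 y y' : (0 <= kk y y')%E.
  by rewrite mule_ge0 ?lee_fin ?(ltW CC0)// le_max lexx.
have dist_le y y' : A y -> A y' -> 0 <= enorm (y - y') <= rmax.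
  move=> Ay Ay'; rewrite enorm_ge0/=; apply: enorm_sub_le; first exact: ltW.
    exact: AN Ay.
  exact: AN Ay'.
have kernel0 y y' : A y -> A y' ->
    (0 <= riesz_kernel cstar ga (enorm (y - y')))%E.
  move=> Ay Ay'; have /andP[h1 h2] := dist_le y y' Ay Ay'.
  by rewrite riesz_kernel_ge0// h1 (le_lt_trans h2).
have p01 : (0 <= inner_prob P (hitting_event u (phi @` S) A) <= 1)%E.
  apply/andP; split.
    apply: (@le_trans _ _ (P set0)); first by rewrite measure0.
    apply: ereal_sup_ubound; exists set0 => //; split; [exact: measurable0|exact: sub0set].
  by apply: ge_ereal_sup => _ [B [mB _] <-]; exact: probability_le1.
have mollE e p y w : mollifier V z e (p, y) w =
    e^-1 ^+ d * \prod_i gauss ((V i p w - z i y) / e).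
  by rewrite /mollifier big_split/= prodr_const card_ord.
have covb p q : S p -> S q -> _ := fun Sp Sq =>
  hcov (phi p) (phi q) (St p Sp) (St q Sq) (SD p q Sp Sq).
have mg e p y : measurable_fun setT (fun w => \prod_i gauss ((V i p w - z i y) / e)).
  under eq_fun do under eq_bigr do rewrite mulrBl.
  by apply: measurable_prod_gauss => i; exact: measurable_funM.
have one_point e p y : 0 < e <= 1 -> S p -> A y ->
    (clow%:E <= \int[P]_w (mollifier V z e (p, y) w)%:E)%E.
  move=> /andP[e0 e1] Sp Ay.
  have [cA Ac _ _] := covb p p Sp Sp; set a := wave_cov beta _ _ in cA Ac.
  have a0 : 0 < a by rewrite (lt_le_trans c10).
  have {}Ac : a <= c2 by rewrite (le_trans (ler_norm _)).
  under eq_integral do rewrite mollE EFinM.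
  rewrite ge0_integralZl//; last 3 first.
  - exact/measurable_EFinP.
  - by move=> w _; rewrite lee_fin prodr_ge0// => i _; exact: gauss_ge0.
  - by rewrite lee_fin exprn_ge0// invr_ge0 ltW.
  rewrite (@single_gaussE R d _ W P (fun i => V i p) a e (fun i => z i y)) //; last 2 first.
  - move=> al c.
    (* One parameter is a pair with coefficient [0] on its second copy. *)
    have := decorrelated_cos sigma_inv solu al (fun=> 0) c (tS p Sp) (tS p Sp).
    rewrite -/a => h; transitivity ((cos c * \prod_i expR
      (- (al i ^+ 2 * a + 2 * al i * 0 * a + 0 ^+ 2 * a) / 2))%:E).
      rewrite -h; apply: eq_integral => w _; congr (cos (_ + c))%:E.
      by apply: eq_bigr => i _; rewrite mul0r addr0.
    congr (_ * _)%:E; apply: eq_bigr => i _.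
    by rewrite mulr0 mul0r expr0n/= mul0r !addr0.
  - exact: ltW.
  rewrite -EFinM lee_fin /clow.
  have -> : e^-1 ^+ d * \prod_(i < d) (e / Num.sqrt (e ^+ 2 + a) *
      expR (- z i y ^+ 2 / (2 * (e ^+ 2 + a)))) =
    \prod_(i < d) (e^-1 * (e / Num.sqrt (e ^+ 2 + a) *
      expR (- z i y ^+ 2 / (2 * (e ^+ 2 + a))))).
    by rewrite [RHS]big_split/= prodr_const card_ord.
  rewrite -[d in leLHS]card_ord -prodr_const; apply: ler_prod => i _.
  have e2 : 0 < e ^+ 2 by exact: exprn_gt0.
  have e21 : e ^+ 2 <= 1 by rewrite expr_le1// ltW.
  have sa : 0 < e ^+ 2 + a by exact: addr_gt0.
  have sc : 0 < 1 + c2 by rewrite ltr_pwDl.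
  apply/andP; split; first by rewrite mulr_ge0 ?expR_ge0// invr_ge0 sqrtr_ge0.
  rewrite mulrA [e^-1 * _]mulrA mulVf ?gt_eqF// mul1r; apply: ler_pM.
  - by rewrite invr_ge0 sqrtr_ge0.
  - exact: expR_ge0.
  - by rewrite lef_pV2 ?posrE ?sqrtr_gt0// ler_wsqrtr// lerD.
  - rewrite ler_expR mulNr lerN2; apply: ler_pM.
    + exact: sqr_ge0.
    + by rewrite invr_ge0 mulr_ge0// ltW.
    + rewrite -real_normK ?num_real// lerXn2r ?nnegrE//.
      by apply: z_le; exact: AN Ay.
    + by rewrite lef_pV2 ?posrE ?mulr_gt0// ler_wpM2l// (le_trans cA)// lerDr ltW.
have two_points e p y y' : 0 < e <= 1 -> S p -> A y -> A y' ->
    (\int[nu]_(q in S) \int[P]_w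
      (mollifier V z e (p, y) w * mollifier V z e (q, y') w)%:E <= kk y y')%E.
  move=> /andP[e0 e1] Sp Ay Ay'.
  have e20 : 0 < (e ^+ 2) ^+ d by rewrite !exprn_gt0.
  pose G q : \bar R := (\int[P]_w
      (mollifier V z e (p, y) w * mollifier V z e (q, y') w)%:E)%E.
  have G0 q : (0 <= G q)%E.
    by apply: integral_ge0 => w _; rewrite lee_fin mulr_ge0// mollifier_ge0.
  have mm := @measurable_mollifier R d _ E _ W _ 'rV[R]_d V z mV mz e.
  have mG : measurable_fun setT G.
    have mgg : measurable_fun setT (fun qw : E * W =>
        (mollifier V z e (p, y) qw.2 * mollifier V z e (qw.1, y') qw.2)%:E).
      apply/measurable_EFinP; apply: measurable_funM.
        exact: measurableT_comp (measurableT_comp mm (measurable_pair1 (p, y))) measurable_snd.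
      have h2 : measurable_fun setT (fun qw : E * W => ((qw.1, y'), qw.2)).
        apply: measurable_fun_pair; last exact: measurable_snd.
        by apply: measurable_fun_pair; [exact: measurable_fst|exact: measurable_cst].
      exact: (measurableT_comp mm h2).
    have gg0 (qw : E * W) : (0 <= (mollifier V z e (p, y) qw.2 *
        mollifier V z e (qw.1, y') qw.2)%:E :> \bar R)%E.
      by rewrite lee_fin mulr_ge0// mollifier_ge0.
    exact: (@measurable_fun_fubini_tonelli_F _ _ _ _ _ P _ mgg gg0).
  have GE q : G q = (((e ^+ 2) ^+ d)^-1%:E * \int[P]_w (\prod_i
      (gauss ((V i p w - z i y) / e) * gauss ((V i q w - z i y') / e)))%:E)%E.
    rewrite /G -ge0_integralZl//; last 3 first.
    - under eq_fun do rewrite big_split/=.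
      by apply/measurable_EFinP; exact: measurable_funM.
    - by move=> w _; rewrite lee_fin prodr_ge0// => i _; rewrite mulr_ge0// gauss_ge0.
    - by rewrite lee_fin invr_ge0 ltW.
    apply: eq_integral => w _; rewrite !mollE -EFinM big_split/=; congr EFin.
    by rewrite mulrACA -exprMn -exprVn expr2 invfM.
  have Gb q : S q ->
      (0 < sup_dist (phi p) (phi q) ->
        (G q <= (C' * sup_dist (phi p) (phi q) `^ (- (eta * d%:R)))%:E)%E) /\
      (0 < enorm (y - y') -> (G q <= (C' * enorm (y - y') ^- d)%:E)%E).
    move=> Sq; have [cA Bc AB cond] := covb p q Sp Sq.
    have := hC2 _ W P (fun i => V i p) (fun i => V i q) _ _ _ _ e
      (fun i => z i y) (fun i => z i y') (mVp ^~ p) (mVp ^~ q)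
      (fun a b c => decorrelated_cos sigma_inv solu a b c (tS p Sp) (tS q Sq))
      cA Bc (sup_dist_ge0 (phi p) (phi q)) AB cond e0 (fun i => z_le i (AN _ Ay)).
    rewrite /=; set I := (\int[P]_w _)%E => -[hdel hr]; rewrite GE -/I.
    have scale X : (I <= (C2 * (e ^+ 2) ^+ d * X)%:E)%E ->
        (((e ^+ 2) ^+ d)^-1%:E * I <= (C2 * X)%:E)%E.
      move=> IX; apply: (@le_trans _ _ (((e ^+ 2) ^+ d)^-1%:E *
          (C2 * (e ^+ 2) ^+ d * X)%:E)%E).
        by apply: lee_wpmul2l => //; rewrite lee_fin invr_ge0 ltW.
      rewrite -EFinM lee_fin le_eqVlt; apply/orP; left; apply/eqP.
      by move: ((e ^+ 2) ^+ d) e20 => x x0; field; rewrite gt_eqF.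
    split=> [del0|r0].
      apply: (le_trans (scale _ (hdel del0))).
      by rewrite lee_fin ler_wpM2r ?powR_ge0.
    have rz := enorm_z y y'; set rr := Num.sqrt _ in rz hr.
    have rr0 : 0 < rr.
      by rewrite -(pmulr_rgt0 _ L0) (lt_le_trans r0).
    apply: (le_trans (scale _ (hr rr0))).
    rewrite lee_fin /C' -mulrA ler_wpM2l ?(ltW C20)//.
    rewrite -exprVn -exprVn -exprMn lerXn2r ?nnegrE ?mulr_ge0 ?invr_ge0 ?(ltW L0) ?(ltW r0) ?(ltW rr0)//.
    by rewrite ler_pdivlMr// mulrC ler_pdivrMr.
  pose f q : \bar R := (C'^-1%:E * G q)%E.
  have C'V : 0 <= C'^-1 by rewrite invr_ge0 ltW.
  have fle X q : (G q <= (C' * X)%:E)%E -> (f q <= X%:E)%E.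
    move=> GX; apply: (@le_trans _ _ (C'^-1%:E * (C' * X)%:E)%E).
      by apply: lee_wpmul2l.
    by rewrite -EFinM mulrA mulVf ?mul1r// gt_eqF.
  have msup : measurable_fun setT (fun q => sup_dist (phi p) (phi q)).
    apply: measurable_maxr.
      apply: measurableT_comp => //; apply: measurable_funB => //.
      exact: measurableT_comp measurable_fst mphi.
    apply: (measurableT_comp (continuous_measurable_rV (@norm_continuous _ 'rV[R]_k))).
    apply: measurable_rVP => i; under eq_fun do rewrite !mxE.
    apply: measurable_funB => //.
    exact: (measurableT_comp (measurable_coord i) (measurableT_comp measurable_snd mphi)).
  have := hCk _ E nu (fun q => sup_dist (phi p) (phi q)) S f (enorm (y - y'))
    msup (fun q => sup_dist_ge0 _ _) (fun r => Snu p r Sp) mS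
    (fun q Sq => SD p q Sp Sq) _ _ (dist_le y y' Ay Ay') _ _.
  rewrite -/ga => hk.
  have fS : (\int[nu]_(q in S) f q <= Ck%:E * riesz_kernel cstar ga (enorm (y - y')))%E.
    apply: hk.
    - by apply: measurable_funTS; exact: measurable_funeM.
    - by move=> q _; rewrite mule_ge0// lee_fin.
    - by move=> q Sq del0; apply: fle; exact: (Gb q Sq).1.
    - by move=> q Sq r0; apply: fle; exact: (Gb q Sq).2.
  rewrite /kk max_r; last exact: kernel0.
  apply: (@le_trans _ _ (C'%:E * \int[nu]_(q in S) f q)%E); last first.
    by rewrite [in leRHS]EFinM -[leRHS]muleA; apply: lee_wpmul2l => //; rewrite lee_fin ltW.
  rewrite -ge0_integralZl//; last 3 first.
  - by apply: measurable_funTS; exact: measurable_funeM.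
  - by move=> q _; rewrite mule_ge0// lee_fin.
  - by rewrite lee_fin ltW.
  rewrite le_eqVlt; apply/orP; left; apply/eqP; apply: eq_integral => q _.
  by rewrite /f muleA -EFinM mulfV ?gt_eqF// mul1e.
have energy_le (mu : probability 'rV[R]_d R) F : measurable F -> F `<=` A ->
    (\int[mu]_(y in F) \int[mu]_(y' in F) kk y y' <=
      (C' * Ck)%:E * energy cstar ga A mu)%E.
  move=> mF FA.
  have mkk1 B y : measurable_fun B (fun y' => kk y y').
    by apply: measurable_funTS; exact: (measurableT_comp mkk (measurable_pair1 y)).
  have mk2 B : measurable B -> measurable_fun setT (fun y => \int[mu]_(y' in B) kk y y')%E.
    move=> mB; apply: (@measurable_integral_section R _ _ _ _ mu B
      (fun yy => kk yy.1 yy.2)) => //.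
  apply: (@le_trans _ _ (\int[mu]_(y in A) \int[mu]_(y' in A) kk y y')%E).
    apply: (@le_trans _ _ (\int[mu]_(y in F) \int[mu]_(y' in A) kk y y')%E).
      apply: ge0_le_integral => //.
      - by move=> y _; apply: integral_ge0.
      - by apply: measurable_funTS; exact: mk2.
      - by apply: measurable_funTS; exact: mk2.
      - move=> y _; apply: ge0_subset_integral; [exact: mF|exact: mA|exact: mkk1| |exact: FA].
        by move=> y' _; exact: kk0.
    apply: ge0_subset_integral => //.
    - by apply: measurable_funTS; exact: mk2.
    - by move=> y _; apply: integral_ge0.
  pose h (y y' : 'rV[R]_d) : \bar R := maxe 0%E (riesz_kernel cstar ga (enorm (y - y'))).
  have h0 y y' : (0 <= h y y')%E by rewrite le_max lexx.
  have mh1 B y : measurable_fun B (fun y' => h y y').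
    by apply: measurable_funTS; exact: (measurableT_comp mh (measurable_pair1 y)).
  have mh2 : measurable_fun setT (fun y => \int[mu]_(y' in A) h y y')%E.
    apply: (@measurable_integral_section R _ _ _ _ mu A (fun yy => h yy.1 yy.2)) => //.
  have -> : energy cstar ga A mu = (\int[mu]_(y in A) \int[mu]_(y' in A) h y y')%E.
    apply: eq_integral => y /set_mem Ay; apply: eq_integral => y' /set_mem Ay'.
    by rewrite /h max_r//; exact: kernel0.
  rewrite -ge0_integralZl//; last 3 first.
  - exact: measurable_funTS.
  - by move=> y _; exact: integral_ge0.
  - by rewrite lee_fin ltW.
  rewrite le_eqVlt; apply/orP; left; apply/eqP; apply: eq_integral => y _.
  have CC : (0 <= (C' * Ck)%:E :> \bar R)%E by rewrite lee_fin ltW.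
  exact: (@ge0_integralZl _ _ R mu A mA (h y) (mh1 A y) _ (fun y' _ => h0 y y') CC).
have no_hit w F : compact F -> F `<=` A -> ~ hitting_event u (phi @` S) A w ->
    exists2 e, 0 < e & forall p y, S p -> F y -> exists i, e <= `|V i p w - z i y|.
  move=> cptF FA nH.
  have [e e0 he] : exists2 e, 0 < e & forall q y, (phi @` S) q -> F y ->
      exists i, e <= `|decorrelated T sigma u i q w - z i y|.
    apply: (compact_far d1 cS cptF).
    - by move=> i; exact: cV.
    - by move=> i; exact: continuous_mulmx.
    move=> _ y [x Sx <-] Fy; apply: contrapT => /forallNP hV; apply: nH.
    exists y; split; last exact: FA.
    exists (phi x); first by exists x.
    apply: (decorrelated_solution sigma_inv (tS x Sx)) => i.
    by apply/eqP/negPn/negP; exact: hV.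
  by exists e => // p y Sp Fy; apply: he => //; exists p.
apply: capacity_le => //.
- by rewrite divr_gt0 ?mulr_gt0// exprn_gt0.
- move=> mu b x muA b0 /andP[x0 x1] Eb.
  (* The closed subset [F] of the cube is compact and has mass at least [x]. *)
  have [F [cF FA mAF]] := @probability_inner_closed R d mu A (1 - x) mA
    (ltac:(by rewrite subr_gt0)).
  have mF : measurable F by exact: closed_measurable_rV.
  have [ka kaE] : exists ka, mu F = ka%:E.
    by exists (fine (mu F)); rewrite fineK// fin_num_measure.
  have xka : x <= ka.
    have : (mu A <= mu F + mu (A `\` F))%E.
      rewrite -measureU//; last 2 first.
      - exact: measurableD.
      - by apply/seteqP; split => y // [Fy [_]].
      apply: le_measure; rewrite ?inE//; first by apply: measurableU => //; exact: measurableD.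
      by move=> y Ay; have [Fy|Fy] := pselect (F y); [left|right].
    rewrite muA kaE => /le_trans; move=> /(_ _ (leeD2l _ mAF)).
    by rewrite -EFinD lee_fin; lra.
  have ka0 : 0 < ka by rewrite (lt_le_trans x0).
  have cptF : compact F.
    have := @rV_compact R d (fun=> `[- N, N]%classic) (fun=> segment_compact (a := - N) (b := N)).
    move=> cB; apply: (subclosed_compact cF cB) => y Fy i; rewrite /= in_itv/= -ler_norml.
    exact: AN (FA _ Fy) i.
  have b'0 : 0 < C' * Ck * b by rewrite mulr_gt0.
  apply: (@le_trans _ _ (clow ^+ 2 * s * ka ^+ 2 / (4 * (C' * Ck * b)))%:E).
    rewrite lee_fin.
    have -> : clow ^+ 2 * s / (4 * (C' * Ck)) * x ^+ 2 / b =
      clow ^+ 2 * s / (4 * (C' * Ck * b)) * x ^+ 2.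
      by field; rewrite !gt_eqF.
    rewrite [leRHS]mulrAC ler_wpM2l//.
      apply: divr_ge0; first by rewrite mulr_ge0 ?sqr_ge0 ?(ltW s0).
      by rewrite mulr_ge0 ?(ltW b'0).
    by rewrite lerXn2r ?nnegrE ?(ltW x0) ?(ltW ka0).
  apply: (@hitting_prob_ge R d _ E _ W _ _ P mu nu V z S F mS mF mV mz clow s ka
    (C' * Ck * b) kk) => //.
  + by move=> e p y e01 Sp Fy; apply: one_point => //; exact: FA.
  + by move=> e p y y' e01 Sp Fy Fy'; apply: two_points => //; exact: FA.
  + exact: (le_trans (energy_le mu F mF FA) (lee_wpmul2l (ltW CC0 : (0%:E <= (C' * Ck)%:E)%E) Eb)).
  + by move=> w nH; apply: (no_hit w F cptF FA nH).
- move=> mu muA; apply: integral_ge0 => y Ay; apply: integral_ge0 => y' Ay'.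
  exact: kernel0.
Qed.

End hitting_estimate.

(** * The three parameter sets *)

Section parameter_sets.
Context {R : realType}.

Lemma measurable_rV_ball (k : nat) (x : 'rV[R]_k) (r : R) :
  measurable [set y : 'rV[R]_k | `|x - y| <= r].
Proof.
apply: measurable_sublevel.
apply: (measurableT_comp (continuous_measurable_rV (@norm_continuous _ 'rV[R]_k))).
apply: measurable_rVP => i; under eq_fun do rewrite !mxE.
by apply: measurable_funB => //; exact: measurable_coord.
Qed.

Lemma lebesgue_rV_ball_le (k : nat) (x : 'rV[R]_k) (r : R) : 0 < r ->
  (lebesgue_rV R k [set y | (`|x - y| <= r)%R] <= (2 ^+ k * r ^+ k)%:E)%E.
Proof.
move=> r0; pose B (i : 'I_k) : set R := `[x 0 i - r, x 0 i + r]%classic.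
have mB i : measurable (B i) by exact: measurable_itv.
apply: (@le_trans _ _ (lebesgue_rV R k [set v | forall i, B i (v 0 i)])).
  apply: le_measure; rewrite ?inE.
  - exact: measurable_rV_ball.
  - exact: measurable_rV_box.
  - move=> y /= xy i; rewrite /B/= in_itv/= -ler_distl distrC.
    by apply: le_trans xy; have := rV_coord_le (x - y) i; rewrite !mxE.
rewrite lebesgue_rV_box// -exprMn.
rewrite (eq_bigr (fun=> (2 * r)%:E)); last first.
  move=> i _; rewrite lebesgue_measure_itv/= lte_fin ifT; last by rewrite ltrD2l gtrN.
  by rewrite -EFinB; congr EFin; ring.
by rewrite prodEFin lee_fin prodr_const card_ord.
Qed.

Lemma compact_bound_rV (k : nat) (J : set 'rV[R]_k) : compact J ->
  exists2 M : R, 0 < M & forall v, J v -> `|v| <= M.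
Proof.
by move=> /compact_bounded/ex_strict_bound_gt0[M M0 h]; exists M => // v /h/ltW.
Qed.

Lemma compact_lebesgue_rV_fin (k : nat) (J : set 'rV[R]_k) : compact J ->
  measurable J /\ (lebesgue_rV R k J < +oo)%E.
Proof.
move=> cJ; have cl : closed J by apply: compact_closed => //; exact: norm_hausdorff.
have mJ := closed_measurable_rV cl; split => //.
have [M M0 JM] := compact_bound_rV cJ.
have h := lebesgue_rV_ball_le (0 : 'rV[R]_k) M0.
apply: (le_lt_trans _ (ltry (2 ^+ k * M ^+ k))); apply: le_trans h.
apply: le_measure; rewrite ?inE//; first exact: measurable_rV_ball.
by move=> v Jv /=; rewrite sub0r normrN JM.
Qed.

Lemma lebesgue_ball_le (x r : R) : 0 < r ->
  (lebesgue_measure [set y : R | (`|x - y| <= r)%R] <= (2 * r)%:E)%E.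
Proof.
move=> r0; rewrite (_ : [set y | _] = `[x - r, x + r]%classic); last first.
  by apply/seteqP; split => y /=; rewrite in_itv/= distrC ler_distl.
rewrite lebesgue_measure_itv/= lte_fin ifT; last by rewrite ltrD2l gtrN.
by rewrite -EFinB lee_fin; lra.
Qed.

Lemma compact_lebesgue_fin (I : set R) : compact I ->
  measurable I /\ (lebesgue_measure I < +oo)%E.
Proof.
by move=> cI; split; [exact: compact_measurable|exact: compact_finite_measure].
Qed.

End parameter_sets.

Theorem theorem4p4 (R : realType) (k d : nat) (beta N cstar : R)
    (sigma : 'M[R]_d)
    (k_ge1 : (1 <= k)%N) (d_ge1 : (1 <= d)%N)
    (beta_gt0 : 0 < beta) (beta_lt : beta < Num.min 2 k%:R)
    (sigma_inv : sigma \in unitmx) (N_gt0 : 0 < N)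
    (cstar_large : 2 * N * Num.sqrt d%:R < cstar) :
  [/\ (forall (I : set R) (J : set 'rV[R]_k),
        exists2 c : R, 0 < c &
        forall t0 T : R, time_space_setting t0 T I J ->
        forall (disp : measure_display) (W : measurableType disp)
          (P : probability W R) (u : R * 'rV[R]_k -> W -> 'rV[R]_d),
        wave_solution beta T sigma P u ->
        forall A : set 'rV[R]_d, measurable A ->
        A `<=` [set v : 'rV[R]_d | forall i, `|v 0 i| <= N] ->
        (c%:E * capacity cstar (d%:R - 2 * k.+1%:R / (2 - beta)) A
           <= inner_prob P (hitting_event u (I `*` J) A))%E),
      (forall (J : set 'rV[R]_k) (t : R),
        exists2 c : R, 0 < c &
        forall (t0 T : R) (I : set R), time_space_setting t0 T I J -> I t ->
        forall (disp : measure_display) (W : measurableType disp)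
          (P : probability W R) (u : R * 'rV[R]_k -> W -> 'rV[R]_d),
        wave_solution beta T sigma P u ->
        forall A : set 'rV[R]_d, measurable A ->
        A `<=` [set v : 'rV[R]_d | forall i, `|v 0 i| <= N] ->
        (c%:E * capacity cstar (d%:R - 2 * k%:R / (2 - beta)) A
           <= inner_prob P (hitting_event u ([set t] `*` J) A))%E)
    & (forall (I : set R) (x : 'rV[R]_k),
        exists2 c : R, 0 < c &
        forall (t0 T : R) (J : set 'rV[R]_k), time_space_setting t0 T I J ->
        J x ->
        forall (disp : measure_display) (W : measurableType disp)
          (P : probability W R) (u : R * 'rV[R]_k -> W -> 'rV[R]_d),
        wave_solution beta T sigma P u ->
        forall A : set 'rV[R]_d, measurable A ->
        A `<=` [set v : 'rV[R]_d | forall i, `|v 0 i| <= N] ->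
        (c%:E * capacity cstar (d%:R - 2 / (2 - beta)) A
           <= inner_prob P (hitting_event u (I `*` [set x]) A))%E)].
Proof.
have beta2 : beta < 2 by apply: (lt_le_trans beta_lt); rewrite ge_min lexx.
have betak : beta < k%:R by apply: (lt_le_trans beta_lt); rewrite ge_min lexx orbT.
have b20 : 2 - beta != 0 by rewrite gt_eqF// subr_gt0.
have indexE (m : nat) : d%:R - 2 * m%:R / (2 - beta) = d%:R - m%:R / ((2 - beta) / 2).
  by rewrite invf_div; field.
have key := hitting_capacity_ge k_ge1 d_ge1 beta_gt0 beta2 betak sigma_inv N_gt0
  cstar_large.
have fin dT (T : measurableType dT) (mu : {measure set T -> \bar R}) (A : set T) :
    (0 < mu A)%E -> (mu A < +oo)%E -> exists2 s, 0 < s & mu A = s%:E.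
  move=> A0 Aoo; exists (fine (mu A)); first by rewrite fine_gt0// A0.
  by rewrite fineK// ge0_fin_numE// ltW.
split.
- move=> I J.
  (* The constant precedes [t0] and [T]: it is taken from one admissible choice of
     them, and then serves all others, because only [I] and [J] enter. *)
  have [[t0 [T hIJ]]|hno] := pselect (exists t0 T, time_space_setting t0 T I J); last first.
    by exists 1 => // t0 T hIJ; case: hno; exists t0, T.
  have [/andP[t00 _] [cI It] cJ I0 J0] := hIJ.
  have [mI Ioo] := compact_lebesgue_fin cI.
  have [mJ Joo] := compact_lebesgue_rV_fin cJ.
  have [M M0 JM] := compact_bound_rV cJ.
  have [s s0 sE] := fin _ _ _ _ I0 Ioo; have [s' s'0 s'E] := fin _ _ _ _ J0 Joo.
  have D0 : 0 < `|T - t0| + 2 * M by rewrite ltr_wpDl// mulr_gt0.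
  (* Growth: a ball of radius [r] has time extent [2 r] and space volume [(2 r)^k]. *)
  have [c c0 hc] := key t0 T (`|T - t0| + 2 * M) (2 ^+ k.+1) (s * s') k.+1 t00 D0
    (exprn_ge0 _ (ler0n R 2)) (mulr_gt0 s0 s'0) isT.
  exists c => // t1 T1 [_ [_ It1] _ _ _] disp W P u solu A mA AN.
  rewrite indexE.
  have imE : [set (x.1 : R, x.2) | x in I `*` J] = I `*` J.
    apply/seteqP; split => [_ [[a b] h <-]//|[a b] h]; by exists (a, b).
  have := hc _ (measurableTypeR R * 'rV[R]_k)%type
    (prod_measure (@lebesgue_measure R) (lebesgue_rV R k))
    (fun x => (x.1 : R, x.2)) (I `*` J); rewrite imE => h; apply: (h _ _ _ _ _ _ _ T1 _ _ W P u solu A mA AN) => //.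
  + by apply: measurable_fun_pair; [exact: measurable_fst|exact: measurable_snd].
  + exact: measurableX.
  + by rewrite [LHS]prod_measureE// sE s'E.
  + exact: compact_setX.
  + by move=> [a b] [/= Ia _]; have := It a Ia; rewrite /= in_itv.
  + move=> [a b] [a' b'] [/= Ia Jb] [/= Ia' Jb']; rewrite /sup_dist/= ge_max.
    have := It a Ia; have := It a' Ia'; rewrite /= !in_itv/= => /andP[h1 h2] /andP[h3 h4].
    have TT := ler_norm (T - t0).
    apply/andP; split; last first.
      rewrite (le_trans (ler_normB _ _))// -[leLHS]add0r lerD// mulr_natl mulr2n.
      by rewrite lerD// JM.
    by rewrite (le_trans _ (le_trans TT _)) ?lerDl ?mulr_ge0 ?(ltW M0)// ler_norml;
      clear -h1 h2 h3 h4; apply/andP; split; lra.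
  + move=> [a b] r _ r0; rewrite /sup_dist/=.
    have mB : measurable [set y : measurableTypeR R | `|a - y| <= r].
      rewrite (_ : [set y | _] = `[a - r, a + r]%classic); first exact: measurable_itv.
      by apply/seteqP; split => y /=; rewrite in_itv/= distrC ler_distl.
    rewrite [X in (_ X <= _)%E](_ : _ = [set y : measurableTypeR R | `|a - y| <= r] `*`
        [set y : 'rV[R]_k | `|b - y| <= r]); last first.
      by apply/seteqP; split => -[y y'] /=; rewrite ge_max => /andP.
    rewrite [leLHS]prod_measureE//; last exact: measurable_rV_ball.
    apply: (le_trans (lee_pmul _ _ (lebesgue_ball_le a r0) (lebesgue_rV_ball_le b r0))) => //.
    by rewrite -EFinM lee_fin !exprS le_eqVlt; apply/orP; left; apply/eqP; ring.
  + by move=> [a b] [/= Ia _]; have := It1 a Ia; rewrite /= in_itv => /andP[].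
- move=> J t.
  have [[t0 [T [I [hIJ It]]]]|hno] :=
      pselect (exists t0 T I, time_space_setting t0 T I J /\ I t); last first.
    by exists 1 => // t0 T I hIJ It; case: hno; exists t0, T, I.
  have [/andP[t00 _] [cI Itt] cJ I0 J0] := hIJ.
  have t_gt0 : 0 < t by have := Itt t It; rewrite /= in_itv/= => /andP[/(lt_le_trans t00)].
  have [mJ Joo] := compact_lebesgue_rV_fin cJ.
  have [M M0 JM] := compact_bound_rV cJ.
  have [s s0 sE] := fin _ _ _ _ J0 Joo.
  have D0 : 0 < 2 * M by rewrite mulr_gt0.
  have [c c0 hc] := key t t (2 * M) (2 ^+ k) s k t_gt0 D0 (exprn_ge0 _ (ler0n R 2)) s0 k_ge1.
  exists c => // t1 T1 I1 [_ [_ It1] _ _ _] I1t disp W P u solu A mA AN.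
  rewrite indexE.
  have imE : [set (t, x) | x in J] = [set t] `*` J.
    apply/seteqP; split => [_ [x Jx <-]//|[a b] [/= -> Jb]]; by exists b.
  have := hc _ 'rV[R]_k (lebesgue_rV R k) (fun x => (t, x)) J; rewrite imE => h; apply: (h _ _ _ _ _ _ _ T1 _ _ W P u solu A mA AN) => //.
  + exact: measurable_fun_pair.
  + by apply: compact_setX => //; exact: compact_set1.
  + by move=> x Jx /=; rewrite lexx.
  + move=> x y Jx Jy; rewrite /sup_dist/= subrr normr0 ge_max mulr_ge0 ?(ltW M0)//=.
    by rewrite (le_trans (ler_normB _ _))// mulr_natl mulr2n lerD// JM.
  + move=> x r _ r0; rewrite /sup_dist/= subrr normr0.
    rewrite [X in (_ X <= _)%E](_ : _ = [set y : 'rV[R]_k | `|x - y| <= r]).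
      exact: lebesgue_rV_ball_le.
    by apply/seteqP; split => y /=; rewrite ge_max (ltW r0).
  + by move=> x _ /=; have := It1 t I1t; rewrite /= in_itv => /andP[].
- move=> I x.
  have [[t0 [T [J hIJ]]]|hno] :=
      pselect (exists t0 T (J : set 'rV[R]_k), time_space_setting t0 T I J); last first.
    by exists 1 => // t0 T J hIJ; case: hno; exists t0, T, J.
  have [/andP[t00 t0T] [cI It] cJ I0 J0] := hIJ.
  have [mI Ioo] := compact_lebesgue_fin cI.
  have [s s0 sE] := fin _ _ _ _ I0 Ioo.
  have D0 : 0 < T - t0 by rewrite subr_gt0.
  have [c c0 hc] := key t0 T (T - t0) 2 s 1%N t00 D0 (ler0n R 2) s0 isT.
  exists c => // t1 T1 J1 [_ [_ It1] _ _ _] _ disp W P u solu A mA AN.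
  have imE : [set (t : R, x) | t in I] = I `*` [set x].
    apply/seteqP; split => [_ [y Iy <-]//|[a b] [/= Ia ->]]; by exists a.
  have := indexE 1%N; rewrite mulr1 => ->.
  have := hc _ (measurableTypeR R) (@lebesgue_measure R) (fun t => (t : R, x)) I.
  rewrite imE => h; apply: (h _ _ _ _ _ _ _ T1 _ _ W P u solu A mA AN) => //.
  + by apply: compact_setX => //; exact: compact_set1.
  + move=> a a' Ia Ia'; rewrite /sup_dist/= subrr normr0 ge_max (ltW D0) andbT.
    have := It a Ia; have := It a' Ia'; rewrite /= !in_itv/= => /andP[h1 h2] /andP[h3 h4].
    by rewrite ler_norml; apply/andP; split; lra.
  + move=> a r _ r0; rewrite /sup_dist/= subrr normr0.
    rewrite [X in (_ X <= _)%E](_ : _ = [set y : R | `|a - y| <= r]).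
      by rewrite expr1; exact: lebesgue_ball_le.
    by apply/seteqP; split => y /=; rewrite ge_max (ltW r0) andbT.
  + by move=> a Ia /=; have := It1 a Ia; rewrite /= in_itv => /andP[].
Qed.
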